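(* Let $\omega\in\mathbb{R}\setminus\mathbb{Q}$, $\lambda=e^{2\pi i\omega}$ and $\Delta>0$. (i) For generic $F\in\mathscr{F}_{\mathrm{odd},\omega}^{\Delta}$, all formal geometric normalizations of $F$ are divergent. (i') The same conclusion holds for generic $F\in\mathscr{F}_{\mathrm{odd},\omega}^{\Delta}\cap\{\Gamma\neq \mathrm{Id}\}$, the set of those $F\in\mathscr{F}_{\mathrm{odd},\omega}^\Delta$ that are not formally conservative. (ii) Let $N\ge2$ be an integer and let $J(z)=\lambda z+\sum_{2\le j+k\le N}J_{jk}z^j\bar z^k$ ($J_{jk}\in\mathbb{C}$) be odd. Assume that there exist infinitely many integers $k>0$ such that $|\lambda^{2k}-1|^{-1}\ge k!$. Then for generic $F\in\mathscr{F}_{\mathrm{odd},\omega,J}^{\Delta}$, all formal geometric normalizations of $F$ are divergent. (iii) Let $N\ge 2$ be an integer and let $J(z)=\lambda z+\sum_{2\le k\le N}J_kz^k$ ($J_k\in\mathbb{C}$) be odd. Then there exists $\Delta_0>0$ such that, if $\Delta\le\Delta_0$ and if $\omega$ is a non-Bruno number, then for generic $F\in\mathscr{F}_{\mathrm{odd},\omega,J}^{\Delta}$ all formal geometric normalizations of $F$ are divergent. (iv) Let $N\ge 2$ be an integer and let $J(z)=\lambda z+\sum_{2\le j+k\le N}J_{jk}z^j\bar z^k$ be an odd polynomial that is the $N$-jet of an area-preserving map. Then for generic $F\in\mathscr{F}_{\mathrm{odd},\omega,J}^{\Delta}$ all formal geometric normalizations of $F$ are divergent (with no other assumption than $\ome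ga\in\mathbb{R}\setminus\mathbb{Q}$).
   Context: $\mathbb{R}^2$ is identified with $\mathbb{C}$. $\mathscr{F}_\omega$ is the set of formal diffeomorphisms $F(z)=\lambda z+\sum_{j+k\ge2}F_{jk}z^j\bar z^k$, $F_{jk}\in\mathbb{C}$. In formal series, $z,\bar z$ are treated as independent indeterminates; the conjugate of $F=\sum F_{jk}z^j\bar z^k$ is $\tilde F=\overline{F}=\sum\overline{F_{jk}}\,z^k\bar z^j$, and composition with $F$ on the right means substituting $(z,\bar z)\mapsto(F,\overline F)$. A formal geometric normalization of $F\in\mathscr F_\omega$ is a formal tangent-to-identity diffeomorphism $\Phi(z)=z+\sum_{j+k\ge2}\phi_{jk}z^j\bar z^k$ ($\phi_{jk}\in\mathbb{C}$) such that $G=\Phi\circ F\circ\Phi^{-1}$ satisfies $|G(\zeta)|^2=\Gamma(|\zeta|^2)$ for some $\Gamma(R)=R+\sum_{n\ge2}\Gamma_nR^n$ with $\Gamma_n\in\mathbb{R}$. Every $F\in\mathscr F_\omega$ has formal geometric normalizations, and the conjugacy class of $\Gamma$ in the group of formal series $R+\sum_{n\ge2}g_nR^n$ with real coefficients depends only on $F$; $F$ is called formally conservative if $\Gamma=\mathrm{Id}$. A formal series $\sum a_{jk}z^j\bar z^k$ is convergent if $\sum|a_{jk}|\rho_1^j\rho_2^k<\infty$ for some $\rho_1,\rho_2>0$; otherwise it is divergent. The complex extension of $F$ is $\hat F(z,w)=(F(z,w),\tilde F(z,w))$, where $F(z,w)=\lambda z+\sum F_{jk}z^jw^k$ and $\tilde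 F(z,w)=\bar\lambda w+\sum\overline{F_{jk}}\,z^kw^j$. For $\Delta>0$, $B_\Delta=\{(z,w)\in\mathbb{C}^2: |z|<\Delta,|w|<\Delta\}$ and $\mathscr{F}_\omega^{\Delta}$ is the set of analytic $F\in\mathscr F_\omega$ whose complex extension $\hat F$ is holomorphic in $B_\Delta$, with the compact-open topology (uniform convergence of $\hat F$ on compact subsets of $B_\Delta$). $\mathscr F_{\mathrm{odd},\omega}^{\Delta}=\{F\in\mathscr F_\omega^\Delta: F(-z)=-F(z)\}$, and for an integer $N\ge2$ and an odd polynomial $J(z)=\lambda z+\sum_{2\le j+k\le N}J_{jk}z^j\bar z^k$ with $J_{jk}\in\mathbb{C}$, $\mathscr F_{\mathrm{odd},\omega,J}^{\Delta}=\{F\in\mathscr F_{\mathrm{odd},\omega}^{\Delta}: F=J+O(|z|^{N+1})\}$. Subsets carry the induced topology. A property holds for generic $F$ in one of these spaces if it holds on a dense $G_\delta$ subset of that space. A number $\omega$ is non-Bruno if $\sum_{k\ge0}\frac{\ln q_{k+1}}{q_k}=+\infty$, where $(p_k/q_k)_{k\ge0}$ are the convergents of the continued fraction expansion of $\omega$. A formal map of $(\mathbb{R}^2,0)$ is area-preserving if its Jacobian determinant in the real coordinates $(x,y)$, $z=x+iy$, is identically $1$. *)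

(* Defs.v *)
From HB Require Import structures.
From mathcomp Require Import all_boot all_order all_algebra.
From mathcomp Require Import all_classical all_reals all_analysis.
From mathcomp Require Import borel_hierarchy complex.
Set Implicit Arguments.
Unset Strict Implicit.
Unset Printing Implicit Defensive.
Import Order.TTheory GRing.Theory Num.Theory numFieldNormedType.Exports.
Local Open Scope classical_set_scope.
Local Open Scope ring_scope.

(* [f j k] is the coefficient of z^j w^k, the second indeterminate w standing
   for the conjugate of z. *)
Notation fps A := (nat -> nat -> A).

Section FormalSeries.
Variable A : comNzRingType.
Implicit Types f g u v : fps A.

Definition fps_one : fps A := fun j k => ((j == 0%N) && (k == 0%N))%:R.

Definition fps_lin (a b : A) : fps A := fun j k =>
  if (j == 1%N) && (k == 0%N) then a
  else if (j == 0%N) && (k == 1%N) then b else 0.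

Definition fps_mul f g : fps A := fun j k =>
  \sum_(a < j.+1) \sum_(b < k.+1) f a b * g (j - a)%N (k - b)%N.

Definition fps_exp f (n : nat) : fps A := iter n (fps_mul f) fps_one.

(* f(u, v), for u and v without constant term: a monomial z^a w^b of f with
   a + b > j + k then does not contribute to the coefficient (j, k), so the
   truncated sum is the full one. *)
Definition fps_subst f u v : fps A := fun j k =>
  \sum_(a < (j + k).+1) \sum_(b < (j + k).+1)
    f a b * fps_mul (fps_exp u a) (fps_exp v b) j k.

Definition fps_d1 f : fps A := fun j k => j.+1%:R * f j.+1 k.
Definition fps_d2 f : fps A := fun j k => k.+1%:R * f j k.+1.

End FormalSeries.

Section Maps.
Variable R : realType.
Implicit Types (F G Phi Psi : fps R[i]) (Gam : nat -> R) (l : R[i]).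

Definition fps_conj F : fps R[i] := fun j k => ((F k j)^*)%C.

Definition fps_comp F G : fps R[i] := fps_subst F G (fps_conj G).

Definition fps_id : fps R[i] := fps_lin 1 0.

(* F = l z + (terms of degree at least 2) *)
Definition multiplier l F : Prop :=
  [/\ F 0%N 0%N = 0, F 1%N 0%N = l & F 0%N 1%N = 0].

(* F(-z) = - F(z) *)
Definition odd_map F : Prop := forall j k, (-1) ^+ (j + k) * F j k = - F j k.

(* Gam(z w), that is Gam(|z|^2) *)
Definition radial Gam : fps R[i] := fun j k =>
  if j == k then ((Gam j)%:C)%C else 0.

Definition geometric_normalization F Phi Gam : Prop :=
  [/\ multiplier 1 Phi,
      Gam 0%N = 0 /\ Gam 1%N = 1
    & exists Psi, [/\ multiplier 1 Psi,
        fps_comp Phi Psi = fps_id, fps_comp Psi Phi = fps_id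
      & let G := fps_comp (fps_comp Phi F) Psi in
        fps_mul G (fps_conj G) = radial Gam]].

(* Gam depends on the normalization only up to conjugacy, and the identity is
   alone in its conjugacy class. *)
Definition formally_conservative F : Prop :=
  exists Phi, geometric_normalization F Phi (fun n => (n == 1%N)%:R).

(* The Jacobian determinant of (x, y) |-> (U, V), where
   F(x + i y, x - i y) = U(x, y) + i V(x, y) with U, V real series. *)
Definition real_coords F : fps R[i] :=
  fps_subst F (fps_lin 1 'i%C) (fps_lin 1 (- 'i%C)).

Definition fps_jacobian F : fps R := fun j k =>
  let U : fps R := fun a b => complex.Re (real_coords F a b) in
  let V : fps R := fun a b => complex.Im (real_coords F a b) in
  fps_mul (fps_d1 U) (fps_d2 V) j k - fps_mul (fps_d2 U) (fps_d1 V) j k.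

Definition area_preserving F : Prop := fps_jacobian F = fps_one R.

Definition cabs (z : R[i]) : R := complex.Re `|z|.

Definition abs_convergent_at F (r1 r2 : R) : Prop :=
  (\esum_(p in [set: nat * nat])
     (cabs (F p.1 p.2) * r1 ^+ p.1 * r2 ^+ p.2)%:E < +oo)%E.

Definition convergent F : Prop :=
  exists r1 r2 : R, [/\ 0 < r1, 0 < r2 & abs_convergent_at F r1 r2].

Definition divergent F : Prop := ~ convergent F.

Definition all_normalizations_divergent F : Prop :=
  forall Phi Gam, geometric_normalization F Phi Gam -> divergent Phi.

(* R[i]^o is R[i] with its topology and its structure of normed space over
   itself; [differentiable] below is therefore complex differentiability. *)
Local Notation C2 := (R[i]^o * R[i]^o)%type.

Definition fps_eval F (z w : R[i]^o) : R[i]^o :=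
  limn (fun n : nat => (\sum_(j < n) \sum_(k < n) F j k * z ^+ j * w ^+ k : R[i]^o)).

Definition complex_ext F (p : C2) : C2 :=
  (fps_eval F p.1 p.2, fps_eval (fps_conj F) p.1 p.2).

Definition polydisc (D : R) : set C2 := [set p | cabs p.1 < D /\ cabs p.2 < D].

Definition lambda (omega : R) : R[i] :=
  (cos (2 * pi * omega) +i* sin (2 * pi * omega))%C.

Definition Fspace (omega D : R) : set (fps R[i]) := [set F |
  [/\ multiplier (lambda omega) F,
      forall p, polydisc D p -> abs_convergent_at F (cabs p.1) (cabs p.2)
    & forall p, polydisc D p -> differentiable (complex_ext F) p]].

Definition Fodd (omega D : R) : set (fps R[i]) :=
  Fspace omega D `&` [set F | odd_map F].

Definition same_jet (N : nat) F G : Prop :=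
  forall j k, (j + k <= N)%N -> F j k = G j k.

Definition FoddJ (omega D : R) (N : nat) (J : fps R[i]) : set (fps R[i]) :=
  Fodd omega D `&` [set F | same_jet N F J].

Definition odd_polynomial (omega : R) (N : nat) (J : fps R[i]) : Prop :=
  [/\ multiplier (lambda omega) J,
      forall j k, (N < j + k)%N -> J j k = 0 & odd_map J].

(* The set X of series with the topology of uniform convergence of the complex
   extensions on the compact subsets of the polydisc of radius D. *)
Definition compact_open_space (D : R) (X : set (fps R[i])) : topologicalType :=
  initial_topology (fun F : X =>
    (complex_ext (val F) : {family compactly_in (polydisc D), C2 -> C2})).

Definition generic (D : R) (X : set (fps R[i])) (P : fps R[i] -> Prop) : Prop :=
  exists S : set (compact_open_space D X),
    [/\ Gdelta S, dense S & forall F : X, S F -> P (val F)].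

(* Continued fraction of omega: complete quotients, partial quotients, and
   denominators q_n of the convergents; [cf_denoms omega n] is (q_(n-1), q_n),
   with q_(-1) = 0. *)
Fixpoint cf_rem (omega : R) (n : nat) : R :=
  if n is m.+1 then (cf_rem omega m - (Num.floor (cf_rem omega m))%:~R)^-1
  else omega.

Definition cf_quot (omega : R) (n : nat) : int := Num.floor (cf_rem omega n).

Fixpoint cf_denoms (omega : R) (n : nat) : int * int :=
  if n is m.+1 then
    let: (q', q) := cf_denoms omega m in (q, cf_quot omega n * q + q')
  else (0, 1).

Definition cf_denom (omega : R) (n : nat) : R := ((cf_denoms omega n).2)%:~R.

Definition non_bruno (omega : R) : Prop :=
  (\sum_(0 <= k <oo) (ln (cf_denom omega k.+1) / cf_denom omega k)%:E = +oo)%E.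

End Maps.

(* Main.v *)
From HB Require Import structures.
Require Import Defs.
From mathcomp Require Import all_boot all_order all_algebra.
From mathcomp Require Import all_classical all_reals all_analysis.
From mathcomp Require Import borel_hierarchy complex.
From mathcomp Require Import zify ring lra.
Set Implicit Arguments.
Unset Strict Implicit.
Unset Printing Implicit Defensive.
Import Order.TTheory GRing.Theory Num.Theory numFieldNormedType.Exports.
Local Open Scope classical_set_scope.
Local Open Scope ring_scope.

(** The rotation by an irrational angle has no resonances but z (z w)^k, so every
    F is formally conjugate by some h to a map N made of these monomials, and
    h conj h is a formal integral: its composition with F is a function of it.
    Conversely a geometric normalization Phi yields the integral Phi conj Phi,
    and any two integrals are functions of each other ([integral_unique]). For
    odd F the resonant freedom in h can be spent so that h(x, x) = x; call
    I = h conj h the canonical integral. It equals x^2 on the line w = z, so an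
    arbitrary integral is a function e(I) in which e is read off that line. If
    the other integral converges, so does e, hence so does I: the divergence of
    I, which is a statement about F alone, makes all geometric normalizations
    diverge at once ([canonical_obstruction]).

    Each coefficient of I is a polynomial in finitely many coefficients of F and
    their conjugates, hence is continuous on the spaces at hand, and the maps
    whose canonical integral diverges form a G-delta set
    ([unbounded_canonical_Gdelta]). For density one joins a map F0 to a map F1
    with divergent canonical integral by F_s = F0 + (F1 - F0)(s z). As s tends
    to 0 this tends to F0 whatever the radius of convergence of F1, and the
    coefficients of degree n of the canonical integral are polynomials in s of
    degree O(n). If the integral of F_s converged for all s in an interval, then
    by Baire's theorem and the Bernstein-Walsh growth of polynomials it would
    converge for s = 1 as well ([extrapolation], [generic_divergence]). Non
    conservativity and a prescribed jet are kept along the way, so it only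
    remains to exhibit one divergent F1 with the required jet.

    If infinitely many small divisors are below 1/k!, adding a suitable series of odd
    powers of z with coefficients 0 and 1 makes infinitely many coefficients of
    I too large ([digit_model_divergent]). If the jet is conservative to its
    order, it is the jet of a map with normal form T(z) = z U(z w), |U| = 1,
    whose rotation number is not constant. The first variation of the integral
    along the family T(z) (1 + s y), with y the sum of large even powers of z
    and w, satisfies in each weight 2m a linear equation with denominator
    1 - U^(2m), and this vanishes at points that accumulate at 0 because the
    rotation number varies. Such a variation cannot converge, so by
    extrapolation again some member of the family has a divergent integral
    ([twist_divergent], [conservative_model]). Holomorphic jets are conservative
    since they are formally linearizable ([holomorphic_normal_form]), and jets
    of area-preserving maps because a normal form that moves the circles
    |z| = const preserves no density near 0 ([area_preserving_normal_form]). *)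

(** * The ring of formal power series in two indeterminates *)

(** An opaque copy of the function type, so that multiplication is the Cauchy
    product and not the pointwise one. *)
Definition ser (A : comNzRingType) := nat -> nat -> A.

Section SeriesRing.
Variable A : comNzRingType.
Implicit Types (f g h : ser A) (p q : {poly {poly A}}).

HB.instance Definition _ := gen_eqMixin (ser A).
HB.instance Definition _ := gen_choiceMixin (ser A).

Lemma serP f g : (forall j k, f j k = g j k) -> f = g.
Proof. by move=> fg; apply/funext => j; apply/funext => k. Qed.

Definition ser0 : ser A := fun _ _ => 0.
Definition ser_add f g : ser A := fun j k => f j k + g j k.
Definition ser_opp f : ser A := fun j k => - f j k.

Lemma ser_addA : associative ser_add.
Proof. by move=> f g h; apply: serP => j k; rewrite /ser_add addrA. Qed.
Lemma ser_addC : commutative ser_add.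
Proof. by move=> f g; apply: serP => j k; rewrite /ser_add addrC. Qed.
Lemma ser_add0 : left_id ser0 ser_add.
Proof. by move=> f; apply: serP => j k; rewrite /ser_add add0r. Qed.
Lemma ser_addN : left_inverse ser0 ser_opp ser_add.
Proof. by move=> f; apply: serP => j k; rewrite /ser_add addNr. Qed.

HB.instance Definition _ :=
  GRing.isZmodule.Build (ser A) ser_addA ser_addC ser_add0 ser_addN.

Lemma ser_addE f g j k : (f + g) j k = f j k + g j k. Proof. by []. Qed.
Lemma ser_oppE f j k : (- f) j k = - f j k. Proof. by []. Qed.
Lemma ser_subE f g j k : (f - g) j k = f j k - g j k. Proof. by []. Qed.
Lemma ser0E j k : (0 : ser A) j k = 0. Proof. by []. Qed.
Lemma ser_sumE I r (P : pred I) (F : I -> ser A) j k :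
  (\sum_(i <- r | P i) F i) j k = \sum_(i <- r | P i) F i j k.
Proof. by elim/big_rec2: _ => // i y1 y2 _ <-. Qed.

(** Truncated series are bivariate polynomials; the ring axioms for the Cauchy
    product are inherited from polynomials through [represents]. *)
Definition represents n p f :=
  forall j k, (j <= n)%N -> (k <= n)%N -> p`_j`_k = f j k.

Definition truncation n f : {poly {poly A}} :=
  \poly_(j < n.+1) \poly_(k < n.+1) f j k.

Lemma truncationP n f : represents n (truncation n f) f.
Proof. by move=> j k jn kn; rewrite coef_poly ltnS jn coef_poly ltnS kn. Qed.

Lemma coef_mul2 p q j k :
  (p * q)`_j`_k = \sum_(a < j.+1) \sum_(b < k.+1) p`_a`_b * q`_(j - a)`_(k - b).
Proof.
by rewrite coefM coef_sum; apply: eq_bigr => a _; rewrite coefM.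
Qed.

Lemma representsM n p q f g :
  represents n p f -> represents n q g -> represents n (p * q) (fps_mul f g).
Proof.
move=> pf qg j k jn kn; rewrite coef_mul2; apply: eq_bigr => a _.
apply: eq_bigr => b _; rewrite pf ?qg //; have := ltn_ord a; have := ltn_ord b; lia.
Qed.

Lemma represents_inj f g :
  (forall n, exists p, represents n p f /\ represents n p g) -> f = g.
Proof.
move=> fg; apply: serP => j k; have [p [pf pg]] := fg (maxn j k).
by rewrite -pf ?leq_maxl ?leq_maxr // pg ?leq_maxl ?leq_maxr.
Qed.

Lemma ser_mulA : associative (@fps_mul A : ser A -> ser A -> ser A).
Proof.
move=> f g h; apply: represents_inj => n.
exists (truncation n f * truncation n g * truncation n h); split.
  by rewrite -mulrA; do 2?apply: representsM; apply: truncationP.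
by do 2?apply: representsM; apply: truncationP.
Qed.

Lemma ser_mulC : commutative (@fps_mul A : ser A -> ser A -> ser A).
Proof.
move=> f g; apply: represents_inj => n.
exists (truncation n f * truncation n g); split; last rewrite mulrC;
  by apply: representsM; apply: truncationP.
Qed.

Lemma ser_mul1 : left_id (fps_one A : ser A) (@fps_mul A).
Proof.
move=> f; apply: represents_inj => n.
exists (1 * truncation n f); split; last by rewrite mul1r; apply: truncationP.
apply: representsM; last exact: truncationP.
move=> j k _ _; rewrite coef1 /fps_one.
by case: j => [|j]; rewrite ?coef1 ?coef0.
Qed.

Lemma ser_mulDl : left_distributive (@fps_mul A : ser A -> ser A -> ser A) +%R.
Proof.
move=> f g h; apply: serP => j k; rewrite /fps_mul ser_addE -big_split /=.
apply: eq_bigr => a _; rewrite -big_split /=; apply: eq_bigr => b _.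
by rewrite ser_addE mulrDl.
Qed.

Lemma ser_one_neq0 : (fps_one A : ser A) != 0.
Proof.
apply/eqP => /(congr1 (fun f : ser A => f 0%N 0%N)); rewrite /fps_one /=.
by apply/eqP; rewrite oner_eq0.
Qed.

HB.instance Definition _ := GRing.Zmodule_isComNzRing.Build (ser A)
  ser_mulA ser_mulC ser_mul1 ser_mulDl ser_one_neq0.

Lemma ser_mulE f g : fps_mul f g = f * g. Proof. by []. Qed.
Lemma ser_oneE : fps_one A = (1 : ser A). Proof. by []. Qed.
Lemma ser_expE f n : fps_exp f n = f ^+ n.
Proof. by elim: n => [|n IH] //; rewrite exprS -IH. Qed.

Lemma ser_coefM f g j k :
  (f * g) j k = \sum_(a < j.+1) \sum_(b < k.+1) f a b * g (j - a)%N (k - b)%N.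
Proof. by []. Qed.

Definition serC (c : A) : ser A := fun j k => if (j == 0%N) && (k == 0%N) then c else 0.
Definition mono (a b : nat) : ser A := fun j k => ((j == a) && (k == b))%:R.
Definition serZ : ser A := mono 1 0.
Definition serW : ser A := mono 0 1.

Lemma serCM c f j k : (serC c * f) j k = c * f j k.
Proof.
rewrite ser_coefM big_ord_recl big_ord_recl /= /serC /= !subn0.
rewrite [X in _ + X]big1 ?addr0 => [|i _]; last by rewrite big1 // => l _; rewrite mul0r.
by rewrite [X in _ + X]big1 ?addr0 // => i _; rewrite mul0r.
Qed.

Lemma serC_is_zmod_morphism : zmod_morphism serC.
Proof.
move=> x y; apply: serP => j k; rewrite ser_subE /serC; case: ifP => //.
by rewrite subr0.
Qed.
Lemma serC_is_monoid_morphism : monoid_morphism serC.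
Proof.
split=> [|x y]; apply: serP => j k.
  by rewrite -ser_oneE /serC /fps_one; case: ifP.
by rewrite serCM /serC; case: ifP => // _; rewrite mulr0.
Qed.
HB.instance Definition _ := GRing.isZmodMorphism.Build A (ser A) serC serC_is_zmod_morphism.
HB.instance Definition _ := GRing.isMonoidMorphism.Build A (ser A) serC serC_is_monoid_morphism.

Lemma monoM a b f j k :
  (mono a b * f) j k = if (a <= j)%N && (b <= k)%N then f (j - a)%N (k - b)%N else 0.
Proof.
rewrite ser_coefM; case: ifPn => [/andP[aj bk]|H].
  rewrite (bigD1 (Ordinal (aj : a < j.+1)%N)) //= (bigD1 (Ordinal (bk : b < k.+1)%N)) //=.
  rewrite /mono !eqxx mul1r big1 ?addr0 => [|i /negPf ib]; last first.
    rewrite -val_eqE /= in ib; by rewrite ib mul0r.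
  rewrite big1 ?addr0 // => i /negPf ia; rewrite -val_eqE /= in ia.
  by rewrite big1 // => l _; rewrite ia mul0r.
rewrite big1 // => i _; rewrite big1 // => l _; rewrite /mono.
case: eqP => [ia|]; case: eqP => [lb|]; rewrite ?mul0r //.
by have := ltn_ord i; have := ltn_ord l; move: H; lia.
Qed.

Lemma mono_mono a b c d : mono a b * mono c d = mono (a + c) (b + d).
Proof.
apply: serP => j k; rewrite monoM /mono; case: ifPn => [/andP[aj bk]|H].
  by congr ((_ && _)%:R); lia.
by case: andP => // -[/eqP ? /eqP ?]; lia.
Qed.

Lemma monoE a b : mono a b = serZ ^+ a * serW ^+ b.
Proof.
have Z n : serZ ^+ n = mono n 0.
  elim: n => [|n IH]; last by rewrite exprS IH mono_mono.
  by [].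
have W n : serW ^+ n = mono 0 n.
  elim: n => [|n IH]; last by rewrite exprS IH mono_mono.
  by [].
by rewrite Z W mono_mono addn0.
Qed.

Lemma fps_linE a b : fps_lin a b = serC a * serZ + serC b * serW.
Proof.
apply: serP => j k; rewrite ser_addE !serCM /fps_lin /serZ /serW /mono.
by case: j => [|[|j]]; case: k => [|[|k]] /=; rewrite ?mulr1 ?mulr0 ?addr0 ?add0r.
Qed.

(** * Order of vanishing *)

Definition ord n f := forall j k, (j + k < n)%N -> f j k = 0.

Lemma ord_le m n f : (m <= n)%N -> ord n f -> ord m f.
Proof. by move=> mn H j k jk; apply: H; apply: leq_trans mn. Qed.
Lemma ord_zero n : ord n 0. Proof. by []. Qed.
Lemma ordD n f g : ord n f -> ord n g -> ord n (f + g).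
Proof. by move=> H K j k jk; rewrite ser_addE H // K // addr0. Qed.
Lemma ordN n f : ord n f -> ord n (- f).
Proof. by move=> H j k jk; rewrite ser_oppE H // oppr0. Qed.
Lemma ordB n f g : ord n f -> ord n g -> ord n (f - g).
Proof. by move=> H K; apply: ordD => //; apply: ordN. Qed.
Lemma ordM m n f g : ord m f -> ord n g -> ord (m + n) (f * g).
Proof.
move=> H K j k jk; rewrite ser_coefM big1 // => a _; rewrite big1 // => b _.
case: (ltnP (a + b) m) => [/H->|ab]; first by rewrite mul0r.
rewrite K ?mulr0 //; have := ltn_ord a; have := ltn_ord b; lia.
Qed.
Lemma ordMl n f g : ord n f -> ord n (f * g).
Proof. by move=> H; rewrite -[n]addn0; apply: ordM. Qed.
Lemma ordMr n f g : ord n g -> ord n (f * g).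
Proof. by rewrite mulrC; apply: ordMl. Qed.
Lemma ordX m n f : ord m f -> ord (n * m) (f ^+ n).
Proof. by move=> H; elim: n => // n IH; rewrite exprS mulSn; apply: ordM. Qed.
Lemma ord_exp n f : ord 1 f -> ord n (f ^+ n).
Proof. by move=> o; have := ordX (n := n) o; rewrite muln1. Qed.
Lemma ord_mono a b : ord (a + b) (mono a b).
Proof. by move=> j k jk; rewrite /mono; case: andP => // -[/eqP ? /eqP ?]; lia. Qed.
Lemma ord1Z : ord 1 serZ. Proof. exact: (@ord_mono 1 0). Qed.
Lemma ord1W : ord 1 serW. Proof. exact: (@ord_mono 0 1). Qed.

Lemma ord_eq f g : (forall n, ord n (f - g)) -> f = g.
Proof.
move=> H; apply: serP => j k; apply/eqP; rewrite -subr_eq0 -ser_subE.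
by rewrite (H (j + k).+1).
Qed.
Lemma ord_trans n f g h : ord n (f - g) -> ord n (g - h) -> ord n (f - h).
Proof. by move=> H K; have := ordD H K; rewrite addrA subrK. Qed.
Lemma ord_sym n f g : ord n (f - g) -> ord n (g - f).
Proof. by move=> /ordN; rewrite opprB. Qed.
Lemma ord_subP n f g : ord n (f - g) <-> forall j k, (j + k < n)%N -> f j k = g j k.
Proof.
split=> H j k jk; first by apply/eqP; rewrite -subr_eq0 -ser_subE H.
by rewrite ser_subE H // subrr.
Qed.

End SeriesRing.
Arguments serZ {A}.
Arguments serW {A}.
Arguments mono {A}.
Arguments ord {A}.
Arguments ord_exp {A} n {f}.
Arguments ord_le {A m n f}.

(** * Substitution *)

Section Substitution.
Variable A : comNzRingType.
Implicit Types (f g h u v : ser A) (p q : {poly {poly A}}).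

Definition subst f u v : ser A := fps_subst f u v.

Lemma subst_coef f u v j k : subst f u v j k =
  \sum_(a < (j + k).+1) \sum_(b < (j + k).+1) f a b * (u ^+ a * v ^+ b) j k.
Proof. by apply: eq_bigr => a _; apply: eq_bigr => b _; rewrite !ser_expE. Qed.

(** For polynomials, substitution is a ring morphism by construction; the
    multiplicativity of the substitution into series is deduced from this. *)
Definition eval_inner v (q : {poly A}) : ser A := (map_poly (@serC A) q).[v].

Fact eval_inner_is_zmod v : zmod_morphism (eval_inner v).
Proof. by move=> q r /=; rewrite /eval_inner rmorphB hornerD hornerN. Qed.
Fact eval_inner_is_monoid v : monoid_morphism (eval_inner v).
Proof.
by split=> [|q r] /=; rewrite /eval_inner ?rmorph1 ?hornerC // rmorphM hornerM.
Qed.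
HB.instance Definition _ v := GRing.isZmodMorphism.Build {poly A} (ser A)
  (eval_inner v) (eval_inner_is_zmod v).
HB.instance Definition _ v := GRing.isMonoidMorphism.Build {poly A} (ser A)
  (eval_inner v) (eval_inner_is_monoid v).

Definition evals u v p : ser A := (map_poly (eval_inner v) p).[u].

Lemma evalsM u v p q : evals u v (p * q) = evals u v p * evals u v q.
Proof. by rewrite /evals rmorphM hornerM. Qed.

Lemma evals_coef u v p j k n :
  (size p <= n)%N -> (forall a, (size (p`_a)%R <= n)%N) ->
  evals u v p j k = \sum_(a < n) \sum_(b < n) p`_a`_b * (u ^+ a * v ^+ b) j k.
Proof.
move=> sp sc; rewrite /evals (@horner_coef_wide _ n); last exact: leq_trans (size_poly _ _) sp.
rewrite ser_sumE; apply: eq_bigr => a _.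
rewrite coef_map /= /eval_inner (@horner_coef_wide _ n); last first.
  exact: leq_trans (size_poly _ _) (sc _).
rewrite mulr_suml ser_sumE; apply: eq_bigr => b _.
by rewrite coef_map -mulrA serCM [v ^+ _ * _]mulrC.
Qed.

Lemma ord_powers u v a b : ord 1 u -> ord 1 v -> ord (a + b) (u ^+ a * v ^+ b).
Proof.
move=> ou ov; apply: ordM.
  exact: (ord_exp a ou).
exact: (ord_exp b ov).
Qed.

(** Any bound past the degree may replace the one in the definition. *)
Lemma subst_coef_wide n f u v j k : ord 1 u -> ord 1 v -> (j + k < n)%N ->
  subst f u v j k = \sum_(a < n) \sum_(b < n) f a b * (u ^+ a * v ^+ b) j k.
Proof.
move=> ou ov jkn.
have z a b : (j + k < a + b)%N -> f a b * (u ^+ a * v ^+ b) j k = 0.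
  by move=> jk; rewrite (ord_powers ou ov jk) mulr0.
rewrite subst_coef (big_ord_widen n (fun a => \sum_(b < (j + k).+1) f a b * (u ^+ a * v ^+ b) j k)) //.
rewrite big_mkcond /=; apply: eq_bigr => a _; case: ltnP => ajk.
  rewrite (big_ord_widen n (fun b => f a b * (u ^+ a * v ^+ b) j k)) //.
  rewrite big_mkcond /=; apply: eq_bigr => b _; case: ltnP => // bjk.
  by rewrite z // ltn_addl.
by rewrite big1 // => b _; rewrite z // ltn_addr.
Qed.

(** A substitution only sees the part of low total degree, so it may be
    computed on any polynomial with the same part of low degree. *)
Lemma evals_subst u v p f j k : ord 1 u -> ord 1 v ->
  (forall a b, (a + b <= j + k)%N -> p`_a`_b = f a b) ->
  evals u v p j k = subst f u v j k.
Proof.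
move=> ou ov pf.
pose m := maxn (size p) (\max_(a < size p) size (p`_a)%R).
pose n := maxn m (j + k).+1.
have sp : (size p <= n)%N by rewrite /n /m; lia.
have sc a : (size (p`_a)%R <= n)%N.
  case: (ltnP a (size p)) => [ap|/(nth_default 0)->]; last by rewrite size_poly0.
  have := leq_bigmax (F := fun a : 'I_(size p) => size (p`_a)%R) (Ordinal ap).
  rewrite /n /m /=; lia.
rewrite (evals_coef _ _ _ _ sp sc) (@subst_coef_wide n) //; last by rewrite /n; lia.
apply: eq_bigr => a _; apply: eq_bigr => b _.
case: (leqP (a + b) (j + k)) => [/pf->//|jk].
by rewrite (ord_powers ou ov jk) !mulr0.
Qed.

Lemma substM f g u v : ord 1 u -> ord 1 v ->
  subst (f * g) u v = subst f u v * subst g u v.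
Proof.
move=> ou ov; apply: serP => j k.
pose n := (j + k)%N.
have tr f' a b : (a + b <= n)%N -> (truncation n f')`_a`_b = f' a b.
  by move=> ab; apply: truncationP; lia.
rewrite -(@evals_subst _ _ (truncation n f * truncation n g)) //; last first.
  by move=> a b ab; apply: (@representsM _ n); (apply: truncationP || lia).
rewrite evalsM !ser_coefM; apply: eq_bigr => a _; apply: eq_bigr => b _.
have := ltn_ord a; have := ltn_ord b => ? ?.
by congr (_ * _); apply: evals_subst => // c d cd; apply: tr; rewrite /n; lia.
Qed.

Lemma subst_is_zmod u v : zmod_morphism (fun f => subst f u v).
Proof.
move=> f g; apply: serP => j k; rewrite ser_subE !subst_coef -sumrB.
apply: eq_bigr => a _; rewrite -sumrB; apply: eq_bigr => b _.
by rewrite ser_subE mulrBl.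
Qed.

Lemma substB f g u v : subst (f - g) u v = subst f u v - subst g u v.
Proof. exact: subst_is_zmod. Qed.
Lemma subst0 u v : subst 0 u v = 0.
Proof. by have := substB 0 0 u v; rewrite !subrr. Qed.
Lemma substN f u v : subst (- f) u v = - subst f u v.
Proof. by rewrite -sub0r substB subst0 sub0r. Qed.
Lemma substD f g u v : subst (f + g) u v = subst f u v + subst g u v.
Proof. by rewrite -[in LHS](opprK g) substB substN opprK. Qed.

Lemma subst_mono a b u v : ord 1 u -> ord 1 v -> subst (mono a b) u v = u ^+ a * v ^+ b.
Proof.
move=> ou ov; apply: serP => j k.
rewrite (@subst_coef_wide (a + b + j + k).+1) //; last by lia.
have Ha : (a < (a + b + j + k).+1)%N by lia.
have Hb : (b < (a + b + j + k).+1)%N by lia.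
rewrite (bigD1 (Ordinal Ha)) //= (bigD1 (Ordinal Hb)) //= /mono !eqxx mul1r.
rewrite big1 ?addr0 => [|i /negPf ib]; last first.
  by rewrite -val_eqE /= in ib; rewrite ib mul0r.
rewrite big1 ?addr0 // => i /negPf ia; rewrite -val_eqE /= in ia.
by rewrite big1 // => l _; rewrite ia mul0r.
Qed.

Lemma substZ u v : ord 1 u -> ord 1 v -> subst serZ u v = u.
Proof. by move=> ou ov; rewrite subst_mono // expr1 expr0 mulr1. Qed.
Lemma substW u v : ord 1 u -> ord 1 v -> subst serW u v = v.
Proof. by move=> ou ov; rewrite subst_mono // expr1 expr0 mul1r. Qed.
Lemma subst1 u v : ord 1 u -> ord 1 v -> subst 1 u v = 1.
Proof.
move=> ou ov; rewrite (_ : 1 = mono 0 0); last by apply: serP => j k.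
by rewrite subst_mono // !expr0 mulr1.
Qed.
Lemma substX f n u v : ord 1 u -> ord 1 v -> subst (f ^+ n) u v = subst f u v ^+ n.
Proof.
by move=> ou ov; elim: n => [|n IH]; rewrite ?expr0 ?subst1 // !exprS substM // IH.
Qed.
Lemma substC c u v : subst (serC c) u v = serC c.
Proof.
apply: serP => j k; rewrite subst_coef big_ord_recl big_ord_recl /= !expr0 mulr1.
rewrite [X in _ + X + _]big1 ?addr0 => [|i _]; last by rewrite /serC /= mul0r.
rewrite [X in _ + X]big1 ?addr0 => [|i _]; last first.
  by rewrite big1 // => l _; rewrite /serC /= mul0r.
by rewrite -ser_oneE /serC /fps_one /=; case: ifP; rewrite ?mulr1 ?mulr0.
Qed.
Lemma subst_sum I r (P : pred I) (F : I -> ser A) u v :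
  subst (\sum_(i <- r | P i) F i) u v = \sum_(i <- r | P i) subst (F i) u v.
Proof. by elim/big_rec2: _ => [|i y1 y2 _ <-]; rewrite ?subst0 // substD. Qed.

Lemma ord_subst n f u v : ord n f -> ord 1 u -> ord 1 v -> ord n (subst f u v).
Proof.
move=> of_ ou ov j k jk; rewrite subst_coef big1 // => a _; rewrite big1 // => b _.
case: (ltnP (a + b) n) => [/of_->|ab]; first by rewrite mul0r.
by rewrite (ord_powers ou ov) ?mulr0 //; apply: leq_trans ab.
Qed.

Lemma subst_id f : subst f serZ serW = f.
Proof.
apply: serP => j k; rewrite (@subst_coef_wide (j + k).+1) //; [|exact: ord1Z|exact: ord1W].
have Ha : (j < (j + k).+1)%N by lia.
have Hb : (k < (j + k).+1)%N by lia.
rewrite (bigD1 (Ordinal Ha)) //= (bigD1 (Ordinal Hb)) //= -monoE /mono !eqxx mulr1.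
rewrite big1 ?addr0 => [|i /negPf ib]; last first.
  by rewrite -val_eqE /= eq_sym in ib; rewrite -monoE /mono ib andbF mulr0.
rewrite big1 ?addr0 // => i /negPf ia; rewrite -val_eqE /= eq_sym in ia.
by rewrite big1 // => l _; rewrite -monoE /mono ia mulr0.
Qed.

Definition jet n f : ser A := fun j k => if (j + k <= n)%N then f j k else 0.

(** Identities between substitutions are checked on monomials and extended to
    series by this decomposition, up to terms of arbitrarily high order. *)
Lemma jet_sum n f : exists F : 'I_n.+1 -> 'I_n.+1 -> A,
  jet n f = \sum_a \sum_b serC (F a b) * mono a b.
Proof.
exists (fun a b => jet n f a b); apply: serP => j k; rewrite ser_sumE.
have [jn|jn] := ltnP j n.+1; last first.
  rewrite /jet big1 => [|a _]; first by case: ifP => //; lia.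
  rewrite ser_sumE big1 // => b _; rewrite serCM /mono (_ : (j == a) = false) ?mulr0 //.
  by have := ltn_ord a; lia.
have [kn|kn] := ltnP k n.+1; last first.
  rewrite /jet big1 => [|a _]; first by case: ifP => //; lia.
  rewrite ser_sumE big1 // => b _; rewrite serCM /mono (_ : (k == b) = false) ?andbF ?mulr0 //.
  by have := ltn_ord b; lia.
rewrite (bigD1 (Ordinal jn)) //= ser_sumE (bigD1 (Ordinal kn)) //= serCM /mono !eqxx mulr1.
rewrite big1 ?addr0 => [|i /negPf ib]; last first.
  by rewrite -val_eqE /= eq_sym in ib; rewrite serCM ib andbF mulr0.
rewrite big1 ?addr0 // => i /negPf ia; rewrite -val_eqE /= eq_sym in ia.
by rewrite ser_sumE big1 // => l _; rewrite serCM ia mulr0.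
Qed.

Lemma ord_jet n f : ord n.+1 (f - jet n f).
Proof. by apply/ord_subP => j k jk; rewrite /jet -ltnS jk. Qed.

Lemma subst_assoc f u v (p q : ser A) : ord 1 u -> ord 1 v -> ord 1 p -> ord 1 q ->
  subst (subst f u v) p q = subst f (subst u p q) (subst v p q).
Proof.
move=> ou ov op oq; apply: ord_eq => n.
have ou' : ord 1 (subst u p q) by apply: ord_subst.
have ov' : ord 1 (subst v p q) by apply: ord_subst.
have E : subst (subst (jet n f) u v) p q = subst (jet n f) (subst u p q) (subst v p q).
  have [F ->] := jet_sum n f.
  rewrite !subst_sum; apply: eq_bigr => a _; rewrite !subst_sum; apply: eq_bigr => b _.
  by rewrite !substM // !substC !subst_mono // substM // !substX.
have o1 : ord n (f - jet n f) by apply: ord_le (leqnSn n) (@ord_jet n f).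
apply: (@ord_trans _ _ _ (subst (subst (jet n f) u v) p q)).
  by rewrite -!substB; apply: ord_subst => //; apply: ord_subst.
by rewrite E -substB; apply: ord_subst => //; rewrite -opprB; apply: ordN.
Qed.

(** Powers are Lipschitz for the order filtration, and each extra factor gains
    one degree. *)
Lemma ord_powers_diff u v u' v' n a b : (0 < n)%N -> ord 1 u -> ord 1 v ->
  ord n (u' - u) -> ord n (v' - v) -> (0 < a + b)%N ->
  ord (n + (a + b).-1) (u' ^+ a * v' ^+ b - u ^+ a * v ^+ b).
Proof.
move=> n0 ou ov du dv.
have ou' : ord 1 u' by rewrite -(subrK u u'); apply: ordD => //; apply: ord_le du.
have ov' : ord 1 v' by rewrite -(subrK v v'); apply: ordD => //; apply: ord_le dv.
have D (x x' : ser A) m : ord 1 x -> ord 1 x' -> ord n (x' - x) -> (0 < m)%N ->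
    ord (n + m.-1) (x' ^+ m - x ^+ m).
  move=> ox ox' dx; case: m => // m _ /=; elim: m => [|m IH]; first by rewrite addn0.
  rewrite exprS [x ^+ _]exprS (_ : _ - _ = (x' - x) * x' ^+ m.+1 + x * (x' ^+ m.+1 - x ^+ m.+1)); last by ring.
  apply: ordD; first by apply: ordM => //; exact: (ord_exp m.+1 ox').
  by rewrite addnS -add1n; apply: ordM.
have [->|a0] := posnP a; first by rewrite !expr0 !mul1r add0n; apply: D.
have [->|b0] := posnP b => _; first by rewrite !expr0 !mulr1 addn0; apply: D.
rewrite (_ : _ - _ = (u' ^+ a - u ^+ a) * v' ^+ b + u ^+ a * (v' ^+ b - v ^+ b)); last by ring.
apply: ordD.
  rewrite (_ : (n + (a + b).-1 = n + a.-1 + b)%N); last by lia.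
  by apply: ordM; [exact: D | exact: (ord_exp b ov')].
rewrite (_ : (n + (a + b).-1 = a + (n + b.-1))%N); last by lia.
by apply: ordM; [exact: (ord_exp a ou) | exact: D].
Qed.

(** A substitution depends on its arguments up to the order where they differ,
    with m - 1 more degrees when the outer series has order m. This is the
    contraction estimate behind inverses and normal forms. *)
Lemma ord_subst_diff m f u v u' v' n : (0 < n)%N -> ord 1 u -> ord 1 v ->
  ord n (u' - u) -> ord n (v' - v) -> ord m f -> (0 < m)%N ->
  ord (n + m.-1) (subst f u' v' - subst f u v).
Proof.
move=> n0 ou ov du dv of_ m0 j k jk.
rewrite ser_subE !subst_coef -sumrB big1 // => a _; rewrite -sumrB big1 // => b _.
case: (ltnP (a + b) m) => [/of_->|ab]; first by rewrite !mul0r subrr.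
rewrite -mulrBr -ser_subE (ord_powers_diff n0 ou ov du dv) ?mulr0 //; lia.
Qed.

Lemma split_linear f : exists2 r, ord 2 r &
  f = serC (f 0%N 0%N) + serC (f 1%N 0%N) * serZ + serC (f 0%N 1%N) * serW + r.
Proof.
exists (f - (serC (f 0%N 0%N) + serC (f 1%N 0%N) * serZ + serC (f 0%N 1%N) * serW)); last by ring.
apply/ord_subP => j k; rewrite !ser_addE !serCM /serZ /serW /mono /serC.
by case: j => [|[|j]]; case: k => [|[|k]] //= _; rewrite ?mulr1 ?mulr0 ?addr0 ?add0r.
Qed.

(** The terms of f of degree at least 2 contribute at order n + 1 or more, so that
    only the linear part of f acts on the increments d and e. *)
Lemma subst_expand f u v d e n : (0 < n)%N -> ord 1 u -> ord 1 v -> ord n d -> ord n e ->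
  ord n.+1 (subst f (u + d) (v + e)
    - (subst f u v + serC (f 1%N 0%N) * d + serC (f 0%N 1%N) * e)).
Proof.
move=> n0 ou ov od oe; have [r or] := split_linear f.
have o1 : ord 1 (u + d) by apply: ordD => //; apply: ord_le od.
have o2 : ord 1 (v + e) by apply: ordD => //; apply: ord_le oe.
set a := f 0%N 0%N; set b := f 1%N 0%N; set c := f 0%N 1%N => ->.
rewrite !substD !substM // !substC !substZ // !substW //.
rewrite (_ : _ - _ = subst r (u + d) (v + e) - subst r u v); last by ring.
rewrite -addn1; apply: (ord_subst_diff (m := 2)) => //; rewrite addrAC subrr add0r //.
Qed.

(** The terms of lowest degree of f only meet the linear parts of u and v; when
    these are diagonal, monomials are eigenvectors. *)
Lemma subst_lead f u v n l m : ord n f -> ord 1 u -> ord 1 v ->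
  u 1%N 0%N = l -> u 0%N 1%N = 0 -> v 1%N 0%N = 0 -> v 0%N 1%N = m ->
  forall j k, (j + k = n)%N -> subst f u v j k = f j k * (l ^+ j * m ^+ k).
Proof.
move=> of_ ou ov u10 u01 v10 v01 j k jkn.
have du : ord 2 (u - serC l * serZ).
  apply/ord_subP => a b; rewrite serCM /serZ /mono.
  by case: a => [|[|a]]; case: b => [|[|b]] //= _;
    rewrite ?mulr0 ?mulr1 ?u10 ?u01 ?ou.
have dv : ord 2 (v - serC m * serW).
  apply/ord_subP => a b; rewrite serCM /serW /mono.
  by case: a => [|[|a]]; case: b => [|[|b]] //= _;
    rewrite ?mulr0 ?mulr1 ?v10 ?v01 ?ov.
have oZ : ord 1 (serC l * serZ) by apply: ordMr; apply: ord1Z.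
have oW : ord 1 (serC m * serW) by apply: ordMr; apply: ord1W.
have -> : subst f u v j k = subst f (serC l * serZ) (serC m * serW) j k.
  have [n0|n0] := posnP n.
    have -> : j = 0%N by lia. have -> : k = 0%N by lia.
    by rewrite !subst_coef !big_ord1 !expr0.
  have /ord_subP := ord_subst_diff (n := 2) isT oZ oW du dv of_ n0.
  apply; lia.
rewrite (@subst_coef_wide (j + k).+1) //.
have E a b : (serC l * serZ) ^+ a * (serC m * serW) ^+ b
   = serC (l ^+ a * m ^+ b) * mono a b.
  by rewrite !exprMn -!rmorphXn monoE rmorphM /=; ring.
have Ha : (j < (j + k).+1)%N by lia.
have Hb : (k < (j + k).+1)%N by lia.
rewrite (bigD1 (Ordinal Ha)) //= (bigD1 (Ordinal Hb)) //= E serCM /mono !eqxx mulr1.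
rewrite big1 ?addr0 => [|i /negPf ib]; last first.
  by rewrite -val_eqE /= eq_sym in ib; rewrite E serCM /mono ib andbF !mulr0.
rewrite big1 ?addr0 // => i /negPf ia; rewrite -val_eqE /= eq_sym in ia.
by rewrite big1 // => b _; rewrite E serCM /mono ia !mulr0.
Qed.

End Substitution.

#[global] Opaque fps_mul subst.

(** * Formal maps of the plane and their composition *)

Section FormalMaps.
Variable R : realType.
Local Notation C := R[i].
Implicit Types (F G H f g u v : ser C) (l : C).

Definition conj F : ser C := fps_conj F.
Definition comp F G : ser C := fps_comp F G.

Lemma conjE F j k : conj F j k = ((F k j)^*)%C. Proof. by []. Qed.
Lemma compE F G : comp F G = subst F G (conj G). Proof. by []. Qed.

Lemma conjK F : conj (conj F) = F.
Proof. by apply: serP => j k; rewrite !conjE conjcK. Qed.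

Lemma conjB f g : conj (f - g) = conj f - conj g.
Proof. by apply: serP => j k; rewrite ser_subE !conjE ser_subE rmorphB. Qed.
Lemma conjD f g : conj (f + g) = conj f + conj g.
Proof. by apply: serP => j k; rewrite ser_addE !conjE ser_addE rmorphD. Qed.
Lemma conjM f g : conj (f * g) = conj f * conj g.
Proof.
apply: serP => j k; rewrite conjE !ser_coefM exchange_big rmorph_sum /=.
apply: eq_bigr => a _; rewrite rmorph_sum; apply: eq_bigr => b _.
by rewrite rmorphM.
Qed.
Lemma conj1 : conj 1 = 1.
Proof.
by apply: serP => j k; rewrite conjE -!ser_oneE /fps_one andbC conjc_nat.
Qed.
Lemma conjX f n : conj (f ^+ n) = conj f ^+ n.
Proof. by elim: n => [|n IH]; rewrite ?expr0 ?conj1 // !exprS conjM IH. Qed.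
Lemma conjserC c : conj (serC c) = serC (c^*)%C.
Proof. by apply: serP => j k; rewrite conjE /serC andbC; case: ifP; rewrite ?rmorph0. Qed.
Lemma conj_mono a b : conj (mono a b) = mono b a.
Proof. by apply: serP => j k; rewrite conjE /mono andbC conjc_nat. Qed.
Lemma conjZ : conj serZ = serW. Proof. exact: conj_mono. Qed.
Lemma conjW : conj serW = serZ. Proof. exact: conj_mono. Qed.
Lemma ord_conj n f : ord n f -> ord n (conj f).
Proof. by move=> o j k jk; rewrite conjE o ?rmorph0 // addnC. Qed.

Lemma conj_subst f u v : conj (subst f u v) = subst (conj f) (conj v) (conj u).
Proof.
apply: serP => j k; rewrite conjE !subst_coef exchange_big rmorph_sum addnC.
apply: eq_bigr => a _; rewrite rmorph_sum; apply: eq_bigr => b _.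
by rewrite -!conjX -conjM !conjE [v ^+ a * _]mulrC; apply: rmorphM.
Qed.

Lemma conj_comp F G : conj (comp F G) = comp (conj F) G.
Proof. by rewrite !compE conj_subst conjK. Qed.

Lemma ord_comp n F G : ord n F -> ord 1 G -> ord n (comp F G).
Proof. by move=> oF oG; apply: ord_subst => //; apply: ord_conj. Qed.

Lemma comp_assoc F G H : ord 1 G -> ord 1 H ->
  comp (comp F G) H = comp F (comp G H).
Proof.
move=> oG oH; rewrite [in RHS]compE conj_comp !compE subst_assoc //; exact: ord_conj.
Qed.

Lemma comp_id F : comp F serZ = F.
Proof. by rewrite compE conjZ subst_id. Qed.
Lemma id_comp F : ord 1 F -> comp serZ F = F.
Proof. by move=> oF; rewrite compE substZ //; apply: ord_conj. Qed.
Lemma compD F G H : comp (F + G) H = comp F H + comp G H.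
Proof. exact: substD. Qed.
Lemma compB F G H : comp (F - G) H = comp F H - comp G H.
Proof. exact: substB. Qed.
Lemma compM F G H : ord 1 H -> comp (F * G) H = comp F H * comp G H.
Proof. by move=> oH; apply: substM => //; apply: ord_conj. Qed.
Lemma compC c H : comp (serC c) H = serC c.
Proof. exact: substC. Qed.

Lemma fps_idE : fps_id R = serZ.
Proof. by rewrite /fps_id fps_linE rmorph1 rmorph0 mul1r mul0r addr0. Qed.

Lemma multiplierP l F : multiplier l F <-> ord 2 (F - serC l * serZ).
Proof.
split=> [[F00 F10 F01]|/ord_subP H]; last first.
  by split; rewrite H // serCM /serZ /mono ?mulr0 ?mulr1.
apply/ord_subP => j k; rewrite serCM /serZ /mono.
by case: j => [|[|j]]; case: k => [|[|k]] //= _; rewrite ?mulr0 ?mulr1.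
Qed.

Lemma multiplier_ord l F : multiplier l F -> ord 1 F.
Proof.
by case=> F00 _ _ j k; case: j => [|j] //; case: k => [|k] // _; rewrite F00.
Qed.

(** The inverse is the limit of the iterates of a map that contracts the order
    filtration. *)
Fixpoint inverse_iter F n : ser C :=
  if n is m.+1 then serZ - comp (F - serZ) (inverse_iter F m) else serZ.

Lemma inverse_iter_ord F n : multiplier 1 F -> ord 1 (inverse_iter F n).
Proof.
move=> /multiplierP; rewrite rmorph1 mul1r => oF.
elim: n => [|n IH]; first exact: ord1Z.
by apply: ordB; [exact: ord1Z | apply: ord_comp => //; apply: ord_le oF].
Qed.

Lemma inverse_iter_cauchy F n : multiplier 1 F ->
  ord n.+2 (inverse_iter F n.+1 - inverse_iter F n).
Proof.
move=> mF; move: (mF) => /multiplierP; rewrite rmorph1 mul1r => oF.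
elim: n => [|n IH] /=.
  rewrite (_ : _ - _ = - comp (F - serZ) serZ); last by ring.
  by rewrite comp_id; apply: ordN.
set P := (X in serZ - X - _); set Q := (X in _ - (_ - X)).
rewrite (_ : _ - _ = - (P - Q)); last by ring.
apply: ordN.
rewrite (_ : n.+3 = (n.+2 + 1)%N); last by lia.
apply: (ord_subst_diff (m := 2)) => //; try exact: inverse_iter_ord.
- by apply: ord_conj; apply: inverse_iter_ord.
- by rewrite -conjB; apply: ord_conj.
Qed.

Lemma ord_limit (s : nat -> ser C) : (forall n, ord n (s n.+1 - s n)) ->
  exists t, forall n, ord n (t - s n).
Proof.
move=> cs.
have c m n : (m <= n)%N -> ord m (s n - s m).
  move=> /subnK <-; elim: (n - m)%N => [|d IH]; first by rewrite subrr.
  by apply: ord_trans IH; rewrite addSn; apply: ord_le (cs _); apply: leq_addl.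
exists (fun j k => s (j + k).+1 j k) => n; apply/ord_subP => j k jk.
by have /ord_subP -> := c _ _ jk.
Qed.

(** The error estimate on the iterates is kept in the conclusion: it transfers
    to the inverse the properties that all the iterates share. *)
Lemma inverse_exists F : multiplier 1 F ->
  exists G, [/\ multiplier 1 G, comp F G = serZ, comp G F = serZ
    & forall n, ord n (G - inverse_iter F n)].
Proof.
move=> mF.
have right H : multiplier 1 H -> exists G, [/\ multiplier 1 G, comp H G = serZ
    & forall n, ord n (G - inverse_iter H n)].
  move=> mH; move: (mH) => /multiplierP; rewrite rmorph1 mul1r => oH.
  have [|G cG] := @ord_limit (inverse_iter H).
    by move=> n; apply: ord_le (@inverse_iter_cauchy H n mH); lia.
  have o1G : ord 1 G.
    rewrite -(subrK (inverse_iter H 1) G); apply: ordD; first exact: cG.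
    exact: inverse_iter_ord.
  exists G; split=> //.
    apply/multiplierP; rewrite rmorph1 mul1r; apply: ord_trans (cG 2) _.
    apply: (@ord_trans _ _ _ (inverse_iter H 1)).
      by apply: ord_le (@inverse_iter_cauchy H 1 mH).
    exact: (@inverse_iter_cauchy H 0 mH).
  apply: ord_eq => n.
  rewrite (_ : _ - _ = (G - inverse_iter H n.+1)
     + (comp (H - serZ) G - comp (H - serZ) (inverse_iter H n))); last first.
    by rewrite [inverse_iter H n.+1]/= (compB H serZ G) id_comp //; ring.
  apply: ordD; first exact: ord_le (cG _).
  case: n => [|n] //.
  apply: (@ord_le _ _ (n.+1 + 1)); first by lia.
  apply: (ord_subst_diff (m := 2)) => //.
  - exact: inverse_iter_ord.
  - by apply: ord_conj; apply: inverse_iter_ord.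
  - by rewrite -conjB; apply: ord_conj.
have [G [mG FG cG]] := right F mF; have [H [mH GH _]] := right G mG.
exists G; split=> //.
suff -> : F = H by [].
have [oG oH] := (multiplier_ord mG, multiplier_ord mH).
by rewrite -[LHS]comp_id -GH -comp_assoc // FG id_comp.
Qed.

End FormalMaps.

#[global] Opaque conj comp.

(** * Normal forms *)

Section NormalForm.
Variable R : realType.
Local Notation C := R[i].
Implicit Types (F G H N f g h u v E : ser C) (l : C).

Definition nf_defect F h N := comp h F - comp N h.

(** The monomials (j, k) with j = k + 1 are the resonant ones; there the
    divisor vanishes, and so does this quotient. *)
Definition nf_quotient l E j k := - E j k / (l ^+ j * (l^*)%C ^+ k - l).

(** With E the defect in degree n, adding d to h and e to N changes that defect by
    (l^j conj(l)^k - l) d - e on the monomial (j, k). A resonant monomial is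
    therefore put into N and the others are removed by h; with [normalized], the
    resonant coefficient of h makes its coefficients of degree n sum to 0 when n is odd. *)
Definition nf_step (normalized : bool) l F n (p : ser C * ser C) : ser C * ser C :=
  let E := nf_defect F p.1 p.2 in
  (fun j k => if (j + k == n)%N then
       nf_quotient l E j k + (if normalized && (j == k.+1)
         then - \sum_(i < n.+1) nf_quotient l E i (n - i)%N else 0)
     else p.1 j k,
   fun j k => if (j + k == n)%N && (j == k.+1) then E j k else p.2 j k).

Fixpoint nf_stage normalized l F m : ser C * ser C :=
  if m is m'.+1 then nf_step normalized l F m.+1 (nf_stage normalized l F m')
  else (serZ, serC l * serZ).

(** The normalizing map and the normal form; with [normalized], the free
    resonant coefficients are chosen so that h(x, x) = x. *)
Definition nf_map normalized l F : ser C :=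
  fun j k => (nf_stage normalized l F (j + k).-1).1 j k.
Definition nf_form normalized l F : ser C :=
  fun j k => (nf_stage normalized l F (j + k).-1).2 j k.

Definition resonant N := forall j k, j != k.+1 -> N j k = 0.

Section Stages.
Variables (normalized : bool) (l : C) (F : ser C).
Let stage := nf_stage normalized l F.

Lemma nf_stage_next m j k : (j + k != m.+2)%N ->
  (stage m.+1).1 j k = (stage m).1 j k /\ (stage m.+1).2 j k = (stage m).2 j k.
Proof. by rewrite /stage /= => /negPf ->. Qed.

Lemma nf_stage_stable m n j k : (m <= n)%N -> (j + k <= m.+1)%N ->
  (stage n).1 j k = (stage m).1 j k /\ (stage n).2 j k = (stage m).2 j k.
Proof.
move=> /subnK <- jk; elim: (n - m)%N => [|d [IH1 IH2]] //.
rewrite addSn; have [|-> ->] := @nf_stage_next (d + m) j k; first by lia.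
by [].
Qed.

Lemma nf_stage_high m j k : (m.+1 < j + k)%N ->
  (stage m).1 j k = 0 /\ (stage m).2 j k = 0.
Proof.
elim: m => [|m IH] jk.
  rewrite /stage /= serCM /serZ /mono.
  by case: j k jk => [|[|j]] [|[|k]] //=; rewrite ?mulr0.
by have [|-> ->] := @nf_stage_next m j k; [lia | apply: IH; lia].
Qed.

Lemma nf_stage_multiplier m : multiplier 1 (stage m).1 /\ multiplier l (stage m).2.
Proof.
have E j k : (j + k <= 1)%N ->
    (stage m).1 j k = serZ j k /\ (stage m).2 j k = (serC l * serZ) j k.
  by move=> jk; have [] := @nf_stage_stable 0 m j k isT jk.
split; split; rewrite ?(proj1 (E _ _ _)) ?(proj2 (E _ _ _)) // serCM /serZ /mono ?mulr0 ?mulr1 //.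
Qed.

End Stages.

Variable l : C.
Hypothesis l_unit : l * (l^*)%C = 1.
Hypothesis l_irr : forall n, (0 < n)%N -> l ^+ n != 1.

Lemma divisor_pow j k : l ^+ (j + k) * (l^*)%C ^+ k = l ^+ j.
Proof. by rewrite exprD -mulrA -exprMn l_unit expr1n mulr1. Qed.

Lemma divisor_neq1 j k : j != k -> l ^+ j * (l^*)%C ^+ k != 1.
Proof.
move=> jk; case: (ltngtP j k) jk => // jk _; last first.
  by rewrite -(subnK (ltnW jk)) divisor_pow l_irr // subn_gt0.
apply/negP => /eqP H; have : l ^+ (k - j) != 1 by rewrite l_irr // subn_gt0.
case/negP; apply/eqP; rewrite -[LHS]mulr1 -H.
by rewrite mulrA -exprD subnK ?(ltnW jk) // -exprMn l_unit expr1n.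
Qed.

Lemma divisor_neq0 j k : j != k.+1 -> l ^+ j * (l^*)%C ^+ k - l != 0.
Proof.
move=> jk; apply/negP; rewrite subr_eq0 => /eqP H.
have /negP := divisor_neq1 jk; apply; apply/eqP.
by rewrite exprSr mulrA H l_unit.
Qed.

Lemma divisor_eq0 k : l ^+ k.+1 * (l^*)%C ^+ k - l = 0.
Proof. by rewrite -addn1 addnC divisor_pow expr1 subrr. Qed.

Lemma nf_quotient_resonant E k : nf_quotient l E k.+1 k = 0.
Proof. by rewrite /nf_quotient divisor_eq0 invr0 mulr0. Qed.

Section Defect.
Variables (normalized : bool) (F : ser C).
Hypothesis mF : multiplier l F.

(** Each stage kills the defect in one more degree; the quadratic terms of the
    correction only appear in higher degrees. *)
Lemma nf_stage_defect m : ord m.+2 (nf_defect F (nf_stage normalized l F m).1 (nf_stage normalized l F m).2).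
Proof.
have oF := multiplier_ord mF; have oF' := ord_conj oF.
elim: m => [|m IH].
  rewrite /nf_defect /= id_comp // comp_id; exact/multiplierP.
have [[mh mN] [mh' mN']] := (nf_stage_multiplier normalized l F m, nf_stage_multiplier normalized l F m.+1).
have hi := @nf_stage_high normalized l F m; have nx := @nf_stage_next normalized l F m.
move: mh mN mh' mN' IH hi nx.
have : nf_stage normalized l F m.+1 = nf_step normalized l F m.+2 (nf_stage normalized l F m) by [].
move: (nf_stage normalized l F m.+1) (nf_stage normalized l F m) => [h' N'] [h N]; rewrite /nf_step => -[Eh' EN'] /= mh mN mh' mN' oE hi nx.
set E := nf_defect F h N in oE Eh' EN' *.
pose d : ser C := h' - h; pose e : ser C := N' - N.
have od : ord m.+2 d by apply/ord_subP => j k jk; rewrite (nx j k _).1 //; lia.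
have oe : ord m.+2 e by apply/ord_subP => j k jk; rewrite (nx j k _).2 //; lia.
have oh := multiplier_ord mh; have oh' := multiplier_ord mh'.
have Ed : h' = h + d by rewrite /d; ring.
have Ee : N' = N + e by rewrite /e; ring.
case: (mN) => N00 N10 N01.
have X := @subst_expand _ N h (conj h) d (conj d) m.+2 isT oh (ord_conj oh) od (ord_conj od).
rewrite -conjD -Ed N10 N01 rmorph0 mul0r addr0 -!compE in X.
have -> : nf_defect F h' N' = (E + comp d F - serC l * d - comp e h')
    - (comp N h' - (comp N h + serC l * d)).
  have E1 : comp h' F = comp h F + comp d F by rewrite {1}Ed compD.
  have E2 : comp N' h' = comp N h' + comp e h' by rewrite {1}Ee compD.
  by rewrite /nf_defect E1 E2 /E /nf_defect; ring.
apply: ordB => // j k; rewrite ltnS leq_eqVlt => /orP[/eqP jk|jk]; last first.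
  suff : ord m.+2 (E + comp d F - serC l * d - comp e h') by apply.
  apply: ordB; last exact: ord_comp.
  apply: ordB; last exact: ordMr.
  by apply: ordD => //; apply: ord_comp.
have [F00 F10 F01] := mF; have [h00 h10 h01] := mh'.
rewrite !ser_subE ser_addE serCM !compE.
rewrite (subst_lead (l := l) (m := (l^*)%C) od oF oF') ?conjE ?F10 ?F01 ?rmorph0 //.
rewrite (subst_lead (l := 1) (m := 1) oe oh' (ord_conj oh')) ?conjE ?h10 ?h01 ?rmorph0 ?rmorph1 //.
rewrite !expr1n !mulr1.
have [h0 N0] : h j k = 0 /\ N j k = 0 by apply: hi; lia.
rewrite /d /e !ser_subE h0 N0 !subr0 Eh' EN' jk eqxx /=.
have [->|jk1] := eqVneq j k.+1; last first.
  rewrite andbF addr0 N0 subr0 /nf_quotient; have := divisor_neq0 jk1.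
  by set q := _ - l => q0; rewrite -addrA -[l * _]mulrC -mulrBr -/q divfK // subrr.
rewrite nf_quotient_resonant.
rewrite -addn1 addnC divisor_pow expr1; ring.
Qed.

End Defect.

Section Limit.
Variables (normalized : bool) (F : ser C).
Hypothesis mF : multiplier l F.
Let h := nf_map normalized l F.
Let N := nf_form normalized l F.

Lemma nf_map_stage m : ord m.+2 (h - (nf_stage normalized l F m).1).
Proof.
apply/ord_subP => j k jk; rewrite /h /nf_map.
have [||e1 e2] := @nf_stage_stable normalized l F (j + k).-1 m j k; [lia|lia|by rewrite e1].
Qed.

Lemma nf_form_stage m : ord m.+2 (N - (nf_stage normalized l F m).2).
Proof.
apply/ord_subP => j k jk; rewrite /N /nf_form.
have [||e1 e2] := @nf_stage_stable normalized l F (j + k).-1 m j k; [lia|lia|by rewrite e2].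
Qed.

Lemma nf_multipliers : multiplier 1 h /\ multiplier l N.
Proof.
have [m1 m2] := nf_stage_multiplier normalized l F 0.
split; apply/multiplierP.
  by apply: ord_trans (@nf_map_stage 0) _; apply/multiplierP.
by apply: ord_trans (@nf_form_stage 0) _; apply/multiplierP.
Qed.

Lemma nf_conjugacy : comp h F = comp N h.
Proof.
have [mh mN] := nf_multipliers; have [oh oF] := (multiplier_ord mh, multiplier_ord mF).
apply: ord_eq => n; apply: (@ord_le _ _ n.+2); first by lia.
set s := nf_stage normalized l F n.
have [ms1 ms2] := nf_stage_multiplier normalized l F n.
rewrite (_ : _ - _ = comp (h - s.1) F + nf_defect F s.1 s.2
   - (comp (N - s.2) h + (comp s.2 h - comp s.2 s.1))); last first.
  by rewrite /nf_defect !compB; ring.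
apply: ordB; apply: ordD.
- by apply: ord_comp => //; apply: nf_map_stage.
- exact: nf_stage_defect.
- by apply: ord_comp => //; apply: nf_form_stage.
- rewrite -[n.+2]addn0; apply: (ord_subst_diff (m := 1)) => //.
  + exact: multiplier_ord ms1.
  + by apply: ord_conj; apply: multiplier_ord ms1.
  + exact: nf_map_stage.
  + by rewrite -conjB; apply: ord_conj; apply: nf_map_stage.
  + exact: multiplier_ord ms2.
Qed.

Lemma nf_form_resonant : resonant N.
Proof.
move=> j k jk; rewrite /N /nf_form; elim: (j + k).-1 => [|m IH] /=.
  by rewrite serCM /serZ /mono; case: j k jk => [|[|j]] [|k]; rewrite ?mulr0.
by rewrite (negPf jk) andbF.
Qed.

(** In odd degree there is exactly one resonant coefficient, and it absorbs
    the sum of the others. *)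
Lemma nf_map_diagonal n : normalized -> odd n -> (1 < n)%N ->
  \sum_(i < n.+1) h i (n - i)%N = 0.
Proof.
case: n => [|[|m]] // nm on _.
have E (i : 'I_m.+3) : h i (m.+2 - i)%N =
    nf_quotient l (nf_defect F (nf_stage normalized l F m).1 (nf_stage normalized l F m).2) i (m.+2 - i)%N
    + (if i == m.+2./2.+1 :> nat
       then - \sum_(i < m.+3) nf_quotient l (nf_defect F (nf_stage normalized l F m).1 (nf_stage normalized l F m).2) i (m.+2 - i)%N else 0).
  have im : (i + (m.+2 - i) = m.+2)%N by have := ltn_ord i; lia.
  rewrite /h /nf_map im /= im eqxx nm /=; congr (_ + _).
  by rewrite (_ : (_ == _) = (i == m.+2./2.+1 :> nat)) //; have := ltn_ord i; lia.
under eq_bigr => i _ do rewrite E.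
have Hm : (m.+2./2.+1 < m.+3)%N by lia.
rewrite big_split /= [X in _ + X](bigD1 (Ordinal Hm)) //= eqxx.
rewrite [X in _ + (_ + X)]big1 ?addr0 ?subrr // => i /negPf im.
by rewrite -val_eqE /= in im; rewrite im.
Qed.

End Limit.

End NormalForm.

(** * Families of series with graded coefficients *)

Section Graded.
Variables (R : realType) (X : Type).
Local Notation C := R[i].
Implicit Types (f g u v F : X -> ser C).

(** A filtration by degree of a class of functions on X; the cases of use are
    polynomials of bounded degree, continuous functions, functions that vanish
    in odd degree, and functions that agree at two points in low degree. *)
Record graded_class (P : nat -> (X -> C) -> Prop) : Prop := {
  graded0 : forall n, P n (fun=> 0);
  gradedC : forall c, P 0%N (fun=> c);
  gradedD : forall n a b, P n a -> P n b -> P n (fun x => a x + b x);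
  gradedM : forall m n a b, P m a -> P n b -> P (m + n)%N (fun x => a x * b x);
  gradedJ : forall n a, P n a -> P n (fun x => ((a x)^*)%C) }.

Variable P : nat -> (X -> C) -> Prop.
Hypothesis gP : graded_class P.

(** The shift by d makes the weights additive under products, and makes the
    coefficients of weight 0, such as the multiplier of a map when d = 1,
    constants for the filtration by polynomials. *)
Definition weighted d f := forall j k,
  ((j + k < d)%N -> forall x, f x j k = 0) /\
  ((d <= j + k)%N -> P (j + k - d)%N (fun x => f x j k)).

Lemma graded_sum n (I : Type) (r : seq I) (A : I -> X -> C) :
  (forall i, P n (A i)) -> P n (fun x => \sum_(i <- r) A i x).
Proof.
move=> PA; elim: r => [|i r IH].
  rewrite (_ : (fun _ => _) = fun=> 0); first exact: graded0.
  by apply/funext => x; rewrite big_nil.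
rewrite (_ : (fun _ => _) = fun x => A i x + \sum_(j <- r) A j x).
  exact: gradedD.
by apply/funext => x; rewrite big_cons.
Qed.

Lemma graded_cst_mul c n a : P n a -> P n (fun x => c * a x).
Proof. by rewrite -[n]add0n; apply: gradedM => //; apply: gradedC. Qed.

Lemma graded_opp n a : P n a -> P n (fun x => - a x).
Proof.
by move=> /(graded_cst_mul (-1)); congr P; apply/funext => x; rewrite mulN1r.
Qed.

Lemma weighted_ord d f x : weighted d f -> ord d (f x).
Proof. by move=> w j k jk; rewrite (w j k).1. Qed.

Lemma weightedD d f g : weighted d f -> weighted d g -> weighted d (fun x => f x + g x).
Proof.
move=> wf wg j k; split=> jk; first by move=> x; rewrite ser_addE (wf _ _).1 ?(wg _ _).1 ?addr0.
by apply: gradedD => //; [apply: (wf _ _).2 | apply: (wg _ _).2].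
Qed.

Lemma weightedN d f : weighted d f -> weighted d (fun x => - f x).
Proof.
move=> wf j k; split=> jk; first by move=> x; rewrite ser_oppE (wf _ _).1 ?oppr0.
by apply: graded_opp; apply: (wf _ _).2.
Qed.

Lemma weightedB d f g : weighted d f -> weighted d g -> weighted d (fun x => f x - g x).
Proof. by move=> wf wg; apply: weightedD => //; apply: weightedN. Qed.

Lemma weightedM d e f g : weighted d f -> weighted e g ->
  weighted (d + e) (fun x => f x * g x).
Proof.
move=> wf wg j k; split=> jk.
  by move=> x; apply: (ordM (weighted_ord x wf) (weighted_ord x wg)).
pose T (a : 'I_j.+1) (b : 'I_k.+1) x := f x a b * g x (j - a)%N (k - b)%N.
rewrite (_ : (fun _ => _) = fun x => \sum_a \sum_b T a b x); last by apply/funext.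
apply: graded_sum => a; apply: graded_sum => b; rewrite /T.
have := ltn_ord a; have := ltn_ord b => hb ha.
have z (s : X -> C) : (forall x, s x = 0) -> P (j + k - (d + e))%N s.
  by move=> s0; rewrite (_ : s = fun=> 0); [exact: graded0 | apply/funext].
have [ab|ab] := ltnP (a + b) d; first by apply: z => x; rewrite (wf _ _).1 ?mul0r.
have [ab'|ab'] := ltnP (j - a + (k - b)) e.
  by apply: z => x; rewrite (wg _ _).1 ?mulr0.
rewrite (_ : j + k - (d + e) = (a + b - d) + (j - a + (k - b) - e))%N; last by lia.
by apply: gradedM => //; [apply: (wf _ _).2 | apply: (wg _ _).2].
Qed.

Lemma weighted_conj d f : weighted d f -> weighted d (fun x => conj (f x)).
Proof.
move=> wf j k; rewrite [(j + k)%N]addnC; split=> jk.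
  by move=> x; rewrite conjE (wf _ _).1 ?rmorph0.
by apply: gradedJ => //; apply: (wf _ _).2.
Qed.

Lemma weighted_cst1 : weighted 0 (fun=> 1).
Proof.
move=> j k; split=> // _; rewrite subn0 (_ : (fun _ => _) = fun=> fps_one C j k) // /fps_one.
by case: j k => [|j] [|k] /=; rewrite ?mulr1n ?mulr0n; [apply: gradedC | apply: graded0..].
Qed.

Lemma weightedZ : weighted 1 (fun=> serZ).
Proof.
move=> j k; split=> jk; first by move=> x; apply: ord1Z.
rewrite /serZ /mono; case: eqP => [->|_]; case: eqP => [->|_] /=; by
  rewrite ?mulr0n; [apply: gradedC || apply: graded0..].
Qed.

Lemma weighted_scale d c f : weighted d f -> weighted d (fun x => serC c * f x).
Proof.
move=> wf j k; split=> jk; first by move=> x; rewrite serCM (wf _ _).1 ?mulr0.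
rewrite (_ : (fun _ => _) = fun x => c * f x j k); last by apply/funext => x; rewrite serCM.
by apply: graded_cst_mul; apply: (wf _ _).2.
Qed.

Lemma weightedX n u : weighted 1 u -> weighted n (fun x => u x ^+ n).
Proof.
move=> wu; elim: n => [|n IH].
  by rewrite (_ : (fun _ => _) = fun=> 1); [exact: weighted_cst1 | apply/funext => x; rewrite expr0].
rewrite (_ : (fun _ => _) = fun x => u x * u x ^+ n); last by apply/funext => x; rewrite exprS.
by rewrite -add1n; apply: weightedM.
Qed.

Lemma weighted_subst d f u v : weighted d f -> weighted 1 u -> weighted 1 v ->
  weighted d (fun x => subst (f x) (u x) (v x)).
Proof.
move=> wf wu wv j k; split=> jk.
  by move=> x; apply: (ord_subst (weighted_ord x wf) (weighted_ord x wu) (weighted_ord x wv)).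
pose T (a b : 'I_(j + k).+1) x := f x a b * (u x ^+ a * v x ^+ b) j k.
rewrite (_ : (fun _ => _) = fun x => \sum_a \sum_b T a b x); last first.
  by apply/funext => x; rewrite subst_coef.
apply: graded_sum => a; apply: graded_sum => b; rewrite /T.
have wab := weightedM (weightedX a wu) (weightedX b wv).
have z (s : X -> C) : (forall x, s x = 0) -> P (j + k - d)%N s.
  by move=> s0; rewrite (_ : s = fun=> 0); [exact: graded0 | apply/funext].
have [ab|ab] := ltnP (a + b) d; first by apply: z => x; rewrite (wf _ _).1 ?mul0r.
have [ab'|ab'] := ltnP (j + k) (a + b).
  by apply: z => x; rewrite (wab _ _).1 ?mulr0.
rewrite (_ : j + k - d = (a + b - d) + (j + k - (a + b)))%N; last by lia.
by apply: gradedM => //; [apply: (wf _ _).2 | apply: (wab _ _).2].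
Qed.

Lemma weighted_comp d f u : weighted d f -> weighted 1 u ->
  weighted d (fun x => comp (f x) (u x)).
Proof. by move=> wf wu; apply: weighted_subst => //; apply: weighted_conj. Qed.

Lemma weighted_nf_stage normalized l F m : weighted 1 F ->
  weighted 1 (fun x => (nf_stage normalized l (F x) m).1) /\
  weighted 1 (fun x => (nf_stage normalized l (F x) m).2).
Proof.
move=> wF; elim: m => [|m [IH1 IH2]] /=.
  by split; [exact: weightedZ | apply: weighted_scale; exact: weightedZ].
have wE : weighted 1 (fun x => nf_defect (F x) (nf_stage normalized l (F x) m).1
    (nf_stage normalized l (F x) m).2).
  by apply: weightedB; apply: weighted_comp.
set E := (fun x => nf_defect _ _ _) in wE.
split=> j k; split=> jk.
- move=> x; rewrite (_ : (j + k)%N == m.+2 = false); last by lia.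
  by rewrite (IH1 _ _).1.
- have [jkm|_] := eqVneq (j + k)%N m.+2; last by apply: (IH1 _ _).2.
  have wq a b : (a + b = m.+2)%N -> P (j + k - 1) (fun x => nf_quotient l (E x) a b).
    move=> ab; have [_ /(_ _)] := wE a b; rewrite ab jkm => /(_ isT) PE.
    have := graded_cst_mul (- (l ^+ a * (l^*)%C ^+ b - l)^-1) PE.
    congr P; apply/funext => x; rewrite /nf_quotient; ring.
  apply: gradedD => //; first exact: wq.
  case: (normalized && _); last exact: graded0.
  apply: graded_opp; apply: graded_sum => i; apply: wq.
  by have := ltn_ord i; lia.
- move=> x; rewrite (_ : (j + k)%N == m.+2 = false) /=; last by lia.
  by rewrite (IH2 _ _).1.
- by case: ((_ == _) && _); [apply: (wE _ _).2 | apply: (IH2 _ _).2].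
Qed.

(** The normal form is obtained from F by ring operations, conjugations,
    compositions and divisions by constants, all of which respect the grading.
    Polynomial dependence on a parameter, continuity, oddness and finite
    determinacy of the normal form are instances. *)
Lemma weighted_nf normalized l F : weighted 1 F ->
  weighted 1 (fun x => nf_map normalized l (F x)) /\
  weighted 1 (fun x => nf_form normalized l (F x)).
Proof.
move=> wF; split=> j k.
  by have [w _] := weighted_nf_stage normalized l (j + k).-1 wF; apply: w.
by have [_ w] := weighted_nf_stage normalized l (j + k).-1 wF; apply: w.
Qed.

End Graded.

Section GradedApplications.
Variable R : realType.
Local Notation C := R[i].
Implicit Types (F G h N : ser C) (l : C).

Lemma odd_mapP F : odd_map F <-> forall j k, ~~ odd (j + k) -> F j k = 0.
Proof.
split=> oF j k; last first.
  have [ojk|/oF ->] := boolP (odd (j + k)); last by rewrite mulr0 oppr0.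
  by rewrite -signr_odd ojk expr1 mulN1r.
move=> ejk; have := oF j k; rewrite -signr_odd (negPf ejk) expr0 mul1r => /eqP.
by rewrite -addr_eq0 -mulr2n mulrn_eq0 /= => /eqP.
Qed.

Let parity n (a : unit -> C) := odd n -> forall x, a x = 0.

Lemma graded_parity : graded_class parity.
Proof.
split=> //.
- by move=> n a b pa pb on x; rewrite pa ?pb ?addr0.
- move=> m n a b pa pb; rewrite /parity oddD => mn x.
  move: mn; case: (boolP (odd m)) => [om _|_ on]; first by rewrite pa ?mul0r.
  by rewrite pb ?mulr0.
- by move=> n a pa on x; rewrite pa ?rmorph0.
Qed.

Lemma weighted_parity F : ord 1 F -> odd_map F <-> weighted parity 1 (fun=> F).
Proof.
move=> oF; split=> [/odd_mapP H j k|H]; last first.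
  apply/odd_mapP => j k ejk; have [jk|jk] := ltnP (j + k) 1; first exact: oF.
  by apply: ((H j k).2 jk _ tt); move: ejk jk; lia.
split=> jk; first by move=> _; apply: oF.
by move=> ojk _; apply: H; move: ojk jk; lia.
Qed.

Lemma odd_comp F G : ord 1 G -> ord 1 F -> odd_map F -> odd_map G ->
  odd_map (comp F G).
Proof.
move=> oG oF.
move=> /(weighted_parity oF) wF /(weighted_parity oG) wG.
apply/(weighted_parity (ord_comp oF oG)).
exact: (weighted_comp graded_parity wF wG).
Qed.

Lemma odd_nf normalized l F : multiplier l F -> odd_map F ->
  odd_map (nf_map normalized l F) /\ odd_map (nf_form normalized l F).
Proof.
move=> mF /(weighted_parity (multiplier_ord mF)) wF.
have [wh wN] := weighted_nf graded_parity normalized l wF.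
by split; apply/weighted_parity => //; [exact: (weighted_ord tt wh) | exact: (weighted_ord tt wN)].
Qed.

(** This is the grading by the property of agreeing on F and G in the degrees at
    most n, the index set X being a type with two elements. *)
Lemma nf_agree normalized l F G n : multiplier l F -> multiplier l G ->
  ord n.+2 (F - G) ->
  ord n.+2 (nf_map normalized l F - nf_map normalized l G) /\
  ord n.+2 (nf_form normalized l F - nf_form normalized l G).
Proof.
move=> mF mG /ord_subP FG.
pose P m (a : bool -> C) := (m < n.+1)%N -> a true = a false.
have gP : graded_class P.
  split=> //.
  - by move=> m a b pa pb mn; rewrite pa ?pb.
  - by move=> m m' a b pa pb mn; rewrite pa ?pb //; lia.
  - by move=> m a pa mn; rewrite pa.
have wF : weighted P 1 (fun b : bool => if b then F else G).
  move=> j k; split=> jk.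
    by case; [apply: (multiplier_ord mF) | apply: (multiplier_ord mG)].
  by move=> jkn; apply: FG; lia.
have [wh wN] := weighted_nf gP normalized l wF.
split; apply/ord_subP => j k jk.
  have [j0|j0] := ltnP (j + k) 1.
    by rewrite ((wh j k).1 j0 true) ((wh j k).1 j0 false).
  by apply: ((wh j k).2 j0); lia.
have [j0|j0] := ltnP (j + k) 1.
  by rewrite ((wN j k).1 j0 true) ((wN j k).1 j0 false).
by apply: ((wN j k).2 j0); lia.
Qed.

End GradedApplications.

(** * Integrals *)

Section Integrals.
Variable R : realType.
Local Notation C := R[i].
Implicit Types (F G h N I f g u v D : ser C) (l : C) (gam e : nat -> C).

(** A series in one indeterminate, read off the first axis; composing it with
    I on the right is then substitution of I for that indeterminate. *)
Definition one_var gam : ser C := fun j k => if k == 0%N then gam j else 0.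
Definition diagonal gam : ser C := fun j k => if j == k then gam j else 0.

Definition tangent gam := gam 0%N = 0 /\ gam 1%N = 1.

Lemma one_var_multiplier gam : tangent gam -> multiplier (1 : C) (one_var gam).
Proof. by case. Qed.

Lemma subst_one_var gam u v w : ord 1 u -> ord 1 v -> ord 1 w ->
  subst (one_var gam) u v = subst (one_var gam) u w.
Proof.
move=> ou ov ow; apply: serP => j k; rewrite !subst_coef; apply: eq_bigr => a _.
apply: eq_bigr => b _; have [->|b0] := posnP b; first by rewrite !expr0.
have z : one_var gam a b = 0 by rewrite /one_var (gtn_eqF b0).
by rewrite z [LHS]mul0r [RHS]mul0r.
Qed.

Lemma ord2_ZW : ord 2 (serZ * serW : ser C).
Proof. by apply: (@ordM _ 1 1); [apply: ord1Z | apply: ord1W]. Qed.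

Lemma conj_ZW : conj (serZ * serW) = serZ * serW :> ser C.
Proof. by rewrite conjM conjZ conjW mulrC. Qed.

Lemma diagonalE gam : diagonal gam = comp (one_var gam) (serZ * serW).
Proof.
have o : ord 1 (serZ * serW : ser C) by apply: ord_le ord2_ZW.
apply: serP => j k; rewrite compE (@subst_one_var _ _ _ 0) //; last exact: ord_conj.
rewrite (@subst_coef_wide _ (j + k).+1) //.
have Hj : (j < (j + k).+1)%N by lia.
rewrite (bigD1 (Ordinal Hj)) //= (bigD1 (ord0 : 'I_(j + k).+1)) //=.
have z (a b : nat) : b != 0%N -> one_var gam a b = 0 by rewrite /one_var => /negPf ->.
rewrite big1 => [|b b0]; last by rewrite z ?mul0r.
rewrite big1 => [|a ja]; last first.
  rewrite big1 // => b _; have [->|b0] := eqVneq (b : nat) 0%N; last by rewrite z ?mul0r.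
  rewrite expr0 mulr1 exprMn -monoE /mono; move: ja; rewrite -val_eqE /= eq_sym => /negPf ->.
  by rewrite mulr0.
rewrite !addr0 expr0 mulr1 exprMn -monoE /mono eqxx /diagonal /one_var /= eq_sym.
by case: eqP; rewrite ?mulr1 ?mulr0.
Qed.

(** An integral in the weak sense: F permutes the level sets of I according to
    gam, and preserves them when gam is the identity. *)
Definition is_integral F I gam :=
  [/\ ord 3 (I - serZ * serW), tangent gam & comp I F = comp (one_var gam) I].

Lemma is_integral_ord F I gam : is_integral F I gam -> ord 2 I.
Proof.
case=> oI _ _; rewrite -(subrK (serZ * serW) I); apply: ordD; last exact: ord2_ZW.
exact: ord_le oI.
Qed.

(** The eigenspaces of the circle action that maps z to u z and w to w / u. *)
Definition weight (m : int) f := forall j k, (j%:Z - k%:Z)%R != m -> f j k = 0.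

Lemma weightM m n f g : weight m f -> weight n g -> weight (m + n) (f * g).
Proof.
move=> wf wg j k jk; rewrite ser_coefM big1 // => a _; rewrite big1 // => b _.
have [ab|/wf ->] := eqVneq (a%:Z - b%:Z)%R m; last by rewrite mul0r.
rewrite wg ?mulr0 //; move: jk ab; have := ltn_ord a; have := ltn_ord b; lia.
Qed.
Lemma weight1 : weight 0 1.
Proof. by move=> [|j] [|k]. Qed.
Lemma weightX m f n : weight m f -> weight (m * n%:Z) (f ^+ n).
Proof.
move=> wf; elim: n => [|n IH]; first by rewrite mulr0 expr0; exact: weight1.
by rewrite exprS -addn1 PoszD mulrDr mulr1 addrC; apply: weightM.
Qed.
Lemma weight_conj m f : weight m f -> weight (- m) (conj f).
Proof. by move=> wf j k jk; rewrite conjE wf ?rmorph0 //; move: jk; lia. Qed.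
Lemma weight_resonant N : resonant N -> weight 1 N.
Proof. by move=> rN j k jk; apply: rN; move: jk; lia. Qed.

Lemma subst_weight m f u v : ord 1 u -> ord 1 v ->
  (forall a b, f a b != 0 -> weight m (u ^+ a * v ^+ b)) -> weight m (subst f u v).
Proof.
move=> ou ov H j k jk; rewrite subst_coef big1 // => a _; rewrite big1 // => b _.
by have [->|/H ->//] := eqVneq (f a b) 0; rewrite ?mul0r ?mulr0.
Qed.

Lemma weight_comp_resonant m f N : ord 1 N -> resonant N -> weight m f -> weight m (comp f N).
Proof.
move=> oN /weight_resonant wN wf; apply: subst_weight => //; first exact: ord_conj.
move=> a b fab; have -> : m = 1 * a%:Z + (- 1) * b%:Z.
  by have [ab|/wf fab0] := eqVneq (a%:Z - b%:Z)%R m; [lia | rewrite fab0 eqxx in fab].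
by apply: weightM; apply: weightX => //; apply: weight_conj.
Qed.

Lemma weight_comp_diag gam f : ord 1 f -> weight 0 f -> weight 0 (comp (one_var gam) f).
Proof.
move=> o wf; apply: subst_weight => //; first exact: ord_conj.
move=> a [|b]; last by rewrite /one_var /= eqxx.
by move=> _; rewrite expr0 mulr1 -(mul0r a%:Z); apply: weightX.
Qed.

Lemma norm_lead h : multiplier 1 h -> ord 3 (h * conj h - serZ * serW).
Proof.
move=> mh; have oh := multiplier_ord mh.
move/multiplierP: (mh); rewrite rmorph1 mul1r => o2.
rewrite (_ : _ - _ = (h - serZ) * conj h + serZ * (conj h - conj serZ)); last first.
  by rewrite conjZ; ring.
apply: ordD; first by apply: (@ordM _ 2 1) => //; apply: ord_conj.
apply: (@ordM _ 1 2); first exact: ord1Z.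
by rewrite -conjB; apply: ord_conj.
Qed.

Section Uniqueness.
Variables (l : C) (F h N : ser C).
Hypothesis l_unit : l * (l^*)%C = 1.
Hypothesis l_irr : forall n, (0 < n)%N -> l ^+ n != 1.
Hypotheses (mF : multiplier l F) (mh : multiplier 1 h) (mN : multiplier l N).
Hypotheses (rN : resonant N) (hF : comp h F = comp N h).

(** N multiplies z by a function of z w, and so does the conjugate with w. *)
Lemma resonant_norm_diagonal : exists2 gam, tangent gam & N * conj N = diagonal gam.
Proof.
have w : weight 0 (N * conj N).
  by rewrite -(subrr (1 : int)); apply: weightM; rewrite -?weight_conj;
    [exact: weight_resonant | apply: weight_conj; exact: weight_resonant].
exists (fun j => (N * conj N) j j).
  have [N00 N10 N01] := mN; split.
    by rewrite ser_coefM !big_ord1 N00 mul0r.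
  rewrite ser_coefM !big_ord_recl !big_ord0 /= !conjE /= /bump /= !add1n ?subn0 ?subnn.
  by rewrite N00 N10 N01 ?rmorph0 !mul0r ?mulr0 ?add0r ?addr0 l_unit.
apply: serP => j k; rewrite /diagonal; case: eqP => [->//|jk]; apply: w; lia.
Qed.

Lemma canonical_integral gam : N * conj N = diagonal gam -> tangent gam ->
  is_integral F (h * conj h) gam.
Proof.
move=> Ng tg.
have [[oh oF] oN] := (multiplier_ord mh, multiplier_ord mF, multiplier_ord mN).
split=> //; first exact: norm_lead.
have oZW : ord 1 (serZ * serW : ser C) by apply: ord_le ord2_ZW.
rewrite (compM _ _ oF) -conj_comp hF conj_comp -(compM _ _ oh) Ng diagonalE.
rewrite (comp_assoc _ oZW oh).
by rewrite (compM _ _ oh) (id_comp oh) -conjZ -conj_comp (id_comp oh).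
Qed.

(** All integrals are functions of h conj h: in normal form
    coordinates, an off-diagonal term of lowest degree would be an eigenvector
    of the rotation for the eigenvalue 1. *)
Lemma integral_unique I gam : is_integral F I gam ->
  exists2 e, tangent e & I = comp (one_var e) (h * conj h).
Proof.
move=> iI; have oI := is_integral_ord iI; case: iI => oI3 tg IF.
have [k [mk hk kh _]] := inverse_exists mh.
have [[[oh oF] oN] ok] := (multiplier_ord mh, multiplier_ord mF, multiplier_ord mN, multiplier_ord mk).
have oI1 : ord 1 I by apply: ord_le oI.
pose I2 := comp I k.
have oI2 : ord 1 I2 by apply: ord_comp.
have FN : comp k N = comp F k.
  rewrite -[comp k N]comp_id -hk -[in LHS]comp_assoc // [comp (comp k N) h]comp_assoc //.
  by rewrite -hF -comp_assoc // kh id_comp.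
have I2N : comp I2 N = comp (one_var gam) I2.
  by rewrite /I2 (comp_assoc I ok oN) FN -(comp_assoc I oF ok) IF (comp_assoc _ oI1 ok).
pose D : ser C := fun j k => if j == k then 0 else I2 j k.
pose r : ser C := I2 - D.
have wr : weight 0 r.
  by move=> i j ij; rewrite /r ser_subE /D ifN ?subrr //; apply: contraNneq ij => ->; lia.
have o1g := multiplier_ord (one_var_multiplier tg).
have D0 n : ord n.+1 D.
  elim: n => [|n IH].
    by move=> i j; rewrite /D; case: i => [|i]; case: j => [|j].
  have or : ord 1 r by apply: ordB => //; apply: ord_le IH.
  move=> i j; rewrite ltnS leq_eqVlt => /orP[/eqP ij|]; last exact: IH.
  rewrite /D; case: eqVneq => // nij; rewrite -/(D i j).
  have Dij : D i j = I2 i j by rewrite /D (negPf nij).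
  have nij' : (i%:Z - j%:Z)%R != 0 by move: nij; lia.
  have E1 : comp I2 N i j = D i j * (l ^+ i * (l^*)%C ^+ j).
    rewrite (_ : I2 = r + D); last by rewrite /r; ring.
    rewrite compD ser_addE (weight_comp_resonant oN rN wr nij') add0r.
    have [N00 N10 N01] := mN.
    by apply: (subst_lead IH oN (ord_conj oN)); rewrite ?conjE ?N10 ?N01 ?rmorph0.
  have E2 : comp (one_var gam) I2 i j = D i j.
    have X := @subst_expand _ (one_var gam) r (conj r) D (conj D) n.+1 isT or (ord_conj or) IH (ord_conj IH).
    case: tg => g0 g1.
    rewrite -conjD (_ : r + D = I2) in X; last by rewrite /r; ring.
    move/ord_subP: X => /(_ i j); rewrite ij ltnS leqnn => /(_ isT).
    rewrite compE => ->; rewrite !ser_addE !serCM -compE.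
    rewrite (@weight_comp_diag gam _ or wr _ _ nij') /one_var /= g1 mul1r mul0r addr0 add0r.
    by [].
  have := divisor_neq1 l_unit l_irr nij; rewrite -Dij.
  move: I2N => /(congr1 (fun f : ser C => f i j)); rewrite E1 E2 => /eqP.
  rewrite -subr_eq0 -[X in _ - X]mulr1 -mulrBr mulf_eq0 => /orP[/eqP-> //|].
  by rewrite subr_eq0 => ->.
have I2d : I2 = diagonal (fun j => I2 j j).
  apply: serP => i j; rewrite /diagonal; case: eqP => [->//|/eqP ij].
  by have := D0 (i + j)%N i j (leqnn _); rewrite /D (negPf ij).
have te : tangent (fun j => I2 j j).
  have X : ord 3 (I2 - serZ * serW).
    rewrite (_ : _ - _ = comp (I - serZ * serW) k + (comp (serZ * serW) k - serZ * serW)); last first.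
      by rewrite /I2 compB; ring.
    apply: ordD; first exact: ord_comp.
    rewrite (compM _ _ ok) (id_comp ok) -conjZ -conj_comp (id_comp ok).
    by rewrite conjZ; apply: norm_lead.
  by move/ord_subP: X => X; split; rewrite X // /serW /serZ mono_mono.
exists (fun j => I2 j j) => //.
transitivity (comp I2 h); first by rewrite /I2 (comp_assoc I ok oh) kh comp_id.
have oZW : ord 1 (serZ * serW : ser C) by apply: ord_le ord2_ZW.
rewrite [in LHS]I2d diagonalE (comp_assoc _ oZW oh).
by rewrite (compM _ _ oh) (id_comp oh) -conjZ -conj_comp (id_comp oh).
Qed.

End Uniqueness.

End Integrals.

(** * Convergence of series *)

Section Modulus.
Variable R : realType.
Local Notation C := R[i].
Implicit Types (x y z : C).

Lemma cabsE z : `|z| = ((cabs z)%:C)%C. Proof. by []. Qed.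
Lemma cabs_ge0 z : 0 <= cabs z.
Proof. by have := normr_ge0 z; rewrite cabsE ler0c. Qed.
Lemma cabs0 : cabs (0 : C) = 0.
Proof. by rewrite /cabs normr0. Qed.
Lemma cabs1 : cabs (1 : C) = 1.
Proof. by rewrite /cabs normr1. Qed.
Lemma cabs_eq0 z : (cabs z == 0) = (z == 0).
Proof. by apply/eqP/eqP => [/ComplexField.Normc.eq0_normc //|->]; exact: cabs0. Qed.
Lemma cabsM x y : cabs (x * y) = cabs x * cabs y.
Proof. exact: ComplexField.Normc.normcM. Qed.
Lemma cabsX x n : cabs (x ^+ n) = cabs x ^+ n.
Proof. by elim: n => [|n IH]; rewrite ?expr0 ?cabs1 // !exprS cabsM IH. Qed.
Lemma cabsN x : cabs (- x) = cabs x.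
Proof. by rewrite /cabs normrN. Qed.
Lemma cabsJ x : cabs (x^*)%C = cabs x.
Proof. by rewrite /cabs; have -> : `|(x^*)%C| = `|x| by exact: normcJ. Qed.
Lemma cabsV x : cabs x^-1 = (cabs x)^-1.
Proof. exact: ComplexField.Normc.normcV. Qed.
Lemma cabs_real (a : R) : cabs (a%:C)%C = `|a|.
Proof. by rewrite /cabs normc_def /= expr0n /= addr0 sqrtr_sqr. Qed.
Lemma cabsD x y : cabs (x + y) <= cabs x + cabs y.
Proof. by rewrite -lecR rmorphD /= -!cabsE; apply: ler_normD. Qed.
Lemma cabsB x y : cabs (x - y) <= cabs x + cabs y.
Proof. by rewrite -[cabs y]cabsN; apply: cabsD. Qed.
Lemma cabs_sum I r (P : pred I) (F : I -> C) :
  cabs (\sum_(i <- r | P i) F i) <= \sum_(i <- r | P i) cabs (F i).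
Proof.
elim/big_rec2: _ => [|i y x _ H]; first by rewrite cabs0.
by apply: le_trans (cabsD _ _) _; rewrite lerD2l.
Qed.
Lemma cabs_prod I r (P : pred I) (F : I -> C) :
  cabs (\prod_(i <- r | P i) F i) = \prod_(i <- r | P i) cabs (F i).
Proof. by elim/big_rec2: _ => [|i y x _ <-]; rewrite ?cabs1 // cabsM. Qed.

End Modulus.

Section Norms.
Variable R : realType.
Local Notation C := R[i].
Implicit Types (F G f g u v : ser C) (x y : R).

(** A series converges near 0 exactly when these finite sums are bounded in n for
    some x > 0. Truncation keeps all estimates finite, and the truncation at n
    of a product is bounded by the product of the truncations at n. *)
Definition nrm x n f : R :=
  \sum_(j < n.+1) \sum_(k < n.+1) cabs (f j k) * x ^+ (j + k).

Definition bounded f := exists x K : R, 0 < x /\ forall n, nrm x n f <= K.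

Lemma nrm_ge0 x n f : 0 <= x -> 0 <= nrm x n f.
Proof.
move=> x0; apply: sumr_ge0 => j _; apply: sumr_ge0 => k _.
by rewrite mulr_ge0 ?cabs_ge0 ?exprn_ge0.
Qed.

Lemma nrm_coef x n f j k : 0 <= x -> (j <= n)%N -> (k <= n)%N ->
  cabs (f j k) * x ^+ (j + k) <= nrm x n f.
Proof.
move=> x0 jn kn; rewrite /nrm (bigD1 (Ordinal (jn : j < n.+1)%N)) //=.
rewrite (bigD1 (Ordinal (kn : k < n.+1)%N)) //= -addrA lerDl addr_ge0 //.
  by apply: sumr_ge0 => i _; rewrite mulr_ge0 ?cabs_ge0 ?exprn_ge0.
by apply: sumr_ge0 => i _; apply: sumr_ge0 => l _; rewrite mulr_ge0 ?cabs_ge0 ?exprn_ge0.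
Qed.

Lemma sum_triangle n (u : nat -> nat -> R) : (forall a b, 0 <= u a b) ->
  \sum_(j < n) \sum_(a < j.+1) u a (j - a)%N <= \sum_(a < n) \sum_(b < n) u a b.
Proof.
move=> u0.
pose T (j a : nat) := if (a <= j)%N then u a (j - a)%N else 0.
rewrite (_ : \sum_(j < n) _ = \sum_(j < n) \sum_(a < n) T j a); last first.
  apply: eq_bigr => j _.
  rewrite (big_ord_widen n (fun a => u a (j - a)%N)) ?ltn_ord // big_mkcond /=.
  by apply: eq_bigr => a _; rewrite /T ltnS.
rewrite exchange_big /=; apply: ler_sum => a _.
rewrite -(big_mkord xpredT (fun j => T j a)) (big_cat_nat (n := a)) //=; last by apply: ltnW.
rewrite big_nat_cond big1 ?add0r; last first.
  by move=> j /andP[/andP[_ ja] _]; rewrite /T leqNgt ja.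
rewrite -{1}[a : nat]add0n big_addn -(big_mkord xpredT (fun b => u a b)).
rewrite [leRHS](big_cat_nat (n := (n - a)%N)) ?leq_subr //=.
rewrite (eq_bigr (fun i => u a i)) => [|i _]; last by rewrite /T leq_addl addnK.
by rewrite lerDl sumr_ge0.
Qed.

Lemma nrmM x n f g : 0 <= x -> nrm x n (f * g) <= nrm x n f * nrm x n g.
Proof.
move=> x0.
pose w a c b d := (cabs (f a b) * x ^+ (a + b)) * (cabs (g c d) * x ^+ (c + d)).
have w0 a c b d : 0 <= w a c b d.
  by rewrite /w !mulr_ge0 ?cabs_ge0 ?exprn_ge0.
apply: (@le_trans _ _ (\sum_(j < n.+1) \sum_(a < j.+1)
    \sum_(k < n.+1) \sum_(b < k.+1) w a (j - a)%N b (k - b)%N)).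
  apply: ler_sum => j _; rewrite exchange_big /=; apply: ler_sum => k _.
  rewrite ser_coefM; apply: le_trans (ler_wpM2r (exprn_ge0 _ x0) (cabs_sum _ _ _)) _.
  rewrite mulr_suml; apply: ler_sum => a _.
  apply: le_trans (ler_wpM2r (exprn_ge0 _ x0) (cabs_sum _ _ _)) _.
  rewrite mulr_suml; apply: ler_sum => b _.
  rewrite cabsM /w mulrACA -exprD.
  by rewrite (_ : a + b + (j - a + (k - b)) = j + k)%N //; have := ltn_ord a; have := ltn_ord b; lia.
apply: (@le_trans _ _ (\sum_(j < n.+1) \sum_(a < j.+1)
    \sum_(b < n.+1) \sum_(d < n.+1) w a (j - a)%N b d)).
  by apply: ler_sum => j _; apply: ler_sum => a _; apply: (@sum_triangle _ (w a (j - a)%N)).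
apply: le_trans (@sum_triangle _ (fun a c => \sum_(b < n.+1) \sum_(d < n.+1) w a c b d) _) _.
  by move=> a c; apply: sumr_ge0 => b _; apply: sumr_ge0.
rewrite /nrm mulr_suml; apply: ler_sum => a _; rewrite exchange_big /= mulr_suml.
apply: ler_sum => b _; rewrite mulr_sumr; apply: ler_sum => c _.
by rewrite mulr_sumr.
Qed.

Lemma nrmD x n f g : 0 <= x -> nrm x n (f + g) <= nrm x n f + nrm x n g.
Proof.
move=> x0; rewrite /nrm -big_split /=; apply: ler_sum => j _; rewrite -big_split /=.
apply: ler_sum => k _; rewrite -mulrDl ler_wpM2r ?exprn_ge0 //.
by rewrite ser_addE cabsD.
Qed.
Lemma nrmN x n f : nrm x n (- f) = nrm x n f.
Proof. by apply: eq_bigr => j _; apply: eq_bigr => k _; rewrite ser_oppE cabsN. Qed.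
Lemma nrm_conj x n f : nrm x n (conj f) = nrm x n f.
Proof.
rewrite /nrm exchange_big; apply: eq_bigr => j _; apply: eq_bigr => k _.
by rewrite conjE cabsJ addnC.
Qed.
Lemma nrm_mono x n a b : 0 <= x -> nrm x n (mono a b) <= x ^+ (a + b).
Proof.
move=> x0; rewrite /nrm.
have E (j k : nat) : cabs (mono a b j k : C) * x ^+ (j + k)
    = (if j == a then if k == b then x ^+ (a + b) else 0 else 0).
  rewrite /mono; case: eqP => [->|_]; case: eqP => [->|_] /=;
    by rewrite ?cabs0 ?cabs1 ?mul0r ?mul1r.
under eq_bigr do under eq_bigr do rewrite E.
have [an|an] := ltnP a n.+1; last first.
  rewrite big1 ?exprn_ge0 // => j _; rewrite big1 // => k _.
  by rewrite (ltn_eqF (leq_trans (ltn_ord j) an)).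
rewrite (bigD1 (Ordinal an)) //= eqxx [X in _ + X]big1 => [|j /negPf ja]; last first.
  by rewrite -val_eqE /= in ja; rewrite big1 // => k _; rewrite ja.
have [bn|bn] := ltnP b n.+1; last first.
  rewrite addr0 big1 ?exprn_ge0 // => k _.
  by rewrite (ltn_eqF (leq_trans (ltn_ord k) bn)).
rewrite addr0 (bigD1 (Ordinal bn)) //= eqxx big1 ?addr0 // => k /negPf kb.
by rewrite -val_eqE /= in kb; rewrite kb.
Qed.
Lemma nrm1 x n : 0 <= x -> nrm x n 1 <= 1.
Proof.
move=> x0; have := nrm_mono n 0 0 x0; rewrite expr0.
by rewrite (_ : mono 0 0 = 1); last by apply: serP => j k.
Qed.
Lemma nrmX x n f m : 0 <= x -> nrm x n (f ^+ m) <= nrm x n f ^+ m.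
Proof.
move=> x0; elim: m => [|m IH]; first by rewrite !expr0 nrm1.
rewrite !exprS; apply: le_trans (nrmM _ _ _ x0) _.
by rewrite ler_wpM2l ?nrm_ge0.
Qed.

Lemma nrm_le x y n f : 0 <= x -> x <= y -> nrm x n f <= nrm y n f.
Proof.
move=> x0 xy; apply: ler_sum => j _; apply: ler_sum => k _.
by rewrite ler_wpM2l ?cabs_ge0 // lerXn2r // nnegrE (le_trans x0).
Qed.

(** A series of order d is O(x^d), with the constant read at a larger radius. *)
Lemma nrm_scale d t x n f : ord d f -> 0 <= x -> 0 <= t <= 1 ->
  nrm (t * x) n f <= t ^+ d * nrm x n f.
Proof.
move=> of_ x0 /andP[t0 t1]; rewrite /nrm mulr_sumr; apply: ler_sum => j _.
rewrite mulr_sumr; apply: ler_sum => k _; have [jk|jk] := ltnP (j + k) d.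
  by rewrite of_ // cabs0 !mul0r mulr0.
rewrite exprMn mulrCA ler_wpM2r ?mulr_ge0 ?cabs_ge0 ?exprn_ge0 //.
by apply: ler_wiXn2l.
Qed.

(** Substitution is dominated by substitution of the norms. *)
Lemma nrm_subst x y n f u v : 0 <= x -> ord 1 u -> ord 1 v ->
  nrm x n u <= y -> nrm x n v <= y -> nrm x n (subst f u v) <= nrm y (n + n) f.
Proof.
move=> x0 ou ov uy vy.
have y0 : 0 <= y by apply: le_trans uy; apply: nrm_ge0.
pose w a b j k := cabs (f a b) * (cabs ((u ^+ a * v ^+ b) j k) * x ^+ (j + k)).
apply: (@le_trans _ _ (\sum_(j < n.+1) \sum_(k < n.+1)
    \sum_(a < (n + n).+1) \sum_(b < (n + n).+1) w a b j k)).
  apply: ler_sum => j _; apply: ler_sum => k _.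
  rewrite (@subst_coef_wide _ (n + n).+1) //; last by have := ltn_ord j; have := ltn_ord k; lia.
  apply: le_trans (ler_wpM2r (exprn_ge0 _ x0) (cabs_sum _ _ _)) _.
  rewrite mulr_suml; apply: ler_sum => a _.
  apply: le_trans (ler_wpM2r (exprn_ge0 _ x0) (cabs_sum _ _ _)) _.
  by rewrite mulr_suml; apply: ler_sum => b _; rewrite cabsM /w mulrA.
have -> : \sum_(j < n.+1) \sum_(k < n.+1)
    \sum_(a < (n + n).+1) \sum_(b < (n + n).+1) w a b j k
  = \sum_(a < (n + n).+1) \sum_(b < (n + n).+1)
     \sum_(j < n.+1) \sum_(k < n.+1) w a b j k.
  under eq_bigr do rewrite exchange_big.
  rewrite exchange_big; apply: eq_bigr => a _.
  under eq_bigr do rewrite exchange_big.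
  by rewrite exchange_big.
apply: ler_sum => a _; apply: ler_sum => b _.
rewrite /w; under eq_bigr do rewrite -mulr_sumr.
rewrite -mulr_sumr ler_wpM2l ?cabs_ge0 // -/(nrm x n (u ^+ a * v ^+ b)).
apply: le_trans (nrmM _ _ _ x0) _; rewrite exprD.
apply: ler_pM; rewrite ?nrm_ge0 //; apply: le_trans (nrmX _ _ _ x0) _;
  by rewrite lerXn2r // ?nnegrE ?nrm_ge0.
Qed.

Lemma bounded_small d f y : bounded f -> ord d.+1 f -> 0 < y ->
  exists2 x0 : R, 0 < x0 & forall x, 0 <= x <= x0 -> forall n, nrm x n f <= y * x ^+ d.
Proof.
move=> [x1 [K [x1p fK]]] of_ y0.
have K0 : 0 <= K by apply: le_trans (fK 0%N); rewrite nrm_ge0 // ltW.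
pose x0 := Num.min x1 (y * x1 ^+ d.+1 / (K + 1)).
exists x0.
  by rewrite /x0 lt_min x1p divr_gt0 ?mulr_gt0 ?exprn_gt0 // ltr_wpDl.
move=> x /andP[x_ge0 xx0] n.
have xx1 : x <= x1 by apply: le_trans xx0 _; rewrite ge_min lexx.
have xy : x <= y * x1 ^+ d.+1 / (K + 1) by apply: le_trans xx0 _; rewrite ge_min lexx orbT.
have E : x = x / x1 * x1 by rewrite divfK ?gt_eqF.
rewrite [X in nrm X]E; apply: le_trans (nrm_scale _ of_ (ltW x1p) _) _.
  by rewrite divr_ge0 ?(ltW x1p) //= ler_pdivrMr ?mul1r.
apply: (@le_trans _ _ ((x / x1) ^+ d.+1 * (K + 1))).
  by rewrite ler_wpM2l ?exprn_ge0 ?divr_ge0 ?(ltW x1p) // (le_trans (fK n)) ?lerDl.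
rewrite expr_div_n exprS -!mulrA [x ^+ d * _]mulrC !mulrA ler_wpM2r ?exprn_ge0 //.
have K1 : 0 < K + 1 by rewrite ltr_wpDl.
by move: xy; rewrite ler_pdivlMr // mulrAC ler_pdivrMr ?exprn_gt0.
Qed.

Lemma bounded_pos f : bounded f ->
  exists x K : R, [/\ 0 < x, 0 <= K & forall y, 0 <= y <= x -> forall n, nrm y n f <= K].
Proof.
move=> [x [K [x0 fK]]]; exists x, K; split=> //.
  by apply: le_trans (fK 0%N); rewrite nrm_ge0 // ltW.
by move=> y /andP[y0 yx] n; apply: le_trans (nrm_le _ _ y0 yx) _.
Qed.

Lemma boundedD f g : bounded f -> bounded g -> bounded (f + g).
Proof.
move=> /bounded_pos[x [K [x0 K0 fK]]] /bounded_pos[y [L [y0 L0 gL]]].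
exists (Num.min x y), (K + L); split=> [|n]; first by rewrite lt_min x0.
have m0 : 0 <= Num.min x y by rewrite le_min !ltW.
apply: le_trans (nrmD _ _ _ m0) _; apply: lerD.
  by apply: fK; rewrite m0 ge_min lexx.
by apply: gL; rewrite m0 ge_min lexx orbT.
Qed.
Lemma boundedN f : bounded f -> bounded (- f).
Proof. by move=> [x [K [x0 fK]]]; exists x, K; split=> // n; rewrite nrmN. Qed.
Lemma boundedB f g : bounded f -> bounded g -> bounded (f - g).
Proof. by move=> bf bg; apply: boundedD => //; apply: boundedN. Qed.
Lemma boundedM f g : bounded f -> bounded g -> bounded (f * g).
Proof.
move=> /bounded_pos[x [K [x0 K0 fK]]] /bounded_pos[y [L [y0 L0 gL]]].
exists (Num.min x y), (K * L); split=> [|n]; first by rewrite lt_min x0.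
have m0 : 0 <= Num.min x y by rewrite le_min !ltW.
apply: le_trans (nrmM _ _ _ m0) _; apply: ler_pM; rewrite ?nrm_ge0 //.
  by apply: fK; rewrite m0 ge_min lexx.
by apply: gL; rewrite m0 ge_min lexx orbT.
Qed.
Lemma bounded_conj f : bounded f -> bounded (conj f).
Proof. by move=> [x [K [x0 fK]]]; exists x, K; split=> // n; rewrite nrm_conj. Qed.
Lemma bounded_mono a b : bounded (mono a b).
Proof.
by exists 1, 1; split=> // n; have := @nrm_mono 1 n a b ler01; rewrite expr1n.
Qed.
Lemma bounded_cst c : bounded (serC c).
Proof.
exists 1, (cabs c); split=> // n; rewrite /nrm big_ord_recl big_ord_recl /=.
rewrite [X in _ + X + _]big1 ?addr0 => [|i _]; last by rewrite /serC /= cabs0 mul0r.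
rewrite [X in _ + X]big1 ?addr0 => [|i _]; last first.
  by rewrite big1 // => l _; rewrite /serC /= cabs0 mul0r.
by rewrite /serC /= expr0 mulr1.
Qed.

Lemma bounded_subst f u v : bounded f -> bounded u -> bounded v -> ord 1 u -> ord 1 v ->
  bounded (subst f u v).
Proof.
move=> [y [K [y0 fK]]] bu bv ou ov.
have [a a0 ua] := bounded_small bu (ou : ord 0.+1 u) y0.
have [b b0 vb] := bounded_small bv (ov : ord 0.+1 v) y0.
exists (Num.min a b), K; split=> [|n]; first by rewrite lt_min a0.
have m0 : 0 <= Num.min a b by rewrite le_min !ltW.
apply: (le_trans _ (fK (n + n)%N)); apply: nrm_subst => //.
  by have := ua (Num.min a b) _ n; rewrite expr0 mulr1; apply; rewrite m0 ge_min lexx.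
by have := vb (Num.min a b) _ n; rewrite expr0 mulr1; apply; rewrite m0 ge_min lexx orbT.
Qed.

Lemma bounded_comp f u : bounded f -> bounded u -> ord 1 u -> bounded (comp f u).
Proof.
by move=> bf bu ou; apply: bounded_subst => //; [apply: bounded_conj | apply: ord_conj].
Qed.

(** The same integer serves as constant and as ratio, so that convergence is a
    countable union of closed conditions on the coefficients. *)
Lemma bounded_geometric f : bounded f <->
  exists M : nat, forall j k, cabs (f j k) <= M%:R ^+ (j + k).+1.
Proof.
split=> [[x [K [x0 fK]]]|[M fM]].
  have K0 : 0 <= K by apply: le_trans (fK 0%N); rewrite nrm_ge0 // ltW.
  pose M := (Num.truncn (Num.max K x^-1)).+1.
  have MM : Num.max K x^-1 <= M%:R.
    by rewrite ltW // /M; apply: truncnS_gt.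
  exists M => j k; rewrite exprS.
  have := le_trans (nrm_coef f (ltW x0) (leq_maxl j k) (leq_maxr j k)) (fK _).
  rewrite -ler_pdivlMr ?exprn_gt0 // => /le_trans; apply.
  rewrite -exprVn; apply: ler_pM => //; first by rewrite exprn_ge0 // invr_ge0 ltW.
    by apply: le_trans MM; rewrite le_max lexx.
  rewrite lerXn2r // ?nnegrE ?invr_ge0 ?(ltW x0) //.
  by apply: le_trans MM; rewrite le_max lexx orbT.
pose x : R := (2 * (M%:R + 1))^-1.
have M1 : 0 < (M%:R + 1 : R) by rewrite ltr_wpDl.
have x0 : 0 < x by rewrite invr_gt0 mulr_gt0.
exists x, (M%:R * 4); split=> // n.
have half : \sum_(i < n.+1) 2^-1 ^+ i <= (2 : R).
  suff -> : \sum_(i < n.+1) 2^-1 ^+ i = 2 - 2^-1 ^+ n :> R by rewrite gerBl exprn_ge0 // invr_ge0.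
  elim: n => [|n IH]; first by rewrite big_ord_recl big_ord0 !expr0; lra.
  by rewrite big_ord_recr /= IH exprS; lra.
apply: (@le_trans _ _ (\sum_(j < n.+1) \sum_(k < n.+1) M%:R * (2^-1 ^+ j * 2^-1 ^+ k))).
  apply: ler_sum => j _; apply: ler_sum => k _.
  apply: le_trans (ler_wpM2r (exprn_ge0 _ (ltW x0)) (fM j k)) _.
  rewrite exprS -mulrA ler_wpM2l // -exprD -exprMn lerXn2r //.
  - by rewrite nnegrE mulr_ge0 // ltW.
  - by rewrite nnegrE invr_ge0.
  - by rewrite /x invfM mulrCA ler_piMr ?invr_ge0 // ler_pdivrMr // mul1r lerDl.
under eq_bigr do rewrite -mulr_sumr -mulr_sumr.
rewrite -mulr_sumr -mulr_suml ler_wpM2l // (_ : 4 = 2 * 2 :> R); last by lra.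
by apply: ler_pM => //; apply: sumr_ge0 => i _; rewrite exprn_ge0 // invr_ge0.
Qed.

(** All the iterates of the contraction that defines the inverse stay in the
    ball of radius 2x, so the inverse does. *)
Lemma bounded_inverse F G : multiplier 1 F -> multiplier 1 G -> bounded F ->
  comp F G = serZ -> bounded G.
Proof.
move=> mF mG bF FG.
have [H [mH FH HF cH]] := inverse_exists mF.
have [oF oG] := (multiplier_ord mF, multiplier_ord mG); have oH := multiplier_ord mH.
have -> : G = H.
  by rewrite -[G](id_comp oG) -HF (comp_assoc _ oF oG) FG comp_id.
have oFZ : ord 2 (F - serZ) by move/multiplierP: mF; rewrite rmorph1 mul1r.
have bFZ : bounded (F - serZ) by apply: boundedB => //; apply: bounded_mono.
have [x1 x1p Fx] := @bounded_small 1 _ (2^-1) bFZ oFZ ltac:(by rewrite invr_gt0).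
pose x := x1 / 2.
have x0 : 0 <= x by rewrite divr_ge0 // ltW.
have x2 : 0 <= 2 * x <= x1 by rewrite mulr_ge0 //= /x; lra.
have it m n : nrm x n (inverse_iter F m) <= 2 * x.
  have nZ : nrm x n serZ <= x by have := nrm_mono n 1 0 x0; rewrite expr1.
  elim: m => [|m IH] /=; first by apply: le_trans nZ _; lra.
  apply: le_trans (nrmD _ _ _ x0) _; rewrite nrmN.
  have oI := inverse_iter_ord m mF.
  have := nrm_subst (F - serZ) x0 oI (ord_conj oI) IH (_ : nrm x n (conj _) <= _).
  rewrite nrm_conj => /(_ IH) H1; have H2 := Fx _ x2 (n + n)%N.
  have : nrm x n (comp (F - serZ) (inverse_iter F m)) <= x.
    apply: le_trans H1 _; apply: le_trans H2 _; rewrite expr1; lra.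
  lra.
exists x, (2 * x); split=> [|n]; first by rewrite divr_gt0.
suff -> : nrm x n H = nrm x n (inverse_iter F (n + n).+1) by [].
apply: eq_bigr => j _; apply: eq_bigr => k _.
have /ord_subP -> // := cH (n + n).+1.
by have := ltn_ord j; have := ltn_ord k; lia.
Qed.

End Norms.

(** * The canonical integral *)

Section CanonicalIntegral.
Variable R : realType.
Local Notation C := R[i].
Implicit Types (F G h N I f g u v D : ser C) (l : C) (gam e : nat -> C).

Lemma subst_ZZ f j k : subst f serZ serZ j k =
  if k == 0%N then \sum_(i < j.+1) f i (j - i)%N else 0.
Proof.
rewrite subst_coef.
have E (a b : nat) : (serZ ^+ a * serZ ^+ b) j k = ((j == a + b)%N && (k == 0%N))%:R :> C.
  by rewrite -exprD -[serZ ^+ _]mulr1 -[1](expr0 serW) -monoE.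
under eq_bigr do under eq_bigr do rewrite E.
case: eqP => [->|_]; last first.
  by rewrite big1 // => a _; rewrite big1 // => b _; rewrite andbF mulr0.
rewrite addn0; apply: eq_bigr => a _.
have Hb : (j - a < j.+1)%N by lia.
rewrite (bigD1 (Ordinal Hb)) //= (subnKC (ltn_ord a : (a <= j)%N)) eqxx mulr1.
rewrite big1 ?addr0 // => b; rewrite -val_eqE /= => ba.
by case: eqP => [jab|_]; rewrite ?mulr0 //; case/eqP: ba; lia.
Qed.

Lemma one_var_ZZ e n : subst (one_var e) (serZ * serZ) 0 (n + n)%N 0%N = e n.
Proof.
have oZZ : ord 1 (serZ * serZ : ser C) by apply: ordMl; apply: ord1Z.
rewrite (@subst_coef_wide _ (n + n).+1) //; last by rewrite addn0.
have Hn : (n < (n + n).+1)%N by lia.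
rewrite (bigD1 (Ordinal Hn)) //= (bigD1 (ord0 : 'I_(n + n).+1)) //=.
have z (a b : nat) : b != 0%N -> one_var e a b = 0 by rewrite /one_var => /negPf ->.
have E (a : nat) : ((serZ * serZ) ^+ a * 0 ^+ 0) (n + n)%N 0%N = (n == a)%:R :> C.
  rewrite expr0 mulr1 -expr2 -exprM -[serZ ^+ _]mulr1 -[1](expr0 serW) -monoE /mono eqxx andbT.
  by congr (_%:R); lia.
rewrite big1 => [|b b0]; last by rewrite z ?[LHS]mul0r.
rewrite E eqxx mulr1 addr0 {1}/one_var /= big1 ?addr0 // => a an.
rewrite big1 // => b _; have [->|b0] := eqVneq (b : nat) 0%N; last by rewrite z ?[LHS]mul0r.
rewrite E; move: an; rewrite -val_eqE /= eq_sym => /negPf ->.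
by rewrite mulr0.
Qed.

Variable l : C.
Hypothesis l_unit : l * (l^*)%C = 1.
Hypothesis l_irr : forall n, (0 < n)%N -> l ^+ n != 1.

Definition canonical F : ser C := nf_map true l F * conj (nf_map true l F).
Definition radial_factor F : ser C := nf_form true l F * conj (nf_form true l F).

(** The sums of coefficients along antidiagonals vanish: in odd degree by the
    normalization, in even degree by oddness. *)
Lemma nf_map_axis F : multiplier l F -> odd_map F ->
  subst (nf_map true l F) serZ serZ = serZ /\
  subst (conj (nf_map true l F)) serZ serZ = serZ.
Proof.
move=> mF oF; set h := nf_map true l F.
have [mh mN] := nf_multipliers l true F.
have [/odd_mapP oh _] := odd_nf true mF oF.
have S j : \sum_(i < j.+1) h i (j - i)%N = (j == 1%N)%:R.
  have [oj|ej] := boolP (odd j); last first.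
    rewrite big1 => [|i _]; first by case: j ej => [|[|j]].
    by apply: oh; rewrite (subnKC (ltn_ord i : (i <= j)%N)).
  have [j1|j1] := ltnP 1 j.
    by rewrite nf_map_diagonal // gtn_eqF.
  have -> : j = 1%N by case: j oj j1 => [|[|j]].
  by case: mh => h00 h10 h01; rewrite /h !big_ord_recl big_ord0 /= /bump /= subn0 h01 h10 add0r addr0.
split; apply: serP => j k; rewrite subst_ZZ /serZ /mono; case: eqP => [_|_]; rewrite ?andbF ?andbT //.
rewrite (reindex_inj rev_ord_inj) /=.
transitivity ((\sum_(i < j.+1) h i (j - i)%N)^*)%C; last first.
  by rewrite S; apply: conjc_nat.
rewrite rmorph_sum; apply: eq_bigr => i _ /=; rewrite conjE subSS.
by rewrite (subKn (ltn_ord i : (i <= j)%N)).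
Qed.

Lemma canonical_ord F : multiplier l F -> ord 2 (canonical F).
Proof.
move=> mF; have [mh _] := nf_multipliers l true F; have oh := multiplier_ord mh.
by apply: (@ordM _ 1 1) => //; apply: ord_conj.
Qed.

Lemma canonical_conjugate F : multiplier l F ->
  comp (canonical F) F = comp (radial_factor F) (nf_map true l F).
Proof.
move=> mF; have [mh mN] := nf_multipliers l true F.
have [oh oF] := (multiplier_ord mh, multiplier_ord mF).
have E := nf_conjugacy l_unit l_irr true mF.
by rewrite /canonical (compM _ _ oF) -conj_comp E conj_comp -(compM _ _ oh).
Qed.

Lemma radial_factorE F : multiplier l F ->
  exists2 gam, tangent gam & radial_factor F = diagonal gam.
Proof.
move=> mF; have [mh mN] := nf_multipliers l true F.
by apply: (resonant_norm_diagonal l_unit mN); apply: nf_form_resonant.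
Qed.

Lemma canonical_is_integral F gam : multiplier l F -> tangent gam ->
  radial_factor F = diagonal gam -> is_integral F (canonical F) gam.
Proof.
move=> mF tg E; have [mh mN] := nf_multipliers l true F.
by apply: (canonical_integral mF mh mN); rewrite ?nf_conjugacy.
Qed.

Lemma canonical_unique F I gam : multiplier l F -> is_integral F I gam ->
  exists2 e, tangent e & I = comp (one_var e) (canonical F).
Proof.
move=> mF iI; have [mh mN] := nf_multipliers l true F.
exact: (integral_unique l_unit l_irr mF mh mN (@nf_form_resonant _ _ _ _)
  (nf_conjugacy l_unit l_irr true mF) iI).
Qed.

Lemma comp_one_var_inj e I : tangent e -> ord 1 I ->
  exists G, [/\ multiplier 1 G, comp (one_var e) G = serZ
     & I = comp G (comp (one_var e) I)].
Proof.
move=> te oI; have me := one_var_multiplier te.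
have [G [mG eG Ge _]] := inverse_exists me.
exists G; split=> //.
by rewrite -(comp_assoc G (multiplier_ord me) oI) Ge id_comp.
Qed.

(** Since the canonical integral restricts to z^2 on the line w = z, the
    function relating another integral to it is read off that line. *)
Lemma canonical_axis F I gam : multiplier l F -> odd_map F -> is_integral F I gam ->
  exists e, [/\ tangent e, I = comp (one_var e) (canonical F) &
    forall n, subst I serZ serZ (n + n)%N 0%N = e n].
Proof.
move=> mF oF iI.
have [e te Ie] := canonical_unique mF iI; exists e; split=> // n.
have oc : ord 1 (canonical F) by apply: ord_le (canonical_ord mF).
have [hz hz'] := nf_map_axis mF oF.
have [mh _] := nf_multipliers l true F; have oh := multiplier_ord mh.
have oZ : ord 1 (serZ : ser C) by apply: ord1Z.
have cz : subst (canonical F) serZ serZ = serZ * serZ.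
  by rewrite substM // hz hz'.
suff -> : subst I serZ serZ = subst (one_var e) (serZ * serZ) 0 by exact: one_var_ZZ.
rewrite Ie compE subst_assoc //; last exact: ord_conj.
rewrite cz; apply: subst_one_var; first by apply: ordMl.
  by apply: ord_subst => //; apply: ord_conj.
by [].
Qed.

(** Both the function e and its inverse converge, as e is the restriction of I to
    a line. *)
Lemma canonical_bounded F I gam : multiplier l F -> odd_map F ->
  is_integral F I gam -> bounded I -> bounded (canonical F).
Proof.
move=> mF oF iI bI; have oI2 := is_integral_ord iI.
have [e [te Ie Iz]] := canonical_axis mF oF iI.
have oc : ord 1 (canonical F) by apply: ord_le (canonical_ord mF).
have be : bounded (one_var e).
  have /bounded_geometric [M HM] : bounded (subst I serZ serZ).
    have oZ : ord 1 (serZ : ser C) by apply: ord1Z.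
    by apply: bounded_subst => //; apply: bounded_mono.
  apply/bounded_geometric; exists (M * M)%N => j k.
  rewrite /one_var; case: eqP => [->|_]; last by rewrite cabs0 exprn_ge0.
  have := HM (j + j)%N 0%N; rewrite Iz => /le_trans; apply.
  rewrite -natrX -natrX ler_nat addn0 expnMn -expnD.
  by case: M {HM} => [|M]; [rewrite exp0n | apply: leq_pexp2l => //; lia].
have [G [mG eG Ic]] := comp_one_var_inj te oc.
rewrite Ic -Ie; apply: bounded_comp => //; last by apply: ord_le oI2.
by apply: (bounded_inverse (one_var_multiplier te) mG be eG).
Qed.

(** z w is an integral that equals z^2 on the line w = z, which characterizes the
    canonical one. *)
Lemma canonical_conservative F : multiplier l F -> odd_map F ->
  F * conj F = serZ * serW ->
  canonical F = serZ * serW /\ radial_factor F = serZ * serW.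
Proof.
move=> mF oF FF; have oF1 := multiplier_ord mF.
pose e1 n : C := (n == 1%N)%:R.
have d1 : one_var e1 = serZ.
  by apply: serP => i j; rewrite /one_var /serZ /mono /e1; case: (j == 0%N); rewrite ?andbF ?andbT.
have oZW : ord 1 (serZ * serW : ser C) by apply: ord_le (@ord2_ZW _).
have ZWF : comp (serZ * serW) F = serZ * serW.
  by rewrite (compM _ _ oF1) -conjZ -conj_comp (id_comp oF1) FF conjZ.
have iZ : is_integral F (serZ * serW) e1.
  split; first by rewrite subrr; exact: ord_zero.
    by split; rewrite /e1.
  by rewrite ZWF d1 (id_comp oZW).
have [e [te Ie ez]] := canonical_axis mF oF iZ.
have oc : ord 1 (canonical F) by apply: ord_le (canonical_ord mF).
have cE : canonical F = serZ * serW.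
  rewrite Ie -[LHS](id_comp oc); congr comp; rewrite -d1; congr one_var.
  apply/funext => n; rewrite -ez; have oZ : ord 1 (serZ : ser C) by apply: ord1Z.
  rewrite (substM _ _ oZ oZ) (substZ oZ oZ) (substW oZ oZ) -expr2.
  rewrite -[serZ ^+ 2]mulr1 -[1]/(serW ^+ 0) -monoE /mono /e1 andbT.
  by rewrite (_ : (n + n == 2)%N = (n == 1%N)) //; lia.
split=> //; have [gam tg rE] := radial_factorE mF.
have [_ _] := canonical_is_integral mF tg rE.
by rewrite cE ZWF rE diagonalE.
Qed.

(** |Phi(F)|^2 = |G(Phi)|^2 = Gam(|Phi|^2). *)
Lemma normalization_integral F Phi Gam : multiplier l F ->
  geometric_normalization F Phi Gam ->
  is_integral F ((Phi : ser C) * conj Phi) (fun n => (Gam n)%:C)%C.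
Proof.
move=> mF [mP [g0 g1] [Psi [mPsi PP' P'P]]] /= GG.
have [[oF oP] oP'] := (multiplier_ord mF, multiplier_ord mP, multiplier_ord mPsi).
pose G := comp (comp Phi F) Psi.
have GPhi : comp G Phi = comp Phi F.
  rewrite /G (comp_assoc _ oP' oP) (_ : comp Psi Phi = serZ) ?comp_id //.
  by rewrite -fps_idE -P'P.
have GGE : G * conj G = diagonal (fun n => (Gam n)%:C)%C by exact: GG.
split; first exact: norm_lead.
  by split; rewrite ?g0 ?g1.
have oZW : ord 1 (serZ * serW : ser C) by apply: ord_le (@ord2_ZW _).
rewrite (compM _ _ oF) -conj_comp -GPhi conj_comp -(compM _ _ oP) GGE diagonalE.
rewrite (comp_assoc _ oZW oP); congr comp.
by rewrite (compM _ _ oP) (id_comp oP) -conjZ -conj_comp (id_comp oP).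
Qed.

Lemma convergent_bounded F : convergent F -> bounded F.
Proof.
move=> [r1 [r2 [r1p r2p]]]; rewrite /abs_convergent_at.
set a := (fun p : nat * nat => _); set S := esum _ _ => Sfin.
have a0 p : (0 <= a p)%E.
  by rewrite lee_fin !mulr_ge0 ?cabs_ge0 ?exprn_ge0 // ltW.
have S0 : (0 <= S)%E by apply: esum_ge0 => p _; apply: a0.
pose K := fine S.
have SK : S = K%:E by rewrite /K fineK // ge0_fin_numE.
have K0 : 0 <= K by rewrite -lee_fin -SK.
have term j k : cabs (F j k) * r1 ^+ j * r2 ^+ k <= K.
  rewrite -lee_fin -SK; apply: esum_ge; exists [set (j, k)].
    by split.
  by rewrite fsbig_set1.
pose r := Num.min r1 r2; have rp : 0 < r by rewrite lt_min r1p.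
have term' j k : cabs (F j k) <= K * r^-1 ^+ (j + k).
  rewrite exprVn ler_pdivlMr ?exprn_gt0 //; apply: le_trans (term j k).
  rewrite -mulrA ler_wpM2l ?cabs_ge0 // exprD; apply: ler_pM.
  - by rewrite exprn_ge0 // ltW.
  - by rewrite exprn_ge0 // ltW.
  - by rewrite lerXn2r ?nnegrE ?(ltW rp) ?(ltW r1p) // /r ge_min lexx.
  - by rewrite lerXn2r ?nnegrE ?(ltW rp) ?(ltW r2p) // /r ge_min lexx orbT.
apply/bounded_geometric; pose M := (Num.truncn (Num.max K r^-1)).+1.
have MM : Num.max K r^-1 <= M%:R by rewrite ltW // /M; apply: truncnS_gt.
exists M => j k; apply: le_trans (term' j k) _; rewrite exprS; apply: ler_pM => //.
- by rewrite exprn_ge0 // invr_ge0 ltW.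
- by apply: le_trans MM; rewrite le_max lexx.
- rewrite lerXn2r // ?nnegrE ?invr_ge0 ?(ltW rp) //.
  by apply: le_trans MM; rewrite le_max lexx orbT.
Qed.

(** Divergence of the canonical integral is an obstruction to the convergence
    of every geometric normalization at once. *)
Lemma canonical_obstruction F : multiplier l F -> odd_map F ->
  ~ bounded (canonical F) -> all_normalizations_divergent F.
Proof.
move=> mF oF nb Phi Gam gn /convergent_bounded bP; apply: nb.
apply: (canonical_bounded mF oF (normalization_integral mF gn)).
by apply: boundedM => //; apply: bounded_conj.
Qed.

(** If some normalization preserves |z|^2 then its integral is invariant under F,
    hence so is the canonical one, which is a function of it. In the other
    direction h is itself a geometric normalization. *)
Lemma formally_conservativeP F : multiplier l F ->
  formally_conservative F <-> radial_factor F = serZ * serW.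
Proof.
move=> mF; have [mh mN] := nf_multipliers l true F.
have [[oh oN] oF] := (multiplier_ord mh, multiplier_ord mN, multiplier_ord mF).
have [k [mk hk kh _]] := inverse_exists mh; have ok := multiplier_ord mk.
have oZW : ord 1 (serZ * serW : ser C) by apply: ord_le (@ord2_ZW _).
have hF := nf_conjugacy l_unit l_irr true mF.
have d1 : one_var (fun n => (((n == 1%N)%:R : R)%:C)%C) = serZ.
  apply: serP => i j; rewrite /one_var /serZ /mono.
  by case: eqP => _; rewrite ?andbF ?andbT //= rmorph_nat.
split=> [[Phi gn]|rZW].
  have iI := normalization_integral mF gn; have oI2 := is_integral_ord iI.
  have oI : ord 1 ((Phi : ser C) * conj Phi) by apply: ord_le oI2.
  have [e te Ie] := canonical_unique mF iI.
  have oc : ord 1 (canonical F) by apply: ord_le (canonical_ord mF).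
  have [G [_ _ Ic]] := comp_one_var_inj te oc.
  case: iI => _ _; rewrite d1 (id_comp oI) => IF.
  have cF : comp (canonical F) F = canonical F.
    by rewrite {1}Ic -Ie (comp_assoc _ oI oF) IF Ie -Ic.
  move: cF; rewrite (canonical_conjugate mF) => /(congr1 (fun f => comp f k)).
  rewrite (comp_assoc _ oh ok) hk comp_id => ->.
  rewrite /canonical (compM _ _ ok) hk -conj_comp hk conjZ //.
exists (nf_map true l F); split=> //.
exists k; split=> //.
- by rewrite fps_idE; exact: hk.
- by rewrite fps_idE; exact: kh.
have -> : fps_comp (fps_comp (nf_map true l F) F) k = nf_form true l F.
  transitivity (comp (comp (nf_map true l F) F) k); first by [].
  by rewrite hF (comp_assoc _ oh ok) hk comp_id.
rewrite /=; transitivity (serZ * serW : ser C); first exact: rZW.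
rewrite /serZ /serW mono_mono; apply: serP => i j; rewrite /mono /radial.
by case: eqP => [->|ij]; case: eqP => [->|jj] //=; rewrite ?rmorph1 ?rmorph0 //; case: eqP => // ?; lia.
Qed.

End CanonicalIntegral.

(** * Extrapolation of geometric bounds along polynomial families *)

Section Lagrange.
Variable K : fieldType.

Lemma lagrange_eval N (t : 'I_N.+1 -> K) (p : {poly K}) x : injective t ->
  (size p <= N.+1)%N ->
  p.[x] = \sum_i p.[t i] * \prod_(j | j != i) ((x - t j) / (t i - t j)).
Proof.
move=> tI sp.
pose b i : {poly K} := (\prod_(j | j != i) (t i - t j)^-1) *: \prod_(j | j != i) ('X - (t j)%:P).
have bE i y : (b i).[y] = \prod_(j | j != i) ((y - t j) / (t i - t j)).
  rewrite /b hornerZ horner_prod -big_split /=; apply: eq_bigr => j _.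
  by rewrite hornerXsubC mulrC.
pose q := \sum_i p.[t i] *: b i.
suff E : p = q.
  rewrite [in LHS]E /q horner_sum; apply: eq_bigr => i _.
  by rewrite hornerZ bE.
apply/eqP; rewrite -subr_eq0; apply/negPn/negP => pq.
have sb i : (size (b i) <= N.+1)%N.
  apply: leq_trans (size_scale_leq _ _) _.
  rewrite -big_filter size_prod_XsubC -cardE.
  by rewrite (eq_card (B := predC1 i)) // cardC1 card_ord.
have sq : (size q <= N.+1)%N.
  apply: leq_trans (size_sum _ _ _) _; apply/bigmax_leqP => i _.
  by apply: leq_trans (size_scale_leq _ _) (sb i).
have rts : all (root (p - q)) [seq t i | i : 'I_N.+1].
  apply/allP => _ /mapP[i _ ->]; rewrite rootE hornerD hornerN /q horner_sum.
  rewrite (bigD1 i) //= hornerZ bE [X in _ * X]big1 => [|j ji]; last first.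
    by rewrite divff // subr_eq0 (inj_eq tI) eq_sym.
  rewrite mulr1 big1 ?addr0 ?subrr // => j ji.
  by rewrite hornerZ bE (bigD1 i) 1?eq_sym //= subrr mul0r mul0r mulr0.
have := max_poly_roots pq rts _; rewrite map_inj_uniq // enum_uniq => /(_ isT).
rewrite size_map size_enum_ord ltnNge; case/negP.
by apply: leq_trans (size_polyD _ _) _; rewrite size_polyN geq_max sp.
Qed.

End Lagrange.

Section Extrapolation.
Variable R : realType.
Local Notation C := R[i].

(** A weak form of Stirling's bound, from N^N <= (2N)! / N! = C(2N, N) N!. *)
Lemma expn_le_fact N : (N ^ N <= 4 ^ N * N`!)%N.
Proof.
have H m : (N ^ m <= (N + m) ^_ m)%N.
  elim: m => [|m IH] //; rewrite addnS ffactSS expnS leq_mul //; lia.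
apply: leq_trans (H N) _; rewrite -bin_ffact leq_mul2r; apply/orP; right.
have -> : (4 ^ N = 2 ^ (N + N))%N by rewrite addnn -mul2n expnM.
have -> : (2 ^ (N + N) = \sum_(i < (N + N).+1) 'C(N + N, i))%N.
  rewrite (_ : 2 = 1 + 1)%N // expnDn; apply: eq_bigr => i _.
  by rewrite !exp1n !muln1.
have HN : (N < (N + N).+1)%N by lia.
by rewrite (bigD1 (Ordinal HN)) //= leq_addr.
Qed.

(** The product of the distances from i to the other nodes is i! (N - i)!. *)
Lemma prod_dist N (i : nat) : (i <= N)%N ->
  (N`! <= 2 ^ N * \prod_(j < N.+1 | j != i :> nat) (if j < i then i - j else j - i))%N.
Proof.
move=> iN.
suff -> : (\prod_(j < N.+1 | j != i :> nat) (if j < i then i - j else j - i) = i`! * (N - i)`!)%N.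
  rewrite -(bin_fact iN) leq_mul2r; apply/orP; right.
  have -> : (2 ^ N = \sum_(i < N.+1) 'C(N, i))%N.
    rewrite (_ : 2 = 1 + 1)%N // expnDn; apply: eq_bigr => j _.
    by rewrite !exp1n !muln1.
  by rewrite (bigD1 (Ordinal (iN : i < N.+1)%N)) //= leq_addr.
rewrite -(subnKC iN); move: (N - i)%N => m; rewrite addKn {N iN}.
elim: m => [|m IH].
  rewrite addn0 fact0 muln1 big_mkcond big_ord_recr /= eqxx /= muln1 -big_mkcond /=.
  elim: i => [|i IH]; first by rewrite big_ord0.
  rewrite big_mkcond big_ord_recl /= factS subn0 -IH; congr muln.
  rewrite [RHS]big_mkcond; apply: eq_bigr => j _ /=.
  by rewrite /bump /= add1n eqSS ltnS subSS.
rewrite addnS big_mkcond big_ord_recr /= -big_mkcond IH factS.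
by rewrite ifT ?ifF; lia.
Qed.

(** Values at equally spaced nodes control a polynomial of degree N everywhere,
    up to a constant to the power N. *)
Lemma equispaced_bound (p : {poly C}) (a dl x B : R) (N : nat) :
  (0 < N)%N -> (size p <= N.+1)%N -> 0 < dl ->
  (forall y, a <= y <= a + dl -> cabs p.[(y%:C)%C] <= B) ->
  cabs p.[(x%:C)%C] <= B * (16 * ((`|x - a| + dl) / dl)) ^+ N.
Proof.
move=> N0 sp dl0 pB.
have N0' : 0 < (N%:R : R) by rewrite ltr0n.
pose t (i : 'I_N.+1) : R := a + i%:R * (dl / N%:R).
have h0 : 0 < dl / N%:R by rewrite divr_gt0.
have tI : injective (fun i => ((t i)%:C)%C : C).
  move=> i j /complexI /addrI /(mulIf (lt0r_neq0 h0)) /eqP.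
  by rewrite eqr_nat => /eqP/val_inj.
have B0 : 0 <= B by apply: le_trans (cabs_ge0 _) (pB a _); rewrite lexx lerDl ltW.
have tb i : a <= t i <= a + dl.
  rewrite /t lerDl mulr_ge0 ?(ltW h0) //= lerD2l mulrCA ler_piMr ?(ltW dl0) //.
  by rewrite ler_pdivrMr // mul1r ler_nat -ltnS.
pose L := `|x - a| + dl.
have L0 : 0 < L by rewrite ltr_wpDl.
have xt i : `|x - t i| <= L.
  have /andP[t1 t2] := tb i.
  rewrite (_ : x - t i = (x - a) + (a - t i)); last by ring.
  apply: le_trans (ler_normD _ _) _; rewrite lerD2l ler_norml; lra.
rewrite (lagrange_eval _ tI sp).
apply: le_trans (cabs_sum _ _ _) _.
have term (i : 'I_N.+1) : cabs (p.[((t i)%:C)%C]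
    * \prod_(j | j != i) (((x%:C)%C - ((t j)%:C)%C) / (((t i)%:C)%C - ((t j)%:C)%C)))
   <= B * ((8 * (L / dl)) ^+ N).
  rewrite cabsM; apply: ler_pM; rewrite ?cabs_ge0 //; first by apply: pB.
  rewrite cabs_prod.
  have E (j : 'I_N.+1) : j != i ->
     cabs (((x%:C)%C - ((t j)%:C)%C) / (((t i)%:C)%C - ((t j)%:C)%C))
     <= (L * (N%:R / dl)) * ((if j < i then i - j else j - i)%N%:R)^-1.
    move=> ji; rewrite cabsM cabsV -!rmorphB /= !cabs_real -mulrA.
    apply: ler_pM; rewrite ?normr_ge0 ?invr_ge0 //.
    rewrite /t opprD addrACA subrr add0r -mulrBl normrM (gtr0_norm h0) invfM.
    rewrite invf_div mulrC ler_wpM2l //; first by rewrite divr_ge0 // ltW.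
    case: ltnP => ij; first by rewrite natrB 1?ltnW // ger0_norm ?subr_ge0 ?ler_nat // ltnW.
    by rewrite natrB // distrC ger0_norm ?subr_ge0 ?ler_nat.
  apply: (@le_trans _ _ (\prod_(j < N.+1 | j != i)
      ((L * (N%:R / dl)) * ((if j < i then i - j else j - i)%N%:R)^-1))).
    by apply: ler_prod => j ji; rewrite cabs_ge0 E.
  rewrite big_split /= prodr_const (eq_card (B := predC1 i)) // cardC1 card_ord /=.
  rewrite prodfV -natr_prod.
  set P := (X in X%:R^-1).
  have NP : (N`! <= 2 ^ N * P)%N.
    apply: leq_trans (prod_dist (ltn_ord i : (i <= N)%N)) _.
    by rewrite leq_mul2l; apply/orP; right; rewrite (eq_bigl (fun j => j != i)).
  have P0 : (0 < P)%N by have := fact_gt0 N; case: (P) NP => //; rewrite muln0; lia.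
  rewrite ler_pdivrMr ?ltr0n // [X in _ <= X](_ : _ = (L / dl) ^+ N * (8 ^+ N * P%:R)); last first.
    by rewrite [in LHS]exprMn; ring.
  rewrite exprMn (_ : L ^+ N * _ ^+ N = (L / dl) ^+ N * N%:R ^+ N); last first.
    by rewrite !expr_div_n; field; rewrite expf_neq0 // gt_eqF.
  rewrite ler_wpM2l ?exprn_ge0 ?divr_ge0 ?(ltW L0) ?(ltW dl0) //.
  rewrite -!natrX -natrM ler_nat; apply: leq_trans (expn_le_fact N) _.
  apply: leq_trans (leq_mul (leqnn _) NP) _.
  by rewrite mulnA -expnMn.
apply: le_trans (ler_sum _ (fun i _ => term i)) _.
rewrite sumr_const card_ord.
rewrite (_ : _ *+ N.+1 = B * (N.+1%:R * (8 * (L / dl)) ^+ N)); last by rewrite -[LHS]mulr_natl mulrCA.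
rewrite ler_wpM2l //.
rewrite (_ : 16 * (L / dl) = 2 * (8 * (L / dl))); last by ring.
rewrite [X in _ <= X]exprMn ler_wpM2r //.
  by rewrite exprn_ge0 // mulr_ge0 // divr_ge0 // ltW.
by rewrite -natrX ler_nat ltn_expl.
Qed.

Definition repoly (q : {poly C}) : {poly R} := \poly_(i < size q) complex.Re q`_i.
Definition impoly (q : {poly C}) : {poly R} := \poly_(i < size q) complex.Im q`_i.

Lemma horner_re_im (q : {poly C}) (x : R) : q.[(x%:C)%C] = ((repoly q).[x] +i* (impoly q).[x])%C.
Proof.
have re (r : R) (z : C) : complex.Re (z * (r%:C)%C) = complex.Re z * r.
  by case: z => u v /=; rewrite mulr0 subr0.
have im (r : R) (z : C) : complex.Im (z * (r%:C)%C) = complex.Im z * r.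
  by case: z => u v /=; rewrite mulr0 add0r.
have sre n (f : 'I_n -> C) : complex.Re (\sum_i f i) = \sum_i complex.Re (f i).
  have m : {morph (@complex.Re R) : u v / u + v >-> u + v} by case=> ? ? [? ?].
  exact: (big_morph _ m erefl).
have sim n (f : 'I_n -> C) : complex.Im (\sum_i f i) = \sum_i complex.Im (f i).
  have m : {morph (@complex.Im R) : u v / u + v >-> u + v} by case=> ? ? [? ?].
  exact: (big_morph _ m erefl).
rewrite !horner_poly horner_coef; apply/eqP; rewrite eq_complex /= sre sim.
by apply/andP; split; apply/eqP; apply: eq_bigr => i _; rewrite -rmorphXn ?re ?im.
Qed.

Definition sqmod (p : {poly C}) : {poly R} := repoly p ^+ 2 + impoly p ^+ 2.

Lemma sqmodE p (x : R) : (sqmod p).[x] = cabs p.[(x%:C)%C] ^+ 2.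
Proof.
rewrite /sqmod hornerD !horner_exp horner_re_im /cabs normc_def /=.
by rewrite sqr_sqrtr // addr_ge0 // sqr_ge0.
Qed.

(** If the coefficients of a family of series are polynomials in a real
    parameter, of degree at most proportional to their own degree, and if the
    family converges at every parameter of some interval, then it converges at
    every parameter. By Baire's theorem the bounds are uniform on a smaller
    interval, from which polynomials are extrapolated. *)
Lemma extrapolation (T : Type) (c : T -> {poly C}) (wt : T -> nat) (d : nat) (a b : R) :
  (forall t, (size (c t) <= d * wt t + 1)%N) -> a < b ->
  (forall x, a <= x <= b -> exists M : nat, forall t,
     cabs (c t).[(x%:C)%C] <= M%:R ^+ (wt t).+1) ->
  forall x, exists M : nat, forall t, cabs (c t).[(x%:C)%C] <= M%:R ^+ (wt t).+1.
Proof.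
move=> sc ab H x.
pose U (M : nat) : set R := [set y | y < a] `|` [set y | b < y] `|`
   \bigcup_(t in [set: T]) [set y | (M%:R ^+ (wt t).+1) ^+ 2 < (sqmod (c t)).[y]].
have oU M : open (U M).
  apply: openU; first by apply: openU; [exact: open_lt | exact: open_gt].
  apply: bigcup_open => t _.
  apply: (@open_comp _ _ (fun y => (sqmod (c t)).[y]) [set z | _ < z]); last exact: open_gt.
  by move=> y _; exact: continuous_horner.
have [dU|] := pselect (forall M, dense (U M)).
  have odU M : open (U M) /\ dense (U M) by split.
  have /(_ `]a, b[%classic) := @Baire R R U odU.
  case=> [||y [/=]].
  - by exists ((a + b) / 2); rewrite /= in_itv /=; lra.
  - exact: interval_open.
  rewrite in_itv /= => /andP[ay yb] Uy.
  have [|M HM] := H y; first by rewrite !ltW.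
  have [[|]|[t _] /=] := Uy M I; rewrite /=; [lra|lra|].
  rewrite sqmodE ltNge => /negP; case.
  by rewrite lerXn2r // nnegrE ?cabs_ge0 ?exprn_ge0.
move=> /existsNP[M nd]; have [V [[x0 [oV Vx0]] VU]] := denseNE nd.
have /nbhs_ballP[r /= r0 rV] : nbhs x0 V by apply: open_nbhs_nbhs.
have inK y : ball x0 r y -> forall t, cabs (c t).[(y%:C)%C] <= M%:R ^+ (wt t).+1.
  move=> By t; rewrite leNgt; apply/negP => ct.
  have : (V `&` U M) y.
    split; first exact: rV.
    by right; exists t => //=; rewrite sqmodE ltrXn2r.
  by rewrite VU.
pose dl := r / 2; have dl0 : 0 < dl by rewrite divr_gt0.
have inK' y : x0 <= y <= x0 + dl -> forall t, cabs (c t).[(y%:C)%C] <= M%:R ^+ (wt t).+1.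
  move=> xy; apply: inK; rewrite /ball /= ltr_norml; move: xy; rewrite /dl; move: r0; lra.
pose A := 16 * ((`|x - x0| + dl) / dl).
have A1 : 1 <= A.
  rewrite /A; have : 1 <= (`|x - x0| + dl) / dl.
    by rewrite ler_pdivlMr // mul1r lerDr.
  lra.
pose B := (Num.truncn (A ^+ d.+1)).+1.
have AB : A ^+ d.+1 <= B%:R by rewrite ltW // /B; apply: truncnS_gt.
exists (M * B)%N => t.
have := @equispaced_bound (c t) x0 dl x (M%:R ^+ (wt t).+1) (d * wt t).+1 isT _ dl0 _.
move=> /(_ _ _)/le_trans; apply.
- by apply: leq_trans (sc t) _; lia.
- by move=> y xy; apply: inK'.
rewrite natrM [X in _ <= X]exprMn ler_wpM2l ?exprn_ge0 // -/A.
apply: (@le_trans _ _ ((A ^+ d.+1) ^+ (wt t).+1)).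
  by rewrite -exprM; apply: ler_weXn2l => //; lia.
by rewrite lerXn2r // nnegrE ?exprn_ge0 // (le_trans ler01 A1).
Qed.

End Extrapolation.

(** * The rotation and its powers *)

Section Rotation.
Variable R : realType.
Local Notation C := R[i].
Implicit Types (x y : R) (n : nat).

Lemma lambdaD x y : lambda (x + y) = lambda x * lambda y.
Proof.
rewrite /lambda mulrDr cosD sinD; apply/eqP; rewrite eq_complex /=.
by apply/andP; split; apply/eqP; ring.
Qed.
Lemma lambda0 : lambda (0 : R) = 1.
Proof. by rewrite /lambda mulr0 cos0 sin0. Qed.
Lemma lambda1 : lambda (1 : R) = 1.
Proof. by rewrite /lambda mulr1 mulr_natl cos2pi sin2pi. Qed.
Lemma lambdaX x n : lambda x ^+ n = lambda (n%:R * x).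
Proof.
elim: n => [|n IH]; first by rewrite mul0r lambda0.
by rewrite exprS IH -lambdaD -[n.+1%:R]natr1 mulrDl mul1r addrC.
Qed.
Lemma lambda_nat n : lambda (n%:R : R) = 1.
Proof. by rewrite -[n%:R]mulr1 -lambdaX lambda1 expr1n. Qed.
Lemma lambda_conj x : ((lambda x)^*)%C = lambda (- x).
Proof. by rewrite /lambda mulrN cosN sinN. Qed.
Lemma lambda_unit x : lambda x * ((lambda x)^*)%C = 1.
Proof. by rewrite lambda_conj -lambdaD subrr lambda0. Qed.
Lemma lambda_int (m : int) : lambda (m%:~R : R) = 1.
Proof.
case: m => n; first exact: lambda_nat.
by rewrite NegzE mulrNz -lambda_conj [lambda _]lambda_nat conjc1.
Qed.
Lemma cabs_lambda x : cabs (lambda x) = 1.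
Proof. by rewrite /cabs normc_def /= cos2Dsin2 sqrtr1. Qed.

Lemma lambda_eq1 x : lambda x = 1 -> exists m : int, x = m%:~R.
Proof.
move=> l1; exists (Num.floor x); apply/eqP; rewrite -subr_eq0.
set f := x - _; have f1 : lambda f = 1.
  by rewrite /f lambdaD l1 -mulrNz lambda_int mul1r.
have f01 : 0 <= f < 1.
  by rewrite /f subr_ge0 ge_floor ltrBlDl -[1]/(1%:~R) -intrD floorD1_gt.
apply/negPn/negP => f0.
have fp : 0 < f by rewrite lt_def f0; case/andP: f01.
have s0 : 0 < sin (pi * f).
  apply: sin_gt0_pi; rewrite mulr_gt0 ?pi_gt0 //=.
  by rewrite gtr_pMr ?pi_gt0 //; case/andP: f01.
move: f1 => /(congr1 (@complex.Re R)) /=.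
rewrite (_ : 2 * pi * f = (pi * f) *+ 2); last by rewrite mulr2n; ring.
rewrite cos_mulr2n => E; have := cos2Dsin2 (pi * f).
have : 0 < sin (pi * f) ^+ 2 by rewrite exprn_gt0.
move: E; rewrite -mulr_natl; lra.
Qed.

Lemma lambda_irrational x n : irrational x -> (0 < n)%N -> lambda x ^+ n != 1.
Proof.
move=> ix n0; apply/negP; rewrite lambdaX => /eqP/lambda_eq1[m xm]; apply: ix.
apply/rationalP; exists m, n; rewrite -xm mulrC mulKf // pnatr_eq0; lia.
Qed.

(** Orthogonality of the characters of Z/Q. *)
Lemma lambda_root_sum (Q m : nat) : (0 < Q)%N ->
  \sum_(s < Q) lambda (s%:R / Q%:R * m%:R : R) = if (Q %| m)%N then Q%:R else 0.
Proof.
move=> Q0; have Q0' : (Q%:R : R) != 0 by rewrite pnatr_eq0; lia.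
have E s : lambda (s%:R / Q%:R * m%:R) = lambda (m%:R / Q%:R : R) ^+ s.
  by rewrite lambdaX; congr lambda; rewrite mulrAC mulrA.
under eq_bigr do rewrite E.
case: ifP => [/dvdnP[k ->]|nd].
  rewrite (eq_bigr (fun=> 1)) => [|s _]; last by rewrite natrM mulfK // lambda_nat expr1n.
  by rewrite sumr_const card_ord.
have /eqP : (lambda (m%:R / Q%:R : R) - 1) * \sum_(s < Q) lambda (m%:R / Q%:R) ^+ s = 0.
  by rewrite -subrX1 lambdaX mulrCA divff // mulr1 lambda_nat subrr.
rewrite mulf_eq0 => /orP[|/eqP //]; rewrite subr_eq0 => /eqP /lambda_eq1[k mk].
move: nd; case/negP; apply/dvdnP.
have mkQ : (m%:R : R) = (k * Q%:Z)%:~R.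
  by rewrite intrM -mk divfK.
have : m%:Z = k * Q%:Z by apply: (intr_inj (R := R)); rewrite -mkQ.
by case: k {mk mkQ} => k mk; [exists k; lia | exists 0%N; nia].
Qed.

End Rotation.

(** * Values of convergent series *)

Section Values.
Variable R : realType.
Local Notation C := R[i].
Implicit Types (F G H : ser C) (z w : C) (r th B a : R).

Lemma geometric_sum_le th n m : 0 <= th < 1 ->
  \sum_(j < m) (if (n <= j)%N then th ^+ j else 0) <= th ^+ n / (1 - th).
Proof.
move=> /andP[t0 t1]; have t1' : 0 < 1 - th by rewrite subr_gt0.
rewrite ler_pdivlMr //; have [mn|nm] := leqP m n.
  rewrite big1 ?mul0r ?exprn_ge0 // => j _.
  by rewrite leqNgt (leq_trans (ltn_ord j) mn).
rewrite -(subnKC (ltnW nm)); elim: (m - n)%N => [|d IH].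
  rewrite addn0 big1 ?mul0r ?exprn_ge0 // => j _.
  by rewrite leqNgt ltn_ord.
rewrite addnS big_ord_recr /= leq_addr mulrDl.
suff -> : (\sum_(i < n + d) if (n <= i)%N then th ^+ i else 0) * (1 - th) = th ^+ n - th ^+ (n + d).
  by rewrite mulrBr mulr1 -exprSr; have := exprn_ge0 (n + d).+1 t0; lra.
elim: d {IH} => [|d IH].
  rewrite addn0 subrr big1 ?mul0r // => j _.
  by rewrite leqNgt ltn_ord.
by rewrite addnS big_ord_recr /= leq_addr mulrDl IH mulrBr mulr1 -exprSr; ring.
Qed.

(** Explicit rate of convergence, used to compare values of series with their
    partial sums; the limit is built separately on real and imaginary parts. *)
Lemma geometric_limit (u : nat -> C) K th : 0 <= th < 1 ->
  (forall n m, (n <= m)%N -> cabs (u m - u n) <= K * th ^+ n) ->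
  exists L : C, (u n : R[i]^o) @[n --> \oo] --> (L : R[i]^o) /\
    forall n, cabs (L - u n) <= 2 * K * th ^+ n.
Proof.
move=> /andP[t0 t1] uC.
have K0 : 0 <= K by have := uC 0%N 0%N (leqnn _); rewrite subrr cabs0 expr0 mulr1.
have real (x : nat -> R) : (forall n m, (n <= m)%N -> `|x m - x n| <= K * th ^+ n) ->
    exists L, forall n, `|L - x n| <= K * th ^+ n.
  move=> xC; pose S := [set x n - K * th ^+ n | n in [set: nat]].
  have ub m : ubound S (x m + K * th ^+ m).
    move=> _ [n _ <-]; have [nm|mn] := leqP n m.
      have := xC _ _ nm; rewrite ler_norml => /andP[H _].
      have : 0 <= K * th ^+ m by rewrite mulr_ge0 ?exprn_ge0.
      by move: H; lra.
    have := xC _ _ (ltnW mn); rewrite ler_norml => /andP[_ H].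
    have : 0 <= K * th ^+ n by rewrite mulr_ge0 ?exprn_ge0.
    by move: H; lra.
  have S0 : S !=set0 by exists (x 0%N - K * th ^+ 0), 0%N.
  exists (sup S) => n; rewrite ler_norml; apply/andP; split.
    have : x n - K * th ^+ n <= sup S.
      by apply: ub_le_sup; [exists (x 0%N + K * th ^+ 0); apply: ub | exists n].
    lra.
  have : sup S <= x n + K * th ^+ n by apply: ge_sup.
  lra.
have re (z : C) : `|complex.Re z| <= cabs z.
  by have := normc_ge_Re z; rewrite cabsE lecR.
have im (z : C) : `|complex.Im z| <= cabs z.
  rewrite /cabs normc_def /= -sqrtr_sqr ler_sqrt ?addr_ge0 ?sqr_ge0 //.
  by rewrite lerDr sqr_ge0.
have [|x Lx] := real (fun n => complex.Re (u n)).
  move=> n m nm; apply: le_trans (uC n m nm); apply: le_trans (re _).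
  by case: (u m) (u n) => ? ? [? ?].
have [|y Ly] := real (fun n => complex.Im (u n)).
  move=> n m nm; apply: le_trans (uC n m nm); apply: le_trans (im _).
  by case: (u m) (u n) => ? ? [? ?].
have bd n : cabs ((x +i* y)%C - u n) <= 2 * K * th ^+ n.
  have -> : (x +i* y)%C - u n = ((x - complex.Re (u n))%:C)%C
      + 'i%C * ((y - complex.Im (u n))%:C)%C.
    by case: (u n) => a b; apply/eqP; rewrite eq_complex /=; apply/andP; split; apply/eqP; ring.
  apply: le_trans (cabsD _ _) _; rewrite cabsM !cabs_real.
  have -> : cabs ('i%C : C) = 1 by rewrite /cabs normc_def /= expr0n expr1n add0r sqrtr1.
  by rewrite mul1r -mulrA mulr_natl mulr2n lerD.
exists (x +i* y)%C; split=> //.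
apply/cvgrPdist_lt => e e0.
have eE : e = ((complex.Re e)%:C)%C.
  move: e0; case: e => a b; rewrite ltcE /= => /andP[/eqP b0 _].
  by apply/eqP; rewrite eq_complex /= eqxx /=; apply/eqP; move: b0; lra.
have re0 : 0 < complex.Re e by rewrite -ltcR -eE.
have := @cvg_geometric R (2 * K) th; rewrite ger0_norm // => /(_ t1).
move=> /cvgrPdist_lt /(_ _ re0); apply: filterS => n /=.
rewrite sub0r normrN => H; rewrite [X in X < _]cabsE eE ltcR.
apply: le_lt_trans (bd n) _; apply: le_lt_trans H.
exact: ler_norm.
Qed.

(** The square partial sums in the definition of the value of a series. *)
Definition dsum (T : nat -> nat -> C) n : C := \sum_(j < n) \sum_(k < n) T j k.

Lemma dsum_cauchy (T : nat -> nat -> C) B th n m : 0 <= th < 1 ->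
  (forall j k, cabs (T j k) <= B * (th ^+ j * th ^+ k)) -> (n <= m)%N ->
  cabs (dsum T m - dsum T n) <= 2 * B / (1 - th) ^+ 2 * th ^+ n.
Proof.
move=> th01 TB nm; have th0 : 0 <= th by case/andP: th01.
have B0 : 0 <= B by have := le_trans (cabs_ge0 _) (TB 0%N 0%N); rewrite !expr0 !mulr1.
have th1 : 0 < 1 - th by rewrite subr_gt0; case/andP: th01.
have -> : dsum T m - dsum T n
   = \sum_(j < m) \sum_(k < m) (if (n <= j)%N || (n <= k)%N then T j k else 0).
  have -> : dsum T n = \sum_(j < m) \sum_(k < m) (if (j < n)%N && (k < n)%N then T j k else 0).
    rewrite /dsum (big_ord_widen m (fun j => \sum_(k < n) T j k)) // big_mkcond /=.
    apply: eq_bigr => j _; case: ifP => jn /=; last by rewrite big1.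
    by rewrite (big_ord_widen m (fun k => T j k)) // big_mkcond.
  rewrite /dsum -sumrB; apply: eq_bigr => j _; rewrite -sumrB; apply: eq_bigr => k _.
  by rewrite !ltnNge; case: (n <= j)%N; case: (n <= k)%N; rewrite /= ?subr0 ?subrr.
apply: (@le_trans _ _ (\sum_(j < m) \sum_(k < m) (
    B * ((if (n <= j)%N then th ^+ j else 0) * th ^+ k)
  + B * (th ^+ j * (if (n <= k)%N then th ^+ k else 0))))).
  apply: le_trans (cabs_sum _ _ _) _; apply: ler_sum => j _.
  apply: le_trans (cabs_sum _ _ _) _; apply: ler_sum => k _.
  have Bt : 0 <= B * (th ^+ j * th ^+ k) by rewrite !mulr_ge0 ?exprn_ge0.
  case: ifP => /=; last by move=> _; rewrite cabs0 addr_ge0 // mulr_ge0 // mulr_ge0 ?exprn_ge0 //; case: ifP; rewrite ?exprn_ge0.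
  move=> jk; apply: le_trans (TB j k) _.
  by move: jk; case: ifP => _; case: ifP => //= _ _; rewrite ?mul0r ?mulr0 ?addr0 ?add0r // lerDl.
have geo n' := @geometric_sum_le th n' m th01.
have geo0 : \sum_(k < m) th ^+ k <= (1 - th)^-1 by have := geo 0%N; rewrite expr0 mul1r.
have pos n' : 0 <= \sum_(j < m) (if (n' <= j)%N then th ^+ j else 0).
  by apply: sumr_ge0 => j _; case: ifP; rewrite ?exprn_ge0.
under eq_bigr do rewrite big_split /= -!mulr_sumr.
rewrite big_split /= -!mulr_sumr -!mulr_suml.
rewrite (_ : 2 * B / _ * _ = B * (th ^+ n / (1 - th) * (1 - th)^-1) + B * ((1 - th)^-1 * (th ^+ n / (1 - th)))); last first.
  by field; rewrite gt_eqF.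
apply: lerD; rewrite ler_wpM2l //; apply: ler_pM; rewrite ?pos //.
- by apply: sumr_ge0 => j _; rewrite exprn_ge0.
- by apply: sumr_ge0 => j _; rewrite exprn_ge0.
Qed.

Lemma dsum_limit (T : nat -> nat -> C) B th : 0 <= th < 1 ->
  (forall j k, cabs (T j k) <= B * (th ^+ j * th ^+ k)) ->
  exists L : C, (dsum T n : R[i]^o) @[n --> \oo] --> (L : R[i]^o) /\
    forall n, cabs (L - dsum T n) <= 4 * B / (1 - th) ^+ 2 * th ^+ n.
Proof.
move=> th01 TB; have [L [cL bL]] := geometric_limit th01 (fun n m => dsum_cauchy th01 TB).
exists L; split=> // n; apply: le_trans (bL n) _.
by rewrite le_eqVlt; apply/orP; left; apply/eqP; ring.
Qed.

Lemma dsum_bound (T : nat -> nat -> C) B th n : 0 <= th < 1 ->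
  (forall j k, cabs (T j k) <= B * (th ^+ j * th ^+ k)) ->
  cabs (dsum T n) <= 2 * B / (1 - th) ^+ 2.
Proof.
move=> th01 TB; have := dsum_cauchy th01 TB (leq0n n).
by rewrite [dsum T 0]/dsum big_ord0 subr0 expr0 mulr1.
Qed.

Definition psum F z w n : C := dsum (fun j k => F j k * z ^+ j * w ^+ k) n.

Definition geometric F B a := forall j k, cabs (F j k) <= B * a ^+ (j + k).

Lemma geometric_terms F B a z w r j k : geometric F B a -> 0 <= a -> 0 <= B ->
  cabs z <= r -> cabs w <= r ->
  cabs (F j k * z ^+ j * w ^+ k) <= B * ((a * r) ^+ j * (a * r) ^+ k).
Proof.
move=> gF a0 B0 zr wr; have r0 : 0 <= r by apply: le_trans zr; exact: cabs_ge0.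
rewrite !cabsM !cabsX -mulrA; apply: (@le_trans _ _ (B * a ^+ (j + k) * (r ^+ j * r ^+ k))).
  apply: ler_pM; rewrite ?mulr_ge0 ?cabs_ge0 ?exprn_ge0 ?cabs_ge0 //.
  by apply: ler_pM; rewrite ?exprn_ge0 ?cabs_ge0 // lerXn2r ?nnegrE ?cabs_ge0.
by rewrite !exprMn exprD le_eqVlt; apply/orP; left; apply/eqP; ring.
Qed.

Lemma eval_limit F B a z w r : geometric F B a -> 0 <= a -> 0 <= B ->
  cabs z <= r -> cabs w <= r -> a * r < 1 ->
  (psum F z w n : R[i]^o) @[n --> \oo] --> (fps_eval F z w) /\
  forall n, cabs (fps_eval F z w - psum F z w n) <= 4 * B / (1 - a * r) ^+ 2 * (a * r) ^+ n.
Proof.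
move=> gF a0 B0 zr wr ar; have r0 : 0 <= r by apply: le_trans zr; exact: cabs_ge0.
have th01 : 0 <= a * r < 1 by rewrite mulr_ge0.
have [L [cL bL]] := dsum_limit th01 (fun j k => geometric_terms j k gF a0 B0 zr wr).
suff -> : fps_eval F z w = L by [].
by rewrite /fps_eval; apply: cvg_lim; first exact: norm_hausdorff.
Qed.

Lemma term_bound F r1 r2 : 0 <= r1 -> 0 <= r2 -> abs_convergent_at F r1 r2 ->
  exists2 K : R, 0 <= K & forall j k, cabs (F j k) * r1 ^+ j * r2 ^+ k <= K.
Proof.
move=> r1p r2p; rewrite /abs_convergent_at.
set a := (fun p : nat * nat => _); set S := esum _ _ => Sfin.
have a0 p : (0 <= a p)%E by rewrite lee_fin !mulr_ge0 ?cabs_ge0 ?exprn_ge0.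
have S0 : (0 <= S)%E by apply: esum_ge0 => p _; apply: a0.
have SK : S = (fine S)%:E by rewrite fineK // ge0_fin_numE.
exists (fine S); first by rewrite -lee_fin -SK.
move=> j k; rewrite -lee_fin -SK; apply: esum_ge; exists [set (j, k)]; first by split.
by rewrite fsbig_set1.
Qed.

Lemma abs_convergent_geometric F B a r1 r2 : geometric F B a -> 0 <= a -> 0 <= B ->
  0 <= r1 -> 0 <= r2 -> a * r1 < 1 -> a * r2 < 1 -> abs_convergent_at F r1 r2.
Proof.
move=> gF a0 B0 r10 r20 ar1 ar2.
have geo (th : R) (c : R) : 0 <= th < 1 -> 0 <= c ->
    (\esum_(k in [set: nat]) (c * th ^+ k)%:E <= (c / (1 - th))%:E)%E.
  move=> th01 c0; have t0 : 0 <= th by case/andP: th01.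
  rewrite -nneseries_esumT; last by move=> n; rewrite lee_fin mulr_ge0 ?exprn_ge0.
  apply: lime_le; first by apply: is_cvg_nneseries => n _ _; rewrite lee_fin mulr_ge0 ?exprn_ge0.
  apply: nearW => n; rewrite sumEFin lee_fin big_mkord -mulr_sumr ler_wpM2l //.
  by have := geometric_sum_le 0 n th01; rewrite expr0 mul1r.
rewrite /abs_convergent_at.
apply: (@le_lt_trans _ _ (\esum_(p in [set: nat] `*`` (fun=> [set: nat]))
   (B * (a * r1) ^+ p.1 * (a * r2) ^+ p.2)%:E)%E).
  rewrite [X in esum X _](_ : _ = [set: nat] `*`` (fun=> [set: nat])); last first.
    by apply/seteqP; split.
  apply: le_esum => -[j k] _ /=; rewrite lee_fin.
  have := gF j k => H; rewrite -mulrA.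
  apply: le_trans (ler_wpM2r (mulr_ge0 (exprn_ge0 j r10) (exprn_ge0 k r20)) H) _.
  by rewrite le_eqVlt; apply/orP; left; apply/eqP; rewrite !exprMn exprD; ring.
rewrite -(@esum_esum R nat nat [set: nat] (fun=> [set: nat])
  (fun j k => (B * (a * r1) ^+ j * (a * r2) ^+ k)%:E)); last first.
  by move=> i j _ _; rewrite lee_fin !mulr_ge0 ?exprn_ge0 ?mulr_ge0.
have th1 : 0 <= a * r1 < 1 by rewrite mulr_ge0.
have th2 : 0 <= a * r2 < 1 by rewrite mulr_ge0.
apply: (@le_lt_trans _ _ (\esum_(j in [set: nat]) ((B / (1 - a * r2)) * (a * r1) ^+ j)%:E)%E).
  apply: le_esum => j _; apply: le_trans (geo _ (B * (a * r1) ^+ j) th2 _) _.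
    by rewrite mulr_ge0 ?exprn_ge0 ?mulr_ge0.
  by rewrite lee_fin mulrAC.
apply: le_lt_trans (geo _ _ th1 _) _; last exact: ltry.
by rewrite divr_ge0 // subr_ge0 ltW.
Qed.

(** Cauchy's inequality on the torus |z| = |w| = r, without integrals. The coefficient is an average over roots of unity of a
    large order Q, up to the coefficients of index larger than Q. *)
Lemma cauchy_coefficient F G B a B' a' r e j k :
  geometric F B a -> geometric G B' a' -> 0 <= a -> 0 <= a' -> 0 <= B -> 0 <= B' ->
  0 <= r -> a * r < 1 -> a' * r < 1 ->
  (forall s t, 0 <= s <= 1 -> 0 <= t <= 1 ->
    cabs (fps_eval F ((r%:C)%C * lambda s) ((r%:C)%C * lambda t)
        - fps_eval G ((r%:C)%C * lambda s) ((r%:C)%C * lambda t)) <= e) ->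
  cabs (F j k - G j k) * r ^+ (j + k) <= e.
Proof.
move=> gF gG a0 a'0 B0 B'0 r0 ar a'r FG.
pose tail Q := 4 * B / (1 - a * r) ^+ 2 * (a * r) ^+ Q + 4 * B' / (1 - a' * r) ^+ 2 * (a' * r) ^+ Q.
have cz s : cabs ((r%:C)%C * lambda s) <= r by rewrite cabsM cabs_lambda cabs_real mulr1 ger0_norm.
have average Q : (j < Q)%N -> (k < Q)%N -> cabs (F j k - G j k) * r ^+ (j + k) <= e + tail Q.
  move=> jQ kQ; have Q0 : (0 < Q)%N by lia.
  have Q0' : (Q%:R : R) != 0 by rewrite pnatr_eq0; lia.
  pose zt (s : nat) := (r%:C)%C * lambda (s%:R / Q%:R : R).
  pose D (z w : C) := psum F z w Q - psum G z w Q.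
  pose H := F - G.
  have DE z w : D z w = \sum_(b < Q) \sum_(c < Q) H b c * z ^+ b * w ^+ c.
    rewrite /D /psum /dsum -sumrB; apply: eq_bigr => b _; rewrite -sumrB; apply: eq_bigr => c _.
    by rewrite /H ser_subE !mulrBl.
  have st01 (s : 'I_Q) : 0 <= (s%:R / Q%:R : R) <= 1.
    by rewrite divr_ge0 //= ler_pdivrMr ?ltr0n // mul1r ler_nat ltnW.
  have Dle (s t : 'I_Q) : cabs (D (zt s) (zt t)) <= e + tail Q.
    have [_ /(_ Q) H1] := eval_limit gF a0 B0 (cz (s%:R / Q%:R)) (cz (t%:R / Q%:R)) ar.
    have [_ /(_ Q) H2] := eval_limit gG a'0 B'0 (cz (s%:R / Q%:R)) (cz (t%:R / Q%:R)) a'r.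
    have H3 := FG _ _ (st01 s) (st01 t).
    rewrite /D /zt; set p1 := psum F _ _ _ in H1 *; set p2 := psum G _ _ _ in H2 *.
    set e1 := fps_eval F _ _ in H1 H3; set e2 := fps_eval G _ _ in H2 H3.
    rewrite (_ : p1 - p2 = (e1 - e2) - (e1 - p1) + (e2 - p2)); last by ring.
    apply: le_trans (cabsD _ _) _; apply: (@le_trans _ _ (cabs (e1 - e2) + cabs (e1 - p1) + cabs (e2 - p2))).
      by rewrite lerD2r; apply: cabsB.
    by rewrite /tail; move: H1 H2 H3; lra.
  pose m (b j : nat) := (b + (Q - j))%N.
  have avg : \sum_(s < Q) \sum_(t < Q)
      D (zt s) (zt t) * (lambda (s%:R / Q%:R * (Q - j)%:R) * lambda (t%:R / Q%:R * (Q - k)%:R))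
     = Q%:R ^+ 2 * (H j k * ((r ^+ (j + k))%:C)%C).
    transitivity (\sum_(b < Q) \sum_(c < Q) H b c * ((r ^+ (b + c))%:C)%C *
       ((\sum_(s < Q) lambda (s%:R / Q%:R * (m b j)%:R)) * (\sum_(t < Q) lambda (t%:R / Q%:R * (m c k)%:R)))).
      under eq_bigr do under eq_bigr do (rewrite DE mulr_suml; under eq_bigr do rewrite mulr_suml).
      under eq_bigr do rewrite exchange_big.
      rewrite exchange_big; apply: eq_bigr => b _ /=.
      under eq_bigr do rewrite exchange_big.
      rewrite exchange_big; apply: eq_bigr => c _ /=.
      rewrite mulr_suml mulr_sumr; apply: eq_bigr => s _.
      rewrite [in RHS]mulr_sumr mulr_sumr; apply: eq_bigr => t _.
      rewrite /zt /m !natrD !mulrDr !lambdaD !exprMn !lambdaX -!rmorphXn exprD rmorphM /=.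
      by rewrite [b%:R * _]mulrC [c%:R * _]mulrC; ring.
    have one (b l : nat) : (b < Q)%N -> (l < Q)%N -> (Q %| m b l)%N = (b == l).
      move=> bQ lQ; rewrite /m; apply/idP/eqP => [/dvdnP[q]|->]; last by rewrite subnKC ?dvdnn // ltnW.
      case: q => [|[|q]]; [rewrite mul0n; lia | rewrite mul1n; lia |].
    by rewrite !mulSn; move: (q * Q)%N; lia.
    rewrite (bigD1 (Ordinal jQ)) //= (bigD1 (Ordinal kQ)) //=.
    rewrite !lambda_root_sum // !one // !eqxx big1 => [|c]; last first.
      rewrite -val_eqE /= => /negPf ck.
      by rewrite !lambda_root_sum // !one // ck !mulr0.
    rewrite big1 => [|b]; last first.
      rewrite -val_eqE /= => /negPf bj; rewrite big1 // => c _.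
      by rewrite !lambda_root_sum // !one // bj mul0r mulr0.
    by rewrite !addr0; ring.
  have Q2 : 0 < (Q%:R ^+ 2 : R) by rewrite exprn_gt0 // ltr0n.
  rewrite -(ler_pM2l Q2).
  have -> : Q%:R ^+ 2 * (cabs (F j k - G j k) * r ^+ (j + k))
      = cabs (Q%:R ^+ 2 * (H j k * ((r ^+ (j + k))%:C)%C)).
    have -> : (Q%:R : C) = ((Q%:R : R)%:C)%C by rewrite rmorph_nat.
    by rewrite (cabsM (_ ^+ 2)) cabsX (cabsM (H j k)) !cabs_real !ger0_norm ?exprn_ge0.
  rewrite -avg; apply: le_trans (cabs_sum _ _ _) _.
  apply: (@le_trans _ _ (\sum_(s < Q) \sum_(t < Q) (e + tail Q))).
    apply: ler_sum => s _; apply: le_trans (cabs_sum _ _ _) _; apply: ler_sum => t _.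
    by rewrite !cabsM !cabs_lambda !mulr1.
  by rewrite !sumr_const card_ord -mulrnA -[X in X <= _]mulr_natl natrM expr2.
apply/ler_addgt0Pr => d d0.
have c1 : (fun n => 4 * B / (1 - a * r) ^+ 2 * (a * r) ^+ n) @ \oo --> (0 : R).
  by apply: cvg_geometric; rewrite ger0_norm // mulr_ge0.
have c2 : (fun n => 4 * B' / (1 - a' * r) ^+ 2 * (a' * r) ^+ n) @ \oo --> (0 : R).
  by apply: cvg_geometric; rewrite ger0_norm // mulr_ge0.
have : tail @ \oo --> (0 : R) by rewrite -[0]addr0; apply: cvgD.
move=> /cvgrPdist_lt /(_ _ d0) [N _ HN].
pose Q := maxn N (maxn j k).+1.
apply: le_trans (average Q _ _) _; [rewrite /Q; lia|rewrite /Q; lia|].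
rewrite lerD2l; have := HN Q (leq_maxl _ _); rewrite /= sub0r normrN => /ltW.
exact: le_trans (ler_norm _).
Qed.

End Values.

(** * Differentiability of convergent series *)

Section Differentiability.
Variable R : realType.
Local Notation C := R[i].
Local Notation C2 := (R[i]^o * R[i]^o)%type.
Implicit Types (F G H : ser C) (z w : C) (r th B a : R).

Lemma pos_complex (e : C) : 0 < e -> exists2 d : R, 0 < d & e = (d%:C)%C.
Proof.
case: e => x y; rewrite ltcE /= => /andP[/eqP y0 x0]; exists x => //.
by apply/eqP; rewrite eq_complex /= eqxx /=; apply/eqP; move: y0; lra.
Qed.

Lemma monomial_taylor z w z' w' r d j k : 0 < r -> 0 <= d ->
  cabs z <= r -> cabs w <= r -> cabs z' <= r -> cabs w' <= r ->
  cabs (z' - z) <= d -> cabs (w' - w) <= d ->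
  cabs (z' ^+ j * w' ^+ k - z ^+ j * w ^+ k
    - ((j%:R * z ^+ j.-1 * w ^+ k) * (z' - z) + (k%:R * z ^+ j * w ^+ k.-1) * (w' - w)))
  <= (j + k)%:R ^+ 2 * r ^+ (j + k) * (d / r) ^+ 2.
Proof.
move=> r0 d0 zr wr z'r w'r zd wd; pose q := d / r.
have q0 : 0 <= q by rewrite divr_ge0 // ltW.
have dq : d = q * r by rewrite /q divfK // gt_eqF.
(* [L] bounds the linear part and [E] the remainder; both are multiplicative
   in the monomial, one factor at a time. *)
pose P j k := z ^+ j * w ^+ k.
pose L j k := (j%:R * z ^+ j.-1 * w ^+ k) * (z' - z) + (k%:R * z ^+ j * w ^+ k.-1) * (w' - w).
pose E j k := z' ^+ j * w' ^+ k - P j k - L j k.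
have PB i l : cabs (P i l) <= r ^+ (i + l).
  rewrite /P cabsM !cabsX exprD; apply: ler_pM; rewrite ?exprn_ge0 ?cabs_ge0 //;
    by rewrite lerXn2r ?nnegrE ?cabs_ge0 // ltW.
have LB i l : cabs (L i l) <= (i + l)%:R * r ^+ (i + l) * q.
  have one (x y : C) n m : cabs x <= r -> cabs y <= r ->
      cabs (n%:R * x ^+ n.-1 * y ^+ m) * d <= n%:R * r ^+ (n + m) * q.
    move=> xr yr; case: n => [|n]; first by rewrite !mul0r cabs0 mul0r.
    rewrite !cabsM !cabsX /= (_ : cabs n.+1%:R = n.+1%:R); last first.
      by rewrite -(rmorph_nat (real_complex R)) cabs_real ger0_norm.
    rewrite dq (_ : _ * (q * r) = n.+1%:R * (cabs x ^+ n * cabs y ^+ m * r) * q); last by ring.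
    rewrite ler_wpM2r // ler_wpM2l // addSn exprS [r * _]mulrC ler_wpM2r ?(ltW r0) // exprD.
    apply: ler_pM; rewrite ?exprn_ge0 ?cabs_ge0 //;
      by rewrite lerXn2r ?nnegrE ?cabs_ge0 // ltW.
  apply: le_trans (cabsD _ _) _; rewrite natrD !mulrDl; apply: lerD; rewrite cabsM.
    by apply: le_trans (one z w i l zr wr); rewrite ler_wpM2l ?cabs_ge0.
  rewrite [(i + l)%N]addnC; apply: le_trans (one w z l i wr zr).
  by rewrite [l%:R * _ * _]mulrAC ler_wpM2l ?cabs_ge0.
suff EB i l : cabs (E i l) <= (i + l)%:R ^+ 2 * r ^+ (i + l) * q ^+ 2.
  by have := EB j k; rewrite /E /P /L.
have step (x x' : C) n (l0 e0 : C) : cabs x <= r -> cabs x' <= r -> cabs (x' - x) <= d ->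
    cabs l0 <= n%:R * r ^+ n * q -> cabs e0 <= n%:R ^+ 2 * r ^+ n * q ^+ 2 ->
    cabs ((x' - x) * l0 + x' * e0) <= n.+1%:R ^+ 2 * r ^+ n.+1 * q ^+ 2.
  move=> xr x'r xd lB eB.
  apply: le_trans (cabsD _ _) _; rewrite !cabsM.
  apply: (@le_trans _ _ (d * (n%:R * r ^+ n * q) + r * (n%:R ^+ 2 * r ^+ n * q ^+ 2))).
    by apply: lerD; apply: ler_pM; rewrite ?cabs_ge0.
  rewrite (_ : _ + _ = (n%:R + n%:R ^+ 2) * (r ^+ n.+1 * q ^+ 2)); last first.
    by rewrite dq [r ^+ n.+1]exprS; ring.
  rewrite -[X in _ <= X]mulrA ler_wpM2r ?(mulr_ge0 (exprn_ge0 _ (ltW r0)) (exprn_ge0 _ q0)) //.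
  by rewrite -natr1 sqrrD expr1n; have := ler0n R n; lra.
elim: i l => [|i IH] l; last first.
  rewrite addSn (_ : E i.+1 l = (z' - z) * L i l + z' * E i l); last first.
    rewrite /E /P /L /= !exprS -natr1; case: i {IH} => [|i] /=; rewrite ?mul0r ?exprS; ring.
  exact: step.
elim: l => [|l IH]; first by rewrite /E /P /L !expr0 !mul0r addr0 !mulr1 !subrr cabs0 expr0n !mul0r.
rewrite add0n (_ : E 0%N l.+1 = (w' - w) * L 0%N l + w' * E 0%N l); last first.
  rewrite /E /P /L /= !exprS -natr1; case: l {IH} => [|l] /=; rewrite ?mul0r ?exprS; ring.
by apply: step => //; rewrite -[l]add0n.
Qed.

Lemma natr_geometric k (n : nat) : 0 <= k < 1 -> n%:R * k ^+ n <= (1 - k)^-1 :> R.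
Proof.
move=> /andP[k0 k1]; have k1' : 0 < 1 - k by rewrite subr_gt0.
have := @geometric_sum_le R k 0 n; rewrite expr0 mul1r k0 k1 => /(_ isT); apply: le_trans.
rewrite mulr_natl -[X in _ *+ X]card_ord -sumr_const; apply: ler_sum => i _ /=.
by apply: ler_wiXn2l => //; [apply: ltW | apply: ltnW].
Qed.

(** Polynomial factors are absorbed by a slightly larger ratio. *)
Lemma natr_sqr_absorb th : 0 <= th < 1 ->
  exists2 th' : R, 0 <= th' < 1 & exists2 A : R, 0 <= A &
    forall n : nat, n%:R * th ^+ n <= A * th' ^+ n /\ n%:R ^+ 2 * th ^+ n <= A * th' ^+ n.
Proof.
move=> /andP[t0 t1]; pose th1 := (1 + th) / 2; pose th2 := (1 + th1) / 2.
have t01 : th < th1 < 1 by rewrite /th1; lra.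
have t12 : th1 < th2 < 1 by rewrite /th2; lra.
have p1 : 0 < th1 by lra. have p2 : 0 < th2 by lra.
exists th2; first by lra.
pose A1 := (1 - th / th1)^-1; pose A2 := (1 - th1 / th2)^-1.
have h1 : 0 <= th / th1 < 1.
  by rewrite divr_ge0 ?(ltW p1) //= ltr_pdivrMr // mul1r; lra.
have h2 : 0 <= th1 / th2 < 1.
  by rewrite divr_ge0 ?ltW //= ltr_pdivrMr // mul1r; lra.
have A1p : 0 < A1 by rewrite /A1 invr_gt0; lra.
have A2p : 0 < A2 by rewrite /A2 invr_gt0; lra.
have b1 n : n%:R * th ^+ n <= A1 * th1 ^+ n.
  have := natr_geometric n h1; rewrite -/A1 expr_div_n mulrA ler_pdivrMr ?exprn_gt0 //.
have b2 n : n%:R * th1 ^+ n <= A2 * th2 ^+ n.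
  have := natr_geometric n h2; rewrite -/A2 expr_div_n mulrA ler_pdivrMr ?exprn_gt0 //.
exists (A1 * (1 + A2)); first by rewrite mulr_ge0 ?(ltW A1p) // addr_ge0 // ltW.
move=> n; have e2 : 0 <= th2 ^+ n by rewrite exprn_ge0 // ltW.
split.
  apply: le_trans (b1 n) _; rewrite -mulrA ler_wpM2l ?(ltW A1p) // mulrDl mul1r.
  apply: (@le_trans _ _ (th2 ^+ n)); last by rewrite lerDl mulr_ge0 // ltW.
  by rewrite lerXn2r ?nnegrE ?ltW //; lra.
rewrite expr2 -mulrA; apply: le_trans (ler_wpM2l (ler0n _ n) (b1 n)) _.
rewrite mulrCA -mulrA ler_wpM2l ?(ltW A1p) // mulrDl mul1r.
by apply: le_trans (b2 n) _; rewrite lerDr.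
Qed.

(** Complex differentiability with an explicit quadratic remainder, by summing
    the Taylor estimates of the monomials. *)
Lemma eval_taylor F B a r z w : geometric F B a -> 0 <= a -> 0 <= B -> 0 < r ->
  a * r < 1 -> cabs z <= r -> cabs w <= r ->
  exists A1 A2 : C, exists2 K : R, 0 <= K & forall z' w' d, cabs z' <= r -> cabs w' <= r ->
    0 <= d -> cabs (z' - z) <= d -> cabs (w' - w) <= d ->
    cabs (fps_eval F z' w' - fps_eval F z w - (A1 * (z' - z) + A2 * (w' - w))) <= K * d ^+ 2.
Proof.
move=> gF a0 B0 r0 ar zr wr; have th01 : 0 <= a * r < 1 by rewrite mulr_ge0 // ltW.
have [th t01 [A A0 tA]] := natr_sqr_absorb th01; set th0 := a * r in th01 tA.
have t0 : 0 <= th by case/andP: t01.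
have tA1 n := (tA n).1; have tA2 n := (tA n).2.
have natC (n : nat) : cabs (n%:R : C) = n%:R.
  by rewrite -(rmorph_nat (real_complex R)) cabs_real ger0_norm.
pose T1 (j k : nat) := F j k * (j%:R * z ^+ j.-1 * w ^+ k).
pose T2 (j k : nat) := F j k * (k%:R * z ^+ j * w ^+ k.-1).
have pw (x y : C) n m : cabs x <= r -> cabs y <= r ->
    cabs (n%:R * x ^+ n.-1 * y ^+ m) <= (n + m)%:R * r ^+ (n + m) / r.
  move=> xr yr; case: n => [|n].
    by rewrite !mul0r cabs0 divr_ge0 ?mulr_ge0 ?exprn_ge0 // ltW.
  rewrite !cabsM !cabsX natC /= (_ : _ / r = (n.+1 + m)%:R * (r ^+ n * r ^+ m)); last first.
    by rewrite addSn exprS exprD; field; rewrite gt_eqF.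
  rewrite -mulrA; apply: ler_pM; rewrite ?mulr_ge0 ?exprn_ge0 ?cabs_ge0 // ?ler_nat ?ltnS ?leq_addr //.
  by apply: ler_pM; rewrite ?exprn_ge0 ?cabs_ge0 // lerXn2r ?nnegrE ?cabs_ge0 // ltW.
have TB (T : nat -> nat -> C) (j k : nat) : cabs (T j k) <= cabs (F j k) * ((j + k)%:R * r ^+ (j + k) / r) ->
    cabs (T j k) <= B * A / r * (th ^+ j * th ^+ k).
  move=> H; apply: le_trans H _.
  apply: (@le_trans _ _ (B * a ^+ (j + k) * ((j + k)%:R * r ^+ (j + k) / r))).
    by rewrite ler_wpM2r ?divr_ge0 ?mulr_ge0 ?exprn_ge0 // ltW.
  rewrite (_ : _ * (_ * _ / r) = (B / r) * ((j + k)%:R * th0 ^+ (j + k))); last by rewrite /th0 exprMn; ring.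
  rewrite (_ : B * A / r * _ = (B / r) * (A * th ^+ (j + k))); last by rewrite exprD; ring.
  by rewrite ler_wpM2l ?divr_ge0 // ltW.
have T1B j k : cabs (T1 j k) <= B * A / r * (th ^+ j * th ^+ k).
  by apply: TB; rewrite /T1 cabsM ler_wpM2l ?cabs_ge0 // pw.
have T2B j k : cabs (T2 j k) <= B * A / r * (th ^+ j * th ^+ k).
  by apply: TB; rewrite /T2 cabsM ler_wpM2l ?cabs_ge0 // [_ * z ^+ _ * _]mulrAC addnC pw.
have [A1 [_ H1]] := dsum_limit t01 T1B; have [A2 [_ H2]] := dsum_limit t01 T2B.
exists A1, A2.
pose K := 2 * (B * A / r ^+ 2) / (1 - th) ^+ 2.
have th1 : 0 < 1 - th by rewrite subr_gt0; case/andP: t01.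
have K0 : 0 <= K.
  apply: divr_ge0; last by rewrite exprn_ge0 // ltW.
  by apply: mulr_ge0 => //; apply: divr_ge0; [exact: mulr_ge0 | exact: exprn_ge0 (ltW r0)].
exists K => // z' w' d z'r w'r d0 zd wd.
have [_ E0] := eval_limit gF a0 B0 zr wr ar; have [_ E1] := eval_limit gF a0 B0 z'r w'r ar.
pose X j k := F j k * (z' ^+ j * w' ^+ k - z ^+ j * w ^+ k
    - ((j%:R * z ^+ j.-1 * w ^+ k) * (z' - z) + (k%:R * z ^+ j * w ^+ k.-1) * (w' - w))).
have XB j k : cabs (X j k) <= (B * A / r ^+ 2 * d ^+ 2) * (th ^+ j * th ^+ k).
  rewrite /X cabsM; have MT := monomial_taylor j k r0 d0 zr wr z'r w'r zd wd.
  apply: (@le_trans _ _ (B * a ^+ (j + k) * ((j + k)%:R ^+ 2 * r ^+ (j + k) * (d / r) ^+ 2))).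
    by apply: ler_pM; rewrite ?cabs_ge0.
  rewrite (_ : _ * (_ * _) = (B / r ^+ 2 * d ^+ 2) * ((j + k)%:R ^+ 2 * th0 ^+ (j + k))); last first.
    by rewrite /th0 [(a * r) ^+ _]exprMn; field; rewrite gt_eqF.
  rewrite (_ : B * A / r ^+ 2 * d ^+ 2 * _ = (B / r ^+ 2 * d ^+ 2) * (A * th ^+ (j + k))); last by rewrite exprD; ring.
  by rewrite ler_wpM2l // mulr_ge0 ?exprn_ge0 // divr_ge0 // exprn_ge0 // ltW.
have SX n : dsum X n = psum F z' w' n - psum F z w n - (dsum T1 n * (z' - z) + dsum T2 n * (w' - w)).
  rewrite /psum /dsum !mulr_suml -sumrB -big_split -sumrB; apply: eq_bigr => j _ /=.
  rewrite !mulr_suml -sumrB -big_split -sumrB; apply: eq_bigr => k _ /=.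
  by rewrite /X /T1 /T2; ring.
pose U := 4 * B / (1 - th0) ^+ 2; pose V := 4 * (B * A / r) / (1 - th) ^+ 2.
have bnd n : cabs (fps_eval F z' w' - fps_eval F z w - (A1 * (z' - z) + A2 * (w' - w)))
    <= K * d ^+ 2 + (2 * U * th0 ^+ n + 2 * d * V * th ^+ n).
  set f' := fps_eval F z' w' in E1 *; set f := fps_eval F z w in E0 *.
  rewrite (_ : _ - _ = dsum X n + ((f' - psum F z' w' n) - (f - psum F z w n)
      - ((A1 - dsum T1 n) * (z' - z) + (A2 - dsum T2 n) * (w' - w)))); last by rewrite SX; ring.
  apply: le_trans (cabsD _ _) _; apply: lerD.
    by apply: le_trans (dsum_bound n t01 XB) _; rewrite /K le_eqVlt; apply/orP; left; apply/eqP; ring.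
  apply: le_trans (cabsB _ _) _; apply: lerD.
    by apply: le_trans (cabsB _ _) _; have := E1 n; have := E0 n; rewrite -/U; lra.
  apply: le_trans (cabsD _ _) _; rewrite !cabsM.
  have V1 := H1 n; have V2 := H2 n; rewrite -/V in V1 V2.
  rewrite (_ : 2 * d * V * _ = V * th ^+ n * d + V * th ^+ n * d); last by ring.
  by apply: lerD; apply: ler_pM; rewrite ?cabs_ge0.
apply/ler_addgt0Pr => e e0.
have c1 : (fun n => 2 * U * th0 ^+ n) @ \oo --> (0 : R).
  by apply: cvg_geometric; case/andP: th01 => ? ?; rewrite ger0_norm.
have c2 : (fun n => 2 * d * V * th ^+ n) @ \oo --> (0 : R).
  by apply: cvg_geometric; case/andP: t01 => ? ?; rewrite ger0_norm.
have : (fun n => 2 * U * th0 ^+ n + 2 * d * V * th ^+ n) @ \oo --> (0 : R).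
  by rewrite -[0]addr0; apply: cvgD.
move=> /cvgrPdist_lt /(_ _ e0) [N _ /(_ N (leqnn _))] /=; rewrite sub0r normrN => HN.
apply: le_trans (bnd N) _; rewrite lerD2l; apply: le_trans (ltW HN).
exact: ler_norm.
Qed.

Definition lin2 (A1 A2 : C) (p : C2) : R[i]^o := A1 * p.1 + A2 * p.2.
Fact lin2_is_linear A1 A2 : linear (lin2 A1 A2).
Proof.
move=> c p q; rewrite /lin2 /=.
rewrite [LHS](_ : _ = A1 * (c * p.1 + q.1) + A2 * (c * p.2 + q.2)) //.
rewrite [RHS](_ : _ = c * (A1 * p.1 + A2 * p.2) + (A1 * q.1 + A2 * q.2)) //.
by rewrite !mulrDr; ring.
Qed.
HB.instance Definition _ A1 A2 := GRing.isLinear.Build R[i] C2 R[i]^o _ (lin2 A1 A2) (lin2_is_linear A1 A2).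

Lemma lin2_continuous A1 A2 : continuous (lin2 A1 A2).
Proof.
move=> p; apply: cvgD.
  by apply: cvgMr; exact: cvg_fst.
by apply: cvgMr; exact: cvg_snd.
Qed.

Lemma differentiable_taylor (f : C2 -> R[i]^o) (p : C2) (A1 A2 : C) (K d0 : R) : 0 < d0 -> 0 <= K ->
  (forall q d, 0 <= d < d0 -> cabs (q.1 - p.1) <= d -> cabs (q.2 - p.2) <= d ->
     cabs (f q - f p - (A1 * (q.1 - p.1) + A2 * (q.2 - p.2))) <= K * d ^+ 2) ->
  differentiable f p.
Proof.
move=> d0p K0 H.
have E : f \o shift p = cst (f p) + lin2 A1 A2 +o_ (0 : C2) id.
  apply/eqaddoP => e /pos_complex[e' e'0 ->].
  have m0 : 0 < Num.min d0 (e' / (K + 1)) by rewrite lt_min d0p divr_gt0 // ltr_wpDl.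
  apply/nbhs_ballP; exists ((Num.min d0 (e' / (K + 1)))%:C)%C; first by rewrite /= ltcR.
  move=> h /=; rewrite -ball_normE /= sub0r normrN prod_normE => hd.
  have [h1 h2] : `|h.1| = ((cabs h.1)%:C)%C /\ `|h.2| = ((cabs h.2)%:C)%C by [].
  rewrite h1 h2; pose d := Num.max (cabs h.1) (cabs h.2).
  have Ed : Num.max ((cabs h.1)%:C)%C ((cabs h.2)%:C)%C = (d%:C)%C.
    by rewrite /d /Num.max /Order.max ltcR; case: ifP.
  rewrite h1 h2 Ed ltcR in hd; rewrite Ed.
  have dd0 : d < d0 by apply: lt_le_trans hd _; rewrite ge_min lexx.
  have de : d <= e' / (K + 1) by apply: ltW; apply: lt_le_trans hd _; rewrite ge_min lexx orbT.
  have dge : 0 <= d by rewrite /d le_max cabs_ge0.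
  have := H (h + p) d; rewrite dge dd0 /= !addrK => /(_ isT).
  have -> : cabs h.1 <= d by rewrite /d le_max lexx.
  have -> : cabs h.2 <= d by rewrite /d le_max lexx orbT.
  move=> /(_ isT isT) Hh.
  rewrite -rmorphM /= [X in X <= _](_ : _ = ((cabs (f (h + p) - f p - (A1 * h.1 + A2 * h.2)))%:C)%C); last first.
    rewrite -cabsE; congr `|_|.
    by rewrite [LHS](_ : _ = f (h + p) - (f p + (A1 * h.1 + A2 * h.2))) // opprD addrA.
  rewrite lecR; apply: le_trans Hh _; rewrite expr2 mulrA ler_wpM2r //.
  apply: (@le_trans _ _ ((K + 1) * d)); first by rewrite ler_wpM2r // lerDl.
  by rewrite mulrC -ler_pdivlMr // ltr_wpDl.
have D := diff_unique (@lin2_continuous A1 A2) E.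
by apply/diff_locallyP; rewrite D; split => //; exact: lin2_continuous.
Qed.

Lemma geometric_conj F B a : geometric F B a -> geometric (conj F) B a.
Proof. by move=> gF j k; rewrite conjE cabsJ addnC. Qed.

Lemma complex_ext_differentiable F B a D (p : C2) : geometric F B a -> 0 <= a -> 0 <= B ->
  a * D < 1 -> polydisc D p -> differentiable (complex_ext F) p.
Proof.
move=> gF a0 B0 aD [/= p1 p2].
have D0 : 0 < D by apply: le_lt_trans p1; exact: cabs_ge0.
pose d0 := Num.min (D - cabs p.1) (D - cabs p.2).
have d0p : 0 < d0 by rewrite lt_min !subr_gt0 p1 p2.
have one G : geometric G B a -> differentiable (fun q : C2 => fps_eval G q.1 q.2 : R[i]^o) p.
  move=> gG; have [A1 [A2 [K K0 H]]] := eval_taylor gG a0 B0 D0 aD (ltW p1) (ltW p2).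
  apply: (@differentiable_taylor _ p A1 A2 K d0) => // q d /andP[d0' dd] q1 q2.
  have [b1 b2] : d0 <= D - cabs p.1 /\ d0 <= D - cabs p.2 by rewrite /d0 !ge_min !lexx orbT.
  apply: H => //.
    by rewrite -(subrK p.1 q.1); apply: le_trans (cabsD _ _) _; lra.
  by rewrite -(subrK p.2 q.2); apply: le_trans (cabsD _ _) _; lra.
by apply: differentiable_pair; apply: one => //; apply: geometric_conj.
Qed.

End Differentiability.

(** * Continuity of the coefficients, and genericity *)

Section Spaces.
Variable R : realType.
Local Notation C := R[i].
Local Notation C2 := (R[i]^o * R[i]^o)%type.
Implicit Types (F G H : ser C) (z w : C) (r s B a : R).

Lemma complex_cvg (T : Type) (N : set_system T) {FN : Filter N} (f : T -> C) z :
  (forall e : R, 0 < e -> \forall t \near N, cabs (z - f t) < e) ->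
  (f t : R[i]^o) @[t --> N] --> (z : R[i]^o).
Proof.
move=> H; apply/cvgrPdist_lt => e /pos_complex[d d0 ->].
by apply: filterS (H d d0) => t; rewrite [X in _ -> X < _]cabsE ltcR.
Qed.

Lemma complex_cvgP (T : Type) (N : set_system T) {FN : Filter N} (f : T -> C) z (e : R) :
  (f t : R[i]^o) @[t --> N] --> (z : R[i]^o) -> 0 < e -> \forall t \near N, cabs (z - f t) < e.
Proof.
move=> /cvgrPdist_lt + e0 => /(_ (e%:C)%C); rewrite ltcR => /(_ e0).
by apply: filterS => t; rewrite [X in X < _ -> _]cabsE ltcR.
Qed.

Lemma lambda_continuous : continuous (fun s : R => lambda s : R[i]^o).
Proof.
move=> s; apply: complex_cvg => e e0.
have e2 : 0 < e / 2 by rewrite divr_gt0.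
have cc : {for s, continuous (fun s : R => cos (2 * pi * s))}.
  by apply: continuous_comp; [apply: cvgMr; exact: cvg_id | exact: continuous_cos].
have cs : {for s, continuous (fun s : R => sin (2 * pi * s))}.
  by apply: continuous_comp; [apply: cvgMr; exact: cvg_id | exact: continuous_sin].
move/cvgrPdist_lt: cc => /(_ _ e2) n1; move/cvgrPdist_lt: cs => /(_ _ e2) n2.
near=> t.
rewrite (_ : lambda s - lambda t = ((cos (2 * pi * s) - cos (2 * pi * t))%:C)%C
    + 'i%C * ((sin (2 * pi * s) - sin (2 * pi * t))%:C)%C); last first.
  by apply/eqP; rewrite eq_complex /=; apply/andP; split; apply/eqP; ring.
apply: le_lt_trans (cabsD _ _) _; rewrite cabsM !cabs_real.
have -> : cabs ('i%C : C) = 1 by rewrite /cabs normc_def /= expr0n expr1n add0r sqrtr1.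
rewrite mul1r [e]splitr; apply: ltrD; near: t; [exact: n1 | exact: n2].
Unshelve. all: by end_near. Qed.

Lemma graded_continuous (W : topologicalType) :
  graded_class (fun (_ : nat) (a : W -> C) => continuous (a : W -> R[i]^o)).
Proof.
split.
- by move=> n x; exact: cvg_cst.
- by move=> c x; exact: cvg_cst.
- by move=> n a b ca cb x; apply: cvgD; [exact: ca | exact: cb].
- by move=> m n a b ca cb x; apply: cvgM; [exact: ca | exact: cb].
- move=> n a ca x; apply: complex_cvg => e e0.
  apply: filterS (complex_cvgP (ca x) e0) => y.
  by rewrite -rmorphB cabsJ.
Qed.

(** The compact sets on which Cauchy's inequality is applied. *)
Definition torus r : set C2 :=
  (fun p : R * R => ((r%:C)%C * lambda p.1, (r%:C)%C * lambda p.2) : C2) @`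
    (`[0, 1]%classic `*` `[0, 1]%classic).

Lemma torus_compactly_in r D : 0 <= r < D -> compactly_in (polydisc D) (torus r).
Proof.
move=> /andP[r0 rD]; split.
  move=> _ [[s t] _ <-] /=; rewrite /polydisc /= !cabsM !cabs_lambda cabs_real mulr1 ger0_norm //.
apply: continuous_compact; last by apply: compact_setX; exact: segment_compact.
apply: continuous_subspaceT => p.
have cf (f : R * R -> R) : {for p, continuous f} ->
    {for p, continuous (fun p => (r%:C)%C * lambda (f p) : R[i]^o)}.
  move=> cf; apply: cvgMr; apply: (@continuous_comp _ _ _ f (fun s : R => lambda s : R[i]^o)) => //.
  exact: lambda_continuous.
apply: (@cvg_pair _ _ _ _ (nbhs ((r%:C)%C * lambda p.1 : R[i]^o))
  (nbhs ((r%:C)%C * lambda p.2 : R[i]^o))).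
  by apply: cf; exact: cvg_fst.
by apply: cf; exact: cvg_snd.
Qed.

Lemma geometric_le F B a B' a' : geometric F B a -> 0 <= a <= a' -> 0 <= B <= B' ->
  geometric F B' a'.
Proof.
move=> gF /andP[a0 aa] /andP[B0 BB] j k; apply: le_trans (gF j k) _.
by apply: ler_pM; rewrite ?exprn_ge0 // lerXn2r ?nnegrE // (le_trans a0).
Qed.

Lemma geometricD F G B B' a : geometric F B a -> geometric G B' a ->
  geometric (F + G) (B + B') a.
Proof.
move=> gF gG j k; rewrite ser_addE mulrDl; apply: le_trans (cabsD _ _) _.
by apply: lerD; [exact: gF | exact: gG].
Qed.

(** Holomorphy of the complex extension follows from the convergence of the
    series, so that membership is a matter of growth of the coefficients. *)
Lemma FspaceP omega D F : 0 < D -> Fspace omega D F <->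
  multiplier (lambda omega) F /\
  forall r, 0 < r < D -> exists2 B, 0 <= B & geometric F B r^-1.
Proof.
move=> D0; split=> [[mF cF _]|[mF gF]].
  split=> // r /andP[r0 rD].
  have cr : cabs (r%:C)%C = r by rewrite cabs_real gtr0_norm.
  have := cF ((r%:C)%C, (r%:C)%C); rewrite /polydisc /= cr => /(_ (Logic.conj rD rD)).
  move=> /(term_bound (ltW r0) (ltW r0)) [K K0 HK].
  exists K => // j k; rewrite exprVn ler_pdivlMr ?exprn_gt0 // exprD mulrA.
  exact: HK.
have between (p : C2) : polydisc D p -> exists r r' : R,
    [/\ 0 < r < D, 0 < r' < r & polydisc r' p].
  move=> [p1 p2]; pose m := Num.max (cabs p.1) (cabs p.2).
  have mD : m < D by rewrite /m gt_max p1 p2.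
  have [m1 m2] : cabs p.1 <= m /\ cabs p.2 <= m by rewrite /m !le_max !lexx orbT.
  have m0 : 0 <= m by apply: le_trans m1; exact: cabs_ge0.
  exists ((m + 3 * D) / 4), ((m + D) / 2); split; [lra|lra|].
  by split; lra.
split=> // p /between[r [r' [rD /andP[r'0 r'r] pr']]]; have [B B0 gB] := gF r rD;
  have r0 : 0 < r by case/andP: rD.
- case: pr' => p1 p2; apply: (abs_convergent_geometric gB); rewrite ?invr_ge0 ?cabs_ge0 ?(ltW r0) //;
    rewrite mulrC ltr_pdivrMr // mul1r; [exact: lt_trans p1 _|exact: lt_trans p2 _].
- by apply: (complex_ext_differentiable gB _ B0 _ pr'); rewrite ?invr_ge0 ?(ltW r0) // mulrC ltr_pdivrMr // mul1r.
Qed.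

Section CoefficientContinuity.
Variables (omega D : R) (D0 : 0 < D) (X : set (fps C)).
Hypothesis XF : X `<=` Fspace omega D.
Local Notation W := (compact_open_space D X).

Let valW (x : W) : ser C := \val (x : X).

(** Cauchy's inequality on the torus of radius D / 2. *)
Lemma coefficient_continuous j k : continuous (fun x : W => valW x j k : R[i]^o).
Proof.
move=> F0; apply: (@complex_cvg _ (nbhs F0) (nbhs_filter F0)) => e e0.
have r0 : 0 < D / 2 by rewrite divr_gt0.
pose e1 := e * (D / 2) ^+ (j + k) / 2.
have re0 : 0 < e * (D / 2) ^+ (j + k) by rewrite mulr_gt0 // exprn_gt0.
have e10 : 0 < e1 by rewrite divr_gt0.
pose E := [set q : C2 * C2 | ball q.1 (e1%:C)%C q.2].
have entE : entourage E by rewrite -entourage_ballE; exists (e1%:C)%C => /=; rewrite ?ltcR.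
have rD : 0 <= D / 2 < D by lra.
have := @fam_nbhs _ _ (compactly_in (polydisc D)) (torus (D / 2)) E
  (complex_ext (valW F0)) entE (torus_compactly_in rD).
move=> N0; have N1 := @initial_continuous _ _ (fun x : X => (complex_ext (val x) :
  {family compactly_in (polydisc D), C2 -> C2})) F0 _ N0.
apply: (@filterS _ (nbhs F0) (nbhs_filter F0) _ _ _ N1) => F /= HF.
have geo (G : W) : exists2 B, 0 <= B & geometric (valW G) B (3 / 4 * D)^-1.
  have /(FspaceP _ _ D0)[_] := XF (set_valP (G : X)); apply; lra.
have [B B0 gB] := geo F0; have [B' B'0 gB'] := geo F.
have a0 : 0 <= (3 / 4 * D)^-1 by rewrite invr_ge0; lra.
have aD : (3 / 4 * D)^-1 * (D / 2) < 1 by rewrite mulrC ltr_pdivrMr; lra.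
have := @cauchy_coefficient R (valW F0) (valW F) B _ B' _ (D / 2) e1 j k gB gB' a0 a0 B0 B'0
  (ltW r0) aD aD.
rewrite -ler_pdivlMr ?exprn_gt0 // => H; apply: (le_lt_trans (H _)).
  move=> s t s01 t01.
  have [|] := HF (((D / 2)%:C)%C * lambda s, ((D / 2)%:C)%C * lambda t).
    by exists (s, t) => //; split; rewrite /= in_itv.
  by rewrite -ball_normE /= => + _; rewrite [X in X < _]cabsE ltcR => /ltW.
rewrite /e1 ltr_pdivrMr ?exprn_gt0 // ltr_pdivrMr // ltr_pMr //; lra.
Qed.

Lemma canonical_continuous j k :
  continuous (fun x : W => canonical (lambda omega) (valW x) j k : R[i]^o).
Proof.
have wF : weighted (fun _ (a : W -> C) => continuous (a : W -> R[i]^o)) 1 valW.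
  move=> a b; split; last by move=> _; exact: coefficient_continuous.
  move=> ab x; have [mF _ _] := XF (set_valP (x : X)).
  exact: (multiplier_ord mF).
have [wh _] := weighted_nf (@graded_continuous W) true (lambda omega) wF.
have wc : weighted (fun _ (a : W -> C) => continuous (a : W -> R[i]^o)) 2
    (fun x => canonical (lambda omega) (valW x)).
  by apply: (weightedM (@graded_continuous W) wh); apply: (weighted_conj (@graded_continuous W)).
have [jk|jk] := ltnP (j + k) 2; last exact: (wc j k).2.
rewrite (_ : (fun x => _) = cst 0); first exact: cst_continuous.
by apply/funext => x; rewrite (wc j k).1.
Qed.

Definition unbounded_canonical : set W := \bigcap_(M in [set: nat])
  \bigcup_(j in [set: nat]) \bigcup_(k in [set: nat])
  [set x : W | M%:R ^+ (j + k).+1 < cabs (canonical (lambda omega) (valW x) j k)].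

Lemma unbounded_canonicalP (x : W) : unbounded_canonical x <->
  ~ bounded (canonical (lambda omega) (valW x)).
Proof.
split=> [SF /bounded_geometric[M HM]|nb M _].
  have [j _ [k _ /=]] := SF M I.
  by rewrite ltNge HM.
apply: contrapT => H; apply: nb; apply/bounded_geometric; exists M => j k.
rewrite leNgt; apply/negP => lt; apply: H.
by exists j => //; exists k.
Qed.

Lemma unbounded_canonical_Gdelta : Gdelta unbounded_canonical.
Proof.
eexists; last reflexivity.
move=> M; apply: bigcup_open => j _; apply: bigcup_open => k _.
rewrite openE => x0 /= HF; rewrite /interior /=.
have e0 : 0 < cabs (canonical (lambda omega) (valW x0) j k) - M%:R ^+ (j + k).+1.
  by rewrite subr_gt0.
apply: filterS (complex_cvgP (@canonical_continuous j k x0) e0) => x1 /=.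
set x := canonical _ _ _ _; set y := canonical _ _ _ _ => xy.
have := cabsD (x - y) y; rewrite subrK => H.
by move: H xy; lra.
Qed.

End CoefficientContinuity.

(** The bound on the degree is 2 n: a map whose coefficients of degree n have
    degree at most n in s is [weighted] in degree 1 as soon as its linear part is
    constant, since n <= 2 (n - 1) for n >= 2. *)
Lemma graded_polynomial : graded_class (fun n (f : R -> C) => exists p : {poly C},
     (size p <= 2 * n + 1)%N /\ forall s, f s = p.[(s%:C)%C]).
Proof.
split.
- by move=> n; exists 0; rewrite size_poly0; split=> // s; rewrite horner0.
- move=> c; exists c%:P; split; first by apply: leq_trans (size_polyC_leq1 _) _; lia.
  by move=> s; rewrite hornerC.
- move=> n f g [p [sp fp]] [q [sq gq]]; exists (p + q); split.
    by apply: leq_trans (size_polyD _ _) _; rewrite geq_max sp sq.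
  by move=> s; rewrite hornerD fp gq.
- move=> m n f g [p [sp fp]] [q [sq gq]]; exists (p * q); split.
    by apply: leq_trans (size_polyMleq _ _) _; lia.
  by move=> s; rewrite hornerM fp gq.
- move=> n f [p [sp fp]]; exists (map_poly (fun x : C => (x^*)%C) p); split.
    by apply: leq_trans (size_poly _ _) _.
  move=> s; rewrite fp -[in RHS](_ : ((s%:C)%C^*)%C = (s%:C)%C).
    by rewrite horner_map.
  by apply/eqP; rewrite eq_complex /= oppr0 !eqxx.
Qed.

Lemma polynomial_modulus (h : R -> ser C) :
  weighted (fun n (f : R -> C) => exists p : {poly C},
     (size p <= 2 * n + 1)%N /\ forall s, f s = p.[(s%:C)%C]) 1 h ->
  exists c : nat * nat -> {poly C}, (forall t, (size (c t) <= 2 * (t.1 + t.2) + 1)%N) /\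
    forall s t, (h s * conj (h s)) t.1 t.2 = (c t).[(s%:C)%C].
Proof.
move=> wh; have gP := graded_polynomial.
have wc := weightedM gP wh (weighted_conj gP wh).
have /choice[c Hc] : forall t : nat * nat, exists p : {poly C}, (size p <= 2 * (t.1 + t.2) + 1)%N /\
    forall s, (h s * conj (h s)) t.1 t.2 = p.[(s%:C)%C].
  move=> t; have [jk|jk] := ltnP (t.1 + t.2) (1 + 1).
    exists 0; rewrite size_poly0; split=> // s; rewrite horner0.
    exact: (wc t.1 t.2).1.
  by have [p [sp E]] := (wc t.1 t.2).2 jk; exists p; split=> //; lia.
by exists c; split=> [t|s t]; case: (Hc t).
Qed.

Section Deformation.
Variables (omega D : R) (D0 : 0 < D).
Local Notation l := (lambda omega).

(** F0(z) + (F1 - F0)(s z): a coefficient of degree n is multiplied by s^n, which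
    tames any positive radius of convergence, and a coefficient common to F0 and
    F1 does not move. *)
Definition deform F0 F1 s : ser C :=
  fun j k => F0 j k + ((s ^+ (j + k))%:C)%C * (F1 j k - F0 j k).

Lemma deform1 F0 F1 : deform F0 F1 1 = F1.
Proof. by apply: serP => j k; rewrite /deform expr1n mul1r addrC subrK. Qed.

Lemma deform_conj F0 F1 s : conj (deform F0 F1 s) = deform (conj F0) (conj F1) s.
Proof.
apply: serP => j k; rewrite /deform !conjE rmorphD rmorphM rmorphB addnC; congr (_ + _ * _).
by apply/eqP; rewrite eq_complex /= oppr0 !eqxx.
Qed.

Lemma deform_multiplier F0 F1 s : multiplier l F0 -> multiplier l F1 -> multiplier l (deform F0 F1 s).
Proof. by move=> [a b c] [a' b' c']; split; rewrite /deform ?a ?b ?c ?a' ?b' ?c' subrr mulr0 addr0. Qed.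

Lemma deform_odd F0 F1 s : odd_map F0 -> odd_map F1 -> odd_map (deform F0 F1 s).
Proof. by move=> o0 o1 j k; rewrite /deform mulrDr o0 mulrCA mulrBr o0 o1; ring. Qed.

Lemma deform_jet F0 F1 s N J : same_jet N F0 J -> same_jet N F1 J -> same_jet N (deform F0 F1 s) J.
Proof. by move=> j0 j1 j k jk; rewrite /deform j0 // j1 // subrr mulr0 addr0. Qed.

Let inner F := forall r, 0 < r < D -> exists2 B, 0 <= B & geometric F B r^-1.

Lemma inner_conj F : inner F -> inner (conj F).
Proof. by move=> H r /H[B B0 gB]; exists B => //; apply: geometric_conj. Qed.

Lemma geometric_difference F0 F1 : inner F0 -> bounded F1 ->
  exists B a, [/\ 0 <= B, 0 < a & geometric (F1 - F0) B a].
Proof.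
move=> i0 /bounded_geometric[M HM]; have rD : 0 < D / 2 < D by move: D0; lra.
have [B B0 gB] := i0 _ rD; pose a := Num.max M%:R (D / 2)^-1.
have [aM aD] : M%:R <= a /\ (D / 2)^-1 <= a by rewrite /a !le_max !lexx orbT.
have d0 : 0 < (D / 2)^-1 by rewrite invr_gt0; lra.
exists (M%:R + B), a; split; [exact: addr_ge0 | exact: lt_le_trans aD |].
apply: geometricD.
  by apply: (@geometric_le _ M%:R M%:R) => [j k||]; rewrite ?ler0n ?lexx //= -exprS.
apply: (@geometric_le _ B (D / 2)^-1) => [j k||]; rewrite ?B0 ?lexx ?aD ?(ltW d0) //.
by rewrite [X in cabs X]/(- F0 j k) cabsN.
Qed.

Section Size.
Variables (F0 F1 : ser C) (B a : R).
Hypotheses (i0 : inner F0) (a0 : 0 < a) (B0 : 0 <= B) (gH : geometric (F1 - F0) B a).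
Hypothesis H0 : F1 0%N 0%N = F0 0%N 0%N.
Let dl := (2 * a * D)^-1.

Let dl0 : 0 < dl. Proof. by rewrite invr_gt0 !mulr_gt0. Qed.

Lemma deform_geometric s : 0 <= s <= dl ->
  geometric (deform F0 F1 s - F0) (B * s / dl) (2 * D)^-1.
Proof.
move=> /andP[s0 sd] j k.
have -> : (deform F0 F1 s - F0) j k = ((s ^+ (j + k))%:C)%C * (F1 - F0) j k.
  by rewrite !ser_subE /deform addrC addKr.
rewrite cabsM cabs_real ger0_norm ?exprn_ge0 //.
case E : (j + k)%N => [|n].
  have [-> ->] : j = 0%N /\ k = 0%N by split; lia.
  by rewrite !expr0 mul1r mulr1 ser_subE H0 subrr cabs0 divr_ge0 ?mulr_ge0 // ltW.
apply: (@le_trans _ _ (s ^+ n.+1 * (B * a ^+ n.+1))).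
  by rewrite ler_wpM2l ?exprn_ge0 // -E; exact: gH.
have -> : (2 * D)^-1 = dl * a by rewrite /dl; field; rewrite !gt_eqF.
rewrite (_ : B * s / dl * _ = s * dl ^+ n * (B * a ^+ n.+1)); last first.
  by rewrite exprMn [dl ^+ n.+1]exprS; field; rewrite gt_eqF.
rewrite ler_wpM2r ?mulr_ge0 ?exprn_ge0 ?(ltW a0) // exprS ler_wpM2l //.
by rewrite lerXn2r ?nnegrE // ltW.
Qed.

Lemma deform_inner s : 0 <= s <= dl -> inner (deform F0 F1 s).
Proof.
move=> sd r rD; have [B' B'0 gB'] := i0 rD; case/andP: rD => r0 rD; case/andP: (sd) => s0 _.
have b0 : 0 <= B * s / dl by rewrite divr_ge0 ?mulr_ge0 // ltW.
exists (B' + B * s / dl); first by rewrite addr_ge0.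
rewrite -[deform _ _ _](subrK F0) addrC; apply: geometricD => //.
apply: geometric_le (deform_geometric sd) _ _; rewrite ?b0 ?lexx //.
rewrite invr_ge0 mulr_ge0 ?(ltW D0) //= lef_pV2 ?posrE ?mulr_gt0 //; lra.
Qed.

Lemma deform_eval s z w : 0 <= s <= dl -> cabs z < D -> cabs w < D ->
  cabs (fps_eval (deform F0 F1 s) z w - fps_eval F0 z w) <= 16 * (B / dl) * s.
Proof.
move=> sd zD wD; pose m := Num.max (cabs z) (cabs w); pose r := (m + D) / 2.
have mD : m < D by rewrite /m gt_max zD wD.
have [m1 m2] : cabs z <= m /\ cabs w <= m by rewrite /m !le_max !lexx orbT.
have m0 : 0 <= m by apply: le_trans m1; exact: cabs_ge0.
have rD : 0 < r < D by rewrite /r; lra.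
have mr : r^-1 * m < 1 by rewrite mulrC ltr_pdivrMr ?mul1r /r; lra.
have r0 : 0 <= r^-1 by rewrite invr_ge0 /r; lra.
have [B' B'0 gB'] := i0 rD; have [B2 B20 gB2] := deform_inner sd rD.
have [c1 _] := eval_limit gB' r0 B'0 m1 m2 mr.
have [c2 _] := eval_limit gB2 r0 B20 m1 m2 mr.
have gd := deform_geometric sd.
have b0 : 0 <= B * s / dl by case/andP: sd => s0 _; rewrite divr_ge0 ?mulr_ge0 // ltW.
have D2 : 0 <= (2 * D)^-1 by rewrite invr_ge0 mulr_ge0 // ltW.
have half : (2 * D)^-1 * D = 1 / 2 by field; rewrite gt_eqF.
have Dh : (2 * D)^-1 * D < 1 by rewrite half; lra.
have [c3 /(_ 0%N)] := eval_limit gd D2 b0 (ltW zD) (ltW wD) Dh.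
have -> : fps_eval (deform F0 F1 s - F0) z w = fps_eval (deform F0 F1 s) z w - fps_eval F0 z w.
  have E : (fun n => psum (deform F0 F1 s - F0) z w n : R[i]^o)
      = (fun n => psum (deform F0 F1 s) z w n - psum F0 z w n).
    apply/funext => n; rewrite /psum /dsum -sumrB; apply: eq_bigr => j _.
    by rewrite -sumrB; apply: eq_bigr => k _; rewrite ser_subE !mulrBl.
  have c4 := cvgB c2 c1; rewrite E in c3.
  exact: (cvg_unique (@norm_hausdorff _ R[i]^o) c3 (c4 _)).
rewrite /psum /dsum big_ord0 subr0 expr0 mulr1 half => H; apply: le_trans H _.
by rewrite le_eqVlt; apply/orP; left; apply/eqP; field; rewrite gt_eqF.
Qed.

End Size.

(** For small s the radius of convergence of (F1 - F0)(s z) is at least 2 D. *)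
Lemma deform_small F0 F1 : Fspace omega D F0 -> multiplier l F1 -> bounded F1 ->
  exists d K : R, [/\ 0 < d, 0 <= K & forall s, 0 <= s <= d ->
    Fspace omega D (deform F0 F1 s) /\ forall p, polydisc D p ->
      cabs ((complex_ext (deform F0 F1 s) p).1 - (complex_ext F0 p).1) <= K * s /\
      cabs ((complex_ext (deform F0 F1 s) p).2 - (complex_ext F0 p).2) <= K * s].
Proof.
move=> S0 m1 b1; have /(FspaceP _ _ D0)[m0 i0] := S0.
have [B [a [B0 a0 gH]]] := geometric_difference i0 b1.
have gHc : geometric (conj F1 - conj F0) B a by rewrite -conjB; apply: geometric_conj.
have [z0 z1] : F0 0%N 0%N = 0 /\ F1 0%N 0%N = 0 by case: m0; case: m1.
have E : F1 0%N 0%N = F0 0%N 0%N by rewrite z0 z1.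
have Ec : conj F1 0%N 0%N = conj F0 0%N 0%N by rewrite !conjE E.
exists (2 * a * D)^-1, (16 * (B / (2 * a * D)^-1)); split.
- by rewrite invr_gt0 !mulr_gt0.
- by rewrite mulr_ge0 // divr_ge0 // invr_ge0 !mulr_ge0 // ltW.
move=> s sd; split.
  apply/(FspaceP _ _ D0); split; first exact: deform_multiplier.
  exact: deform_inner B0 gH E _ sd.
move=> p [p1 p2]; split; first exact: deform_eval.
by rewrite /complex_ext /= -[fps_conj (deform _ _ _)]/(conj _) deform_conj;
  apply: deform_eval => //; exact: inner_conj.
Qed.

Lemma deform_cvg F0 F1 : Fspace omega D F0 -> multiplier l F1 -> bounded F1 ->
  (complex_ext (deform F0 F1 s) : {family compactly_in (polydisc D), C2 -> C2})
    @[s --> (0 : R)^'+] --> (complex_ext F0 : {family compactly_in (polydisc D), C2 -> C2}).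
Proof.
move=> S0 m1 b1; have [d [K [d0 K0 H]]] := deform_small S0 m1 b1.
apply/fam_cvgP => Q [QD _] P /uniform_nbhs[E [entE EP]].
move: entE; rewrite -entourage_ballE => -[_ /pos_complex[e e0 ->] eE].
have K1 : 0 < K + 1 by lra.
suff : \forall s \near (0 : R)^'+, P (complex_ext (deform F0 F1 s)) by [].
near=> s; apply: EP => p /QD pD; apply: eE => /=.
have s0 : 0 < s by near: s; exact: nbhs_right_gt.
have sd : s < d by near: s; exact: nbhs_right_lt.
have se : s < e / (K + 1) by near: s; apply: nbhs_right_lt; rewrite divr_gt0.
have [|_ /(_ p pD) [H1 H2]] := H s; first by rewrite (ltW s0) (ltW sd).
have Ke : K * s < e by move: se; rewrite ltr_pdivlMr //; nra.
by split; rewrite -ball_normE /= distrC [X in X < _]cabsE ltcR; apply: le_lt_trans Ke.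
Unshelve. all: by end_near. Qed.

Hypothesis irr : irrational omega.

Lemma deform_weighted F0 F1 : multiplier l F0 -> multiplier l F1 ->
  weighted (fun n (f : R -> C) => exists p : {poly C},
     (size p <= 2 * n + 1)%N /\ forall s, f s = p.[(s%:C)%C]) 1 (deform F0 F1).
Proof.
move=> [a b c] [a' b' c'] j k; split.
  by case: j k => [|j] [|k] //= _ s; rewrite /deform a a' subrr mulr0 addr0.
move=> jk; have [jk1|jk2] := eqVneq (j + k)%N 1%N.
  exists (F0 j k)%:P; split; first by apply: leq_trans (size_polyC_leq1 _) _; lia.
  move=> s; rewrite hornerC /deform.
  by case: j k jk1 {jk} => [|[|j]] [|[|k]] //= _; rewrite ?b ?b' ?c ?c' subrr mulr0 addr0.
exists ((F0 j k)%:P + (F1 j k - F0 j k) *: 'X^(j + k)); split.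
  apply: leq_trans (size_polyD _ _) _; rewrite geq_max; apply/andP; split.
    by apply: leq_trans (size_polyC_leq1 _) _; lia.
  apply: leq_trans (size_scale_leq _ _) _; rewrite size_polyXn; lia.
by move=> s; rewrite !hornerE /deform -rmorphXn mulrC.
Qed.

(** The deformation stays in X for small s > 0. If the canonical integral of F_s converged for all s in an
    interval, the polynomial growth of its coefficients in s would propagate
    the convergence to s = 1. *)
Lemma generic_divergence (X : set (fps C)) : X `<=` Fodd omega D ->
  (forall F0, X F0 -> exists F1 : ser C,
     [/\ multiplier l F1, bounded F1, ~ bounded (canonical l F1) &
       \forall s \near (0 : R)^'+, X (deform F0 F1 s)]) ->
  generic D X (@all_normalizations_divergent R).
Proof.
move=> XF H; have XS : X `<=` Fspace omega D by move=> F /XF[].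
exists (@unbounded_canonical omega D X); split.
- exact: unbounded_canonical_Gdelta.
- move=> O [x0 Ox0] oO; have [F1 [m1 b1 nb1 X1]] := H _ (set_valP (x0 : X)).
  have S0 := XS _ (set_valP (x0 : X)).
  have [Q oQ QO] := oO; have Qx0 : Q (complex_ext (val (x0 : X))) by move: Ox0; rewrite -QO.
  have := deform_cvg S0 m1 b1 (open_nbhs_nbhs (Logic.conj oQ Qx0)) => nQ.
  have [e /= e0 He] : exists2 e : R, 0 < e & forall s, 0 < s < e ->
      X (deform (val (x0 : X)) F1 s) /\ Q (complex_ext (deform (val (x0 : X)) F1 s)).
    have /nbhs_ballP[e /= e0 He] : \forall s \near (0 : R), 0 < s ->
        X (deform (val (x0 : X)) F1 s) /\ Q (complex_ext (deform (val (x0 : X)) F1 s)).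
      apply: (@filterS2 _ (nbhs (0 : R)) _ _ _ _ _ X1 nQ) => s Xs Qs s0.
      by split; [exact: Xs | exact: Qs].
    exists e => // s /andP[s0 se]; have := He s.
    by rewrite -ball_normE /= sub0r normrN gtr0_norm // => /(_ se s0).
  apply: contrapT => noS; apply: nb1.
  have m0 : multiplier l (val (x0 : X)) by case: S0.
  have [wh _] := weighted_nf graded_polynomial true l (deform_weighted m0 m1).
  have [c [sc Ec]] := polynomial_modulus wh.
  have e23 : e / 3 < e / 2 by lra.
  have [|M HM] := extrapolation sc e23 _ 1.
    move=> s se; have [|Xs Qs] := He s; first by lra.
    pose xs : compact_open_space D X := SigSub (mem_set Xs).
    have : ~ unbounded_canonical omega xs.
      by move=> Sxs; apply: noS; exists xs; split=> //; rewrite -QO.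
    move=> /unbounded_canonicalP/contrapT/bounded_geometric[M HM].
    by exists M => t; rewrite -Ec; exact: (HM t.1 t.2).
  apply/bounded_geometric; exists M => j k.
  by have := HM (j, k); rewrite -Ec deform1.
- move=> x /unbounded_canonicalP nb; have [S o] := XF _ (set_valP x).
  have [m _ _] := S.
  exact: (canonical_obstruction (lambda_unit omega) (fun n => lambda_irrational irr) m o nb).
Qed.

Lemma deform_Fodd F0 F1 : Fodd omega D F0 -> multiplier l F1 -> odd_map F1 -> bounded F1 ->
  \forall s \near (0 : R)^'+, Fodd omega D (deform F0 F1 s).
Proof.
move=> [S0 o0] m1 o1 b1; have [d [K [d0 _ H]]] := deform_small S0 m1 b1.
near=> s; split; last exact: deform_odd.
have s0 : 0 < s by near: s; exact: nbhs_right_gt.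
have sd : s < d by near: s; exact: nbhs_right_lt.
by have [|] := H s; rewrite ?(ltW s0) ?(ltW sd).
Unshelve. all: by end_near. Qed.

(** No lower bound on the radius of convergence is asked for: the deformation
    works with any positive one. *)
Definition divergent_model F :=
  [/\ multiplier l F, odd_map F, bounded F & ~ bounded (canonical l F)].

Lemma generic_odd F1 : divergent_model F1 ->
  generic D (Fodd omega D) (@all_normalizations_divergent R).
Proof.
move=> [m1 o1 b1 nb]; apply: generic_divergence => // F0 S0.
by exists F1; split=> //; exact: deform_Fodd.
Qed.

Lemma generic_jet N J F1 : divergent_model F1 -> same_jet N F1 J ->
  generic D (FoddJ omega D N J) (@all_normalizations_divergent R).
Proof.
move=> [m1 o1 b1 nb] j1; apply: generic_divergence => [F []//|F0 [S0 j0]].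
exists F1; split=> //; near=> s; split; last exact: deform_jet.
by near: s; exact: deform_Fodd.
Unshelve. all: by end_near. Qed.

(** Being conservative is an infinite system of polynomial equations in s. One of
    them fails at s = 0, hence also for small s. *)
Lemma generic_nonconservative F1 : divergent_model F1 ->
  generic D (Fodd omega D `&` [set F | ~ formally_conservative F])
    (@all_normalizations_divergent R).
Proof.
move=> [m1 o1 b1 nb]; apply: generic_divergence => [F []//|F0 [S0 /= nc]].
have irr' n := @lambda_irrational _ omega n irr; have lu := lambda_unit omega.
have m0 : multiplier l F0 by case: S0 => -[].
exists F1; split=> //.
have [j [k [p [p0 Hp]]]] : exists j k (p : {poly C}), p.[0] != 0 /\
    forall s, (radial_factor l (deform F0 F1 s) - serZ * serW) j k = p.[(s%:C)%C].
  have [_ wN] := weighted_nf graded_polynomial true l (deform_weighted m0 m1).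
  have [c [_ Hc]] := polynomial_modulus wN.
  have E0 : deform F0 F1 0 = F0 :> ser C.
    apply: serP => j k; rewrite /deform; case jk : (j + k)%N => [|n].
      have [-> ->] : j = 0%N /\ k = 0%N by split; lia.
      by case: m0 => -> _ _; case: m1 => -> _ _; rewrite subrr mulr0 addr0.
    by rewrite expr0n mul0r addr0.
  apply: contrapT => H; apply: nc; apply/(formally_conservativeP lu irr' m0).
  apply/eqP; rewrite -subr_eq0; apply/eqP; apply: serP => j k.
  apply: contrapT => njk; apply: H; exists j, k.
  have Hp s : radial_factor l (deform F0 F1 s) j k = (c (j, k)).[(s%:C)%C] := Hc s (j, k).
  set p := c (j, k) in Hp.
  exists (p - ((serZ * serW : ser C) j k)%:P); split.
    by rewrite !hornerE -[0 : C]/((0%:C)%C) -Hp E0 -ser_subE; apply/eqP.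
  by move=> s; rewrite ser_subE !hornerE Hp.
have q0 : 0 < (sqmod p).[0] by rewrite sqmodE exprn_gt0 // lt_def cabs_ge0 cabs_eq0 p0.
have nq : \forall s \near (0 : R)^'+, 0 < (sqmod p).[s].
  suff nq0 : nbhs (0 : R) [set s | 0 < (sqmod p).[s]].
    by apply: filterS nq0 => s ? _.
  have q1 : nbhs (sqmod p).[0] [set y : R | 0 < y].
    by apply: open_nbhs_nbhs; split; [exact: open_gt | exact: q0].
  exact: (@continuous_horner _ (sqmod p) 0 _ q1).
near=> s; split; first by near: s; exact: deform_Fodd.
have ms : multiplier l (deform F0 F1 s) by exact: deform_multiplier.
have : 0 < (sqmod p).[s] by near: s.
move=> /= + /(formally_conservativeP lu irr' ms) E.
by rewrite sqmodE -Hp E subrr cabs0 expr0n ltxx.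
Unshelve. all: by end_near. Qed.

End Deformation.
End Spaces.

(** * A divergent model under an arithmetic condition *)

Section SmallDivisors.
Variable R : realType.
Local Notation C := R[i].
Implicit Types (F G h J : ser C).

Lemma comp_first_change (c : C) (f u u' : ser C) n : (0 < n)%N -> multiplier c f -> ord 1 u ->
  ord n (u' - u) -> forall j k, (j + k = n)%N ->
  comp f u' j k - comp f u j k = c * (u' - u) j k.
Proof.
move=> n0 [_ f10 f01] ou od j k jk.
have od' : ord n (conj (u' - u)) by apply: ord_conj.
have := subst_expand f n0 ou (ord_conj ou) od od' => /(_ j k).
rewrite !ser_subE !ser_addE !serCM f10 f01 mul0r addr0 -!compE => /(_ _) E.
have := E; rewrite jk ltnSn => /(_ isT) /eqP.
have -> : u + (u' - u) = u' by rewrite addrC subrK.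
have -> : conj u + conj (u' - u) = conj u' by rewrite conjB addrC subrK.
by rewrite -compE opprD addrA subr_eq0 => /eqP.
Qed.

Section Perturbation.
Variable l : C.
Hypothesis l_unit : l * (l^*)%C = 1.
Hypothesis l_irr : forall n, (0 < n)%N -> l ^+ n != 1.

(** A change of F at order n changes the solution of the linearized conjugacy
    equation by the inverse of the small divisor. *)
Lemma canonical_monomial F n : multiplier l F -> (2 <= n)%N ->
  canonical l (F + mono n 0) n 1 - canonical l F n 1 = - (l ^+ n - l)^-1.
Proof.
move=> mF n2; set F' := F + mono n 0.
have dF : F' - F = mono n 0 by rewrite /F' addrC addKr.
have oE : ord n (F' - F) by rewrite dF; apply: ord_le (@ord_mono _ n 0%N); rewrite addn0.
have mF' : multiplier l F'.
  apply/multiplierP; rewrite /F' addrAC; apply: ordD; first exact/multiplierP.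
  by apply: ord_le (@ord_mono _ n 0%N); rewrite addn0.
set h := nf_map true l F; set N := nf_form true l F.
set h' := nf_map true l F'; set N' := nf_form true l F'.
have [[mh mN] [mh' mN']] := (nf_multipliers l true F, nf_multipliers l true F').
have [oh oF] := (multiplier_ord mh, multiplier_ord mF).
have [od oN] : ord n (h' - h) /\ ord n (N' - N).
  rewrite -(subnKC n2) add2n in oE *; exact: nf_agree.
have n0 : (0 < n)%N by lia.
have E := nf_conjugacy l_unit l_irr true mF; have E' := nf_conjugacy l_unit l_irr true mF'.
rewrite -/h -/N in E; rewrite -/h' -/N' in E'.
have step j k : (j + k = n)%N ->
    (h' - h) j k * (l ^+ j * (l^*)%C ^+ k - l) = (N' - N) j k - mono n 0 j k.
  move=> jk; have A := comp_first_change n0 mh' oF oE jk.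
  have B := comp_first_change n0 mN' oh od jk.
  have A1 : comp (h' - h) F j k = (h' - h) j k * (l ^+ j * (l^*)%C ^+ k).
    case: mF => F0 F1 F2; rewrite compE.
    by apply: (subst_lead od oF (ord_conj oF) F1 F2) => //; rewrite conjE ?F1 ?F2 ?conjc0.
  have B1 : comp (N' - N) h j k = (N' - N) j k.
    case: mh => h0 h1 h2; rewrite compE -[RHS]mulr1.
    rewrite (subst_lead (l := 1) (m := 1) oN oh (ord_conj oh)) ?expr1n ?mulr1 //.
      by rewrite conjE h2 conjc0.
    by rewrite conjE h1 conjc1.
  rewrite (compB h' h F) ser_subE in A1; rewrite (compB N' N h) ser_subE in B1.
  rewrite mul1r dF in A; rewrite E in A1; rewrite E' in A.
  rewrite mulrBr -A1 -B1 [_ * l]mulrC -B -A; ring.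
have nres j k : j != k.+1 -> (N' - N) j k = 0.
  move=> jk; rewrite ser_subE; have -> : N' j k = 0 by exact: nf_form_resonant.
  by have -> : N j k = 0 by [exact: nf_form_resonant]; rewrite subrr.
have d1 : (h' - h) n 0%N = - (l ^+ n - l)^-1.
  have n1 : n != 1%N by lia.
  have := step n 0%N (addn0 n); rewrite nres // sub0r expr0 mulr1 /mono !eqxx /= => H.
  have nz : l ^+ n - l != 0 by have := divisor_neq0 l_unit l_irr n1; rewrite expr0 mulr1.
  by apply: (mulIf nz); rewrite mulNr mulVf.
have d2 : (h' - h) 1%N n.-1 = 0.
  have n1 : 1%N != n.-1.+1 by lia.
  have := step 1%N n.-1; rewrite add1n (ltn_predK n2) nres // /mono => /(_ erefl).
  have -> : (1%N == n) = false by lia.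
  rewrite subr0 => /eqP; rewrite mulf_eq0 => /orP[/eqP //|].
  by rewrite (negPf (divisor_neq0 l_unit l_irr n1)).
have oc : ord n.+2 (canonical l F' - canonical l F - ((h' - h) * serW + serZ * conj (h' - h))).
  have -> : canonical l F' - canonical l F - ((h' - h) * serW + serZ * conj (h' - h))
      = (h' - h) * (conj h' - serW) + (h - serZ) * conj (h' - h).
    by rewrite /canonical -/h -/h' conjB; ring.
  have ohZ (g : ser C) : multiplier 1 g -> ord 2 (g - serZ).
    by move=> /multiplierP; rewrite rmorph1 mul1r.
  rewrite -addn2; apply: ordD.
    by apply: ordM => //; rewrite -conjZ -conjB; apply: ord_conj; apply: ohZ.
  by rewrite addnC; apply: ordM; [exact: ohZ | exact: ord_conj].
move/ord_subP: oc => /(_ n 1%N); rewrite addn1 ltnSn => /(_ isT).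
rewrite ser_subE => ->; rewrite ser_addE [(h' - h) * _]mulrC /serW /serZ !monoM /=.
by rewrite (ltnW n2) subn0 subnn subn1 conjE d2 conjc0 addr0 d1.
Qed.

(** The two coefficients differ by the inverse of the small divisor, so that one
    of them is at least half as large. *)
Lemma large_coefficient F k : multiplier l F -> (0 < k)%N ->
  cabs (canonical l F k.*2.+1 1) < cabs (l ^+ k.*2 - 1)^-1 / 2 ->
  cabs (l ^+ k.*2 - 1)^-1 / 2 <= cabs (canonical l (F + mono k.*2.+1 0) k.*2.+1 1).
Proof.
move=> mF k0 small; have k2 : (2 <= k.*2.+1)%N by lia.
have := canonical_monomial mF k2; set x := canonical l F _ _ in small *; set y := canonical _ _ _ _.
move=> E; have : cabs (y - x) = cabs (l ^+ k.*2 - 1)^-1.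
  rewrite E cabsN exprS -[X in _ - X]mulr1 -mulrBr !cabsV cabsM.
  have -> : cabs l = 1.
    have : cabs l ^+ 2 = 1 by rewrite -(@cabs1 R) -l_unit cabsM cabsJ.
    by move/eqP; rewrite sqrf_eq1 => /orP[/eqP //|/eqP H]; have := cabs_ge0 l; rewrite H; lra.
  by rewrite mul1r.
have := cabsB y x; lra.
Qed.

Variables (N : nat) (J : ser C).
Hypotheses (mJ : multiplier l J) (N2 : (2 <= N)%N).

(** The model is J plus a series of monomials z^(2k+1), with k-th coefficient 1
    when the coefficient (2k+1, 1) of the canonical integral of the series built
    so far is too small, and 0 otherwise. *)
Definition digit F k := (N < k.*2.+1)%N && (cabs (canonical l F k.*2.+1 1) < cabs (l ^+ k.*2 - 1)^-1 / 2).

Fixpoint digit_stage m : ser C :=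
  if m is k.+1 then
    if digit (digit_stage k) k then digit_stage k + mono k.*2.+1 0 else digit_stage k
  else J.

Definition digit_series n : C := (odd n && digit (digit_stage n./2) n./2)%:R.
Definition digit_model : ser C := J + one_var digit_series.

Lemma digit_stageE m i j : digit_stage m i j =
  J i j + (if j == 0%N then (if (i./2 < m)%N then digit_series i else 0) else 0).
Proof.
elim: m => [|m IH] /=; first by rewrite if_same addr0.
case: ifPn => dm; last first.
  rewrite IH; congr (_ + _); case: eqP => // j0; rewrite ltnS [(i./2 <= m)%N]leq_eqVlt.
  case: eqP => [im|//] /=; rewrite im ltnn /digit_series.
  by rewrite im (negPf dm) andbF.
rewrite ser_addE IH /mono -addrA; congr (_ + _); case: eqP => j0; last by rewrite andbF addr0.
rewrite andbT ltnS [(i./2 <= m)%N]leq_eqVlt; case: (eqVneq i m.*2.+1) => [->|im].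
  by rewrite /= uphalf_double ltnn eqxx /digit_series /= odd_double uphalf_double dm add0r.
rewrite addr0; case: eqP => [i2|//] /=; rewrite i2 ltnn /digit_series.
suff -> : odd i = false by [].
apply/negbTE/negP => oi; move/eqP: im; apply; have := odd_double_half i; rewrite oi i2; lia.
Qed.

Lemma digit_model_stage m : ord m.*2.+1 (digit_model - digit_stage m).
Proof.
apply/ord_subP => i j ij; rewrite digit_stageE /digit_model ser_addE /one_var.
congr (_ + _); case: eqP => // j0; case: ltnP => // mi.
rewrite /digit_series; suff -> : odd i = false by [].
by apply/negbTE/negP => oi; have := odd_double_half i; rewrite oi; lia.
Qed.

Lemma digit_stage_multiplier m : multiplier l (digit_stage m).
Proof.
elim: m => //= m IH; case: ifP => // /andP[Nm _].
apply/multiplierP; rewrite addrAC; apply: ordD; first exact/multiplierP.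
by apply: ord_le (@ord_mono _ m.*2.+1 0%N); lia.
Qed.

Lemma digit_model_multiplier : multiplier l digit_model.
Proof.
apply/multiplierP; apply: ord_trans (_ : ord 2 (digit_stage 1 - _)).
  by apply: ord_le (@digit_model_stage 1).
exact/multiplierP/digit_stage_multiplier.
Qed.

Lemma digit_model_jet : same_jet N digit_model J.
Proof.
move=> i j ij; rewrite /digit_model ser_addE /one_var /digit_series /digit.
case: eqP => [j0|_]; last exact: addr0.
case: (boolP (odd i)) => [oi|_]; last exact: addr0.
suff -> : (N < i./2.*2.+1)%N = false by exact: addr0.
by have := odd_double_half i; rewrite oi; lia.
Qed.

Lemma digit_model_odd : odd_map J -> odd_map digit_model.
Proof.
move=> /odd_mapP oJ; apply/odd_mapP => i j ij; rewrite /digit_model ser_addE oJ // add0r /one_var.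
by case: eqP ij => [->|//]; rewrite addn0 /digit_series => /negPf ->.
Qed.

(** The digits after the k-th only change coefficients of higher degree. *)
Lemma digit_model_coefficient k : (N < k.*2.+1)%N ->
  cabs (l ^+ k.*2 - 1)^-1 / 2 <= cabs (canonical l digit_model k.*2.+1 1).
Proof.
move=> Nk; have -> : canonical l digit_model k.*2.+1 1 = canonical l (digit_stage k.+1) k.*2.+1 1.
  have FG : ord k.*2.+1.+2 (digit_model - digit_stage k.+1) by exact: (@digit_model_stage k.+1).
  have [oh _] := nf_agree true digit_model_multiplier (digit_stage_multiplier k.+1) FG.
  move: oh; rewrite /canonical; set h := nf_map _ _ _; set h' := nf_map _ _ _ => oh.
  have [mh mh'] : multiplier 1 h /\ multiplier 1 h' 
    by rewrite /h /h'; case: (nf_multipliers l true digit_model); case: (nf_multipliers l true (digit_stage k.+1)).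
  have o : ord (k.*2.+1.+2 + 1) (h * conj h - h' * conj h').
    rewrite (_ : _ - _ = (h - h') * conj h + h' * conj (h - h')); last by rewrite conjB; ring.
    apply: ordD; first by apply: ordM => //; apply: ord_conj; exact: (multiplier_ord mh).
    by rewrite addnC; apply: ordM; [exact: (multiplier_ord mh') | exact: ord_conj].
  by move/ord_subP: o; apply; lia.
rewrite /=; case: ifPn => [/andP[_ small]|]; last by rewrite /digit Nk /= -leNgt.
by apply: large_coefficient => //; [exact: digit_stage_multiplier | lia].
Qed.

End Perturbation.

Lemma polynomial_bounded (N : nat) J : (forall j k, (N < j + k)%N -> J j k = 0) -> bounded J.
Proof.
move=> JN; apply/bounded_geometric; set K := nrm 1 N J.
exists (Num.truncn K).+1 => j k; have K0 : 0 <= K by exact: nrm_ge0.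
have [jk|jk] := ltnP N (j + k); first by rewrite JN // cabs0 exprn_ge0.
have [jN kN] : (j <= N)%N /\ (k <= N)%N by lia.
have := nrm_coef J (ler01 : 0 <= (1 : R)) jN kN; rewrite expr1n mulr1 => /le_trans; apply.
apply: le_trans (ltW (truncnS_gt K)) _; rewrite exprS ler_peMr //.
by rewrite exprn_ege1 // ler1n.
Qed.

Lemma digit_model_bounded l (N : nat) J : bounded J -> bounded (digit_model l N J).
Proof.
move=> bJ; apply: boundedD => //; apply/bounded_geometric; exists 1%N => j k.
rewrite expr1n /one_var; case: ifP => _; last by rewrite cabs0.
by rewrite /digit_series; case: (_ && _); rewrite ?cabs1 ?cabs0.
Qed.

Lemma infinite_set_unbounded (A : set nat) K : infinite_set A -> exists2 k, A k & (K < k)%N.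
Proof.
move=> iA; apply: contrapT => H; apply: iA; apply: (sub_finite_set (B := `I_K.+1)).
  by move=> k Ak /=; rewrite ltnNge; apply/negP => kK; apply: H; exists k.
exact: finite_II.
Qed.

(** From k^k <= 4^k k!; the constant absorbs 2 * 4^k M^(2k+3) <= (8 (M+1)^5)^k. *)
Lemma factorial_dominates M k : (8 * M.+1 ^ 5 < k)%N -> (2 * M ^ (k.*2 + 3) < k`!)%N.
Proof.
move=> ck; rewrite ltnNge; apply/negP => H.
have k0 : (0 < k)%N by apply: leq_trans ck.
have : (k ^ k <= (8 * M.+1 ^ 5) ^ k)%N.
  apply: leq_trans (expn_le_fact k) _; apply: leq_trans (leq_mul (leqnn _) H) _.
  rewrite mulnA expnMn; apply: leq_mul.
    rewrite -[8%N]/(2 * 4)%N expnMn mulnC leq_mul2r orbC -{1}[2%N]expn1 leq_pexp2l //.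
  rewrite -expnM; apply: leq_trans (_ : M.+1 ^ (k.*2 + 3) <= _)%N.
    by rewrite leq_exp2r ?leqnSn // addn3.
  by rewrite leq_pexp2l //; lia.
by rewrite leqNgt ltn_exp2r ?ck.
Qed.

Lemma digit_model_divergent omega (N : nat) J : irrational omega -> (2 <= N)%N ->
  odd_polynomial omega N J ->
  infinite_set [set k : nat | (0 < k)%N /\
    (k`!)%:R <= `|lambda omega ^+ (2 * k) - 1|^-1] ->
  divergent_model omega (digit_model (lambda omega) N J).
Proof.
move=> irr N2 [mJ JN oJ] iA.
have irr' n := @lambda_irrational _ omega n irr; have lu := lambda_unit omega.
split; [exact: digit_model_multiplier | exact: digit_model_odd | |].
  exact/digit_model_bounded/(polynomial_bounded JN).
move=> /bounded_geometric[M HM].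
have [k [_ kA] Kk] := infinite_set_unbounded (N + 8 * M.+1 ^ 5) iA.
have Nk : (N < k.*2.+1)%N by lia.
have kA' : k`!%:R <= cabs (lambda omega ^+ k.*2 - 1)^-1.
  move: kA; rewrite mul2n (_ : k`!%:R = (k`!%:R%:C)%C); last by rewrite rmorph_nat.
  by rewrite cabsE -fmorphV lecR cabsV.
have := digit_model_coefficient lu irr' mJ N2 Nk.
have := HM k.*2.+1 1%N; set x := cabs (canonical _ _ _ _) => xM lx.
have : (k`!%:R : R) <= 2 * M%:R ^+ (k.*2 + 3).
  have -> : (k.*2 + 3 = (k.*2.+1 + 1).+1)%N by lia.
  lra.
rewrite -natrX -natrM ler_nat leqNgt factorial_dominates //; lia.
Qed.

End SmallDivisors.

(** * Series in z w with polynomial coefficients *)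

Section DiagonalPolynomials.
Variable R : realType.
Local Notation C := R[i].
Implicit Types (f g h : ser C) (p q b c : {poly C}) (x : R).

(** The series p(z w). *)
Definition dpoly p : ser C := (map_poly (@serC C) p).[serZ * serW].

Lemma dpolyM p q : dpoly (p * q) = dpoly p * dpoly q.
Proof. by rewrite /dpoly rmorphM hornerM. Qed.
Lemma dpolyD p q : dpoly (p + q) = dpoly p + dpoly q.
Proof. by rewrite /dpoly rmorphD hornerD. Qed.
Lemma dpolyB p q : dpoly (p - q) = dpoly p - dpoly q.
Proof. by rewrite /dpoly rmorphB hornerD hornerN. Qed.
Lemma dpolyC a : dpoly a%:P = serC a.
Proof. by rewrite /dpoly map_polyC hornerC. Qed.
Lemma dpolyX : dpoly 'X = serZ * serW.
Proof. by rewrite /dpoly map_polyX hornerX. Qed.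
Lemma dpoly_exp p n : dpoly (p ^+ n) = dpoly p ^+ n.
Proof. by rewrite /dpoly rmorphXn horner_exp. Qed.

Lemma dpoly_sum p : dpoly p = \sum_(i < size p) serC p`_i * mono i i.
Proof.
rewrite /dpoly (@horner_coef_wide _ (size p)) ?size_poly //; apply: eq_bigr => i _.
by rewrite coef_map monoE exprMn.
Qed.

Lemma dpolyE p : dpoly p = diagonal (fun n => p`_n).
Proof.
apply: serP => j k; rewrite dpoly_sum ser_sumE /diagonal.
under eq_bigr do rewrite serCM /mono.
case: (eqVneq j k) => [<-|jk]; last first.
  rewrite big1 // => i _; case: eqP => [ji|]; case: eqP => [ki|]; rewrite ?mulr0 //.
  by rewrite ji ki eqxx in jk.
have [jp|jp] := ltnP j (size p); last first.
  rewrite [RHS]nth_default // big1 // => i _; rewrite andbb.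
  by have := ltn_ord i; case: eqP => [<-|]; rewrite ?mulr0 //; lia.
rewrite (bigD1 (Ordinal jp)) //= eqxx mulr1 big1 ?addr0 // => i.
by rewrite -val_eqE /= eq_sym andbb => /negPf ->; rewrite mulr0.
Qed.

Lemma conj_dpoly p : conj (dpoly p) = dpoly (map_poly (fun a : C => (a^*)%C) p).
Proof.
rewrite !dpolyE; apply: serP => j k; rewrite conjE /diagonal eq_sym.
by case: eqP => [->|_]; rewrite ?rmorph0 // coef_map_id0 // rmorph0.
Qed.

Lemma weight_diagonal gam : weight 0 (diagonal gam : ser C).
Proof. move=> j k; rewrite /diagonal; case: (eqVneq j k) => [->|//]; by rewrite subrr eqxx. Qed.

Lemma weight_dpoly p : weight 0 (dpoly p).
Proof. by rewrite dpolyE; exact: weight_diagonal. Qed.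

Lemma bounded_dpoly p : bounded (dpoly p).
Proof.
apply: (@polynomial_bounded _ (size p).*2) => j k jk; rewrite dpolyE /diagonal.
by case: (eqVneq j k) jk => // <- jk; rewrite nth_default // -leq_double -[j.*2]addnn ltnW.
Qed.

Lemma conj_horner p x :
  (map_poly (fun a : C => (a^*)%C) p).[(x%:C)%C] = (p.[(x%:C)%C]^*)%C.
Proof.
rewrite -[in LHS](_ : ((x%:C)%C^*)%C = (x%:C)%C); first by rewrite horner_map.
by apply/eqP; rewrite eq_complex /= oppr0 !eqxx.
Qed.

(** A series in z w that is the quotient of two polynomials has a singularity
    at a zero of the denominator that is not a zero of the numerator, so it
    cannot have a radius of convergence beyond that zero. *)
Lemma quotient_singularity f b c (x0 : C) (K a : R) : f * dpoly b = dpoly c ->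
  b.[x0] = 0 -> c.[x0] != 0 ->
  (forall n, cabs (f n n) <= K * a ^+ n) -> 0 < a -> a * cabs x0 < 1 -> False.
Proof.
move=> fb /rootP/factor_theorem[b' b'E] cx fK a0 ax.
have K0 : 0 <= K by have := le_trans (cabs_ge0 _) (fK 0%N); rewrite expr0 mulr1.
pose g := f * dpoly b'.
have gE : g * (serZ * serW - serC x0) = dpoly c.
  by rewrite -fb b'E dpolyM dpolyB dpolyX dpolyC /g mulrA.
pose S n := \sum_(i < n.+1) c`_i * x0 ^+ i.
have rec n : x0 ^+ n.+1 * g n n = - S n.
  have coef m : dpoly c m m = (if m is m'.+1 then g m' m' else 0) - x0 * g m m.
    rewrite -gE mulrBr ser_subE [g * serC x0]mulrC serCM [g * _]mulrC.
    rewrite (_ : serZ * serW = mono 1 1); last by rewrite monoE !expr1.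
    by rewrite monoM; case: m => [|m] //=; rewrite subn1.
  have cE m : dpoly c m m = c`_m by rewrite dpolyE /diagonal eqxx.
  elim: n => [|n IH].
    by have := coef 0%N; rewrite cE sub0r /S big_ord1 expr0 mulr1 expr1 => ->; rewrite opprK.
  have := coef n.+1; rewrite cE => E; rewrite /S big_ord_recr /= -/(S n) opprD -IH E.
  by rewrite !exprS; ring.
have gS n : (size c <= n.+1)%N -> cabs x0 ^+ n.+1 * cabs (g n n) = cabs c.[x0].
  move=> cn; rewrite -cabsX -cabsM rec cabsN; congr cabs.
  by rewrite (horner_coef_wide _ cn).
pose K' := \sum_(i < size b') cabs b'`_i * a^-1 ^+ i.
have gK n : cabs (g n n) <= K * K' * a ^+ n.
  rewrite /g dpoly_sum mulr_sumr ser_sumE; apply: le_trans (cabs_sum _ _ _) _.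
  rewrite [K * K']mulrC -mulrA mulr_suml; apply: ler_sum => i _.
  rewrite mulrCA serCM [f * _]mulrC monoM cabsM andbb -mulrA ler_wpM2l ?cabs_ge0 //.
  case: leqP => [le_in|_]; last by rewrite cabs0 !mulr_ge0 ?exprn_ge0 ?invr_ge0 // ltW.
  apply: le_trans (fK _) _; rewrite mulrCA ler_wpM2l // -{2}(subnKC le_in) exprD mulrA.
  by rewrite -exprMn mulVf ?gt_eqF // expr1n mul1r.
have cpos : 0 < cabs c.[x0] by rewrite lt_def cabs_ge0 cabs_eq0 cx.
have th : `|a * cabs x0| < 1 by rewrite ger0_norm // mulr_ge0 ?cabs_ge0 // ltW.
have := @cvg_geometric R (cabs x0 * (K * K')) _ th.
move=> /cvgrPdist_lt /(_ _ cpos) [N _ HN].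
have := HN (maxn N (size c)) (leq_maxl _ _); rewrite /= sub0r normrN.
set n := maxn N _; have -> : cabs c.[x0] = cabs x0 ^+ n.+1 * cabs (g n n).
  by rewrite gS // (leq_trans (leq_maxr N _)).
set big := cabs x0 * _ * _ => /(le_lt_trans (ler_norm _)); apply/negP; rewrite -leNgt.
rewrite /big exprS -!mulrA ler_wpM2l ?cabs_ge0 // exprMn [a ^+ n * _]mulrC.
rewrite [X in _ <= X](_ : _ = cabs x0 ^+ n * (K * K' * a ^+ n)); last by ring.
by rewrite ler_wpM2l // exprn_ge0 // cabs_ge0.
Qed.

End DiagonalPolynomials.

(** * Resonances created by a varying rotation number *)

Section Phase.
Variable R : realType.
Local Notation C := R[i].
Implicit Types (q : {poly C}) (x : R).

Lemma polar_form (u v : R) : 0 < u ->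
  exists2 c : R, c != 0 & (u +i* v)%C = (c%:C)%C * lambda (atan (v / u) / (2 * pi)).
Proof.
move=> u0; set t := atan (v / u); have ct : 0 < cos t.
  by apply: cos_gt0_pihalf; rewrite atan_gtNpi2 atan_ltpi2.
exists (u / cos t); first by rewrite mulf_neq0 ?invr_neq0 ?gt_eqF.
rewrite /lambda (_ : 2 * pi * (t / (2 * pi)) = t); last first.
  by rewrite mulrC divfK // mulf_neq0 ?pnatr_eq0 // lt0r_neq0 // pi_gt0.
have tt : sin t / cos t = v / u by rewrite -/(tan t) atanK.
apply/eqP; rewrite eq_complex /=; apply/andP; split; apply/eqP; rewrite mul0r ?subr0 ?addr0.
  by rewrite divfK // gt_eqF.
by rewrite mulrAC -mulrA tt mulrC divfK // gt_eqF.
Qed.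

(** On the circle z w = x, the map l z q(z w) / conj q(z w) has a rotation
    number that varies with x, so that its multiples 2 m pass through integers. *)
Lemma phase_root (omega : R) q (rho : R) (N : nat) : irrational omega ->
  q.[0] = 1 -> 0 < rho -> (forall r, 0 < r -> exists2 x, 0 < x < r & (impoly q).[x] != 0) ->
  exists m x, [/\ (N <= m)%N, 0 < x < rho, q.[(x%:C)%C] != 0 &
    lambda omega ^+ m.*2 * q.[(x%:C)%C] ^+ m.*2 = (q.[(x%:C)%C]^*)%C ^+ m.*2].
Proof.
move=> irr q1 rho0 Hq; have [re0 im0] : (repoly q).[0] = 1 /\ (impoly q).[0] = 0.
  by have := horner_re_im q 0; rewrite (_ : (0%:C)%C = 0) // q1 => -[<- <-].
have [r1 r10 Hr1] : exists2 r : R, 0 < r & forall x, 0 <= x < r -> 0 < (repoly q).[x].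
  have q0 : nbhs (repoly q).[0] [set y : R | 0 < y].
    by apply: open_nbhs_nbhs; split; [exact: open_gt | rewrite /= re0].
  have /nbhs_ballP[r /= r0 Hr] := @continuous_horner _ (repoly q) 0 _ q0.
  exists r => // x /andP[x0 xr]; apply: (Hr x).
  by rewrite -ball_normE /= sub0r normrN ger0_norm.
pose phi x := atan ((impoly q).[x] / (repoly q).[x]) / (2 * pi).
have r0 : 0 < Num.min r1 rho by rewrite lt_min r10 rho0.
have [x1 /andP[x10]] := Hq _ r0; rewrite lt_min => /andP[x1r x1rho] imx1.
have pos x : 0 <= x <= x1 -> 0 < (repoly q).[x].
  by move=> /andP[x0 xx]; apply: Hr1; rewrite x0 (le_lt_trans xx).
have pi2 : 0 < 2 * pi :> R by rewrite mulr_gt0 // pi_gt0.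
have phi1 : phi x1 != 0.
  rewrite /phi mulf_neq0 ?invr_neq0 ?(lt0r_neq0 pi2) //; apply/negP => /eqP /(congr1 (@tan R)).
  rewrite atanK tan0 => /eqP; rewrite mulf_eq0 (negPf imx1) invr_eq0 /=.
  by rewrite gt_eqF // pos // lexx ltW.
have phi0 : phi 0 = 0 by rewrite /phi im0 mul0r atan0 mul0r.
pose m := (N + (Num.truncn `|phi x1|^-1).+1)%N.
have m0 : (0 < m)%N by rewrite /m; lia.
pose psi x := m.*2%:R * (omega + 2 * phi x).
have mphi : 1 <= `|psi x1 - psi 0|.
  rewrite /psi phi0 mulr0 addr0 mulrDr addrC addKr -muln2 natrM normrM.
  rewrite ger0_norm ?mulr_ge0 // normrM (ger0_norm (_ : 0 <= 2)) //.
  have p0 : 0 < `|phi x1| by rewrite normr_gt0.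
  have : `|phi x1|^-1 <= m%:R.
    by apply: le_trans (ltW (truncnS_gt _)) _; rewrite ler_nat leq_addl.
  rewrite -[_ <= m%:R](ler_pM2r p0) mulVf ?gt_eqF // => H.
  have : 0 <= m%:R * `|phi x1| by rewrite mulr_ge0.
  by nra.
pose mx := Num.max (psi 0) (psi x1); pose mn := Num.min (psi 0) (psi x1).
have mm : mn + 1 <= mx.
  move: mphi; rewrite /mn /mx ler_normr => /orP; move: (psi 0) (psi x1) => y0 y1.
  by case: (lerP y0 y1) => y01 [|]; lra.
have nb : mn <= (Num.floor mx)%:~R <= mx.
  have := floorD1_gt mx; rewrite intrD; have := ge_floor mx; lra.
have cpsi : {within `[0, x1], continuous psi}.
  apply: continuous_in_subspaceT => x; rewrite inE /= in_itv /= => x01.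
  apply: cvgMr; apply: cvgD; first exact: cvg_cst.
  apply: cvgMr; apply: cvgMl.
  apply: (@continuous_comp _ _ _ (fun x => (impoly q).[x] / (repoly q).[x]) (@atan R)).
    apply: cvgM; first exact: continuous_horner.
    by apply: cvgV; [rewrite gt_eqF // pos | exact: continuous_horner].
  exact: continuous_atan.
have [x x01 Ex] := IVT (ltW x10) cpsi nb; rewrite in_itv /= in x01.
have pv := @polar_form _ (impoly q).[x] (pos x x01).
case: pv => c c0; rewrite -/(phi x) => Ec.
exists m, x; split; [by rewrite /m leq_addr | | |].
- case/andP: (x01) => x0 xx; rewrite (le_lt_trans xx x1rho) lt_def x0 !andbT.
  apply/negP => /eqP x00; move: Ex; rewrite x00 /psi phi0 mulr0 addr0 => E.
  have := @lambda_irrational _ omega m.*2 irr; rewrite lambdaX E lambda_int eqxx.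
  by rewrite double_gt0 => /(_ m0).
- by rewrite horner_re_im eq_complex negb_and gt_eqF // pos.
- have cj : (((c%:C)%C * lambda (phi x))^*)%C = (c%:C)%C * lambda (- phi x).
    rewrite -lambda_conj; case: (lambda (phi x)) => y z; apply/eqP; rewrite eq_complex /=.
    by apply/andP; split; apply/eqP; ring.
  rewrite horner_re_im Ec cj !exprMn mulrCA; congr (_ * _); rewrite !lambdaX -lambdaD.
  rewrite (_ : _ + _ = (Num.floor mx)%:~R + m.*2%:R * - phi x) ?lambdaD ?lambda_int ?mul1r //.
  by rewrite -Ex /psi; ring.
Qed.

End Phase.

(** * A divergent model next to a conservative twist *)

Section Twist.
Variable R : realType.
Local Notation C := R[i].
Implicit Types (f g h : ser C).

(** The geometric series in 1 - f. *)
Lemma unit_inverse f : f 0%N 0%N = 1 -> bounded f -> weight 0 f ->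
  exists g, [/\ f * g = 1, bounded g & weight 0 g].
Proof.
move=> f1 bf wf; pose e := 1 - f.
have oe : ord 1 e.
  by move=> [|j] [|k] //= _; rewrite /e ser_subE f1 subrr.
have we : weight 0 e by move=> j k jk; rewrite /e ser_subE wf // weight1 // subrr.
pose G : ser C := one_var (fun=> 1).
have oZ : ord 1 (serZ : ser C) by exact: ord1Z.
have GE : (1 - serZ) * G = 1.
  apply: serP => j k; rewrite mulrBl mul1r ser_subE /serZ monoM /G /one_var subn0 andbT.
  by case: j => [|j]; case: k => [|k]; rewrite /= ?subrr ?subr0.
exists (comp G e); split.
- have -> : f = comp (1 - serZ) e.
    rewrite compB (id_comp oe) compE subst1 //; last exact: ord_conj.
    by rewrite /e opprD opprK addrA subrr add0r.
  by rewrite -(compM _ _ oe) GE compE subst1 //; exact: ord_conj.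
- apply: bounded_comp => //; last first.
    by apply: boundedB => //; rewrite -[1](rmorph1 (@serC C)); apply: bounded_cst.
  apply/bounded_geometric; exists 1%N => j k; rewrite expr1n /G /one_var.
  by case: ifP; rewrite ?cabs1 ?cabs0.
- exact: weight_comp_diag.
Qed.

Variables (omega : R) (q : {poly C}) (N : nat).
Hypotheses (irr : irrational omega) (q1 : q.[0] = 1) (N0 : (0 < N)%N).
Hypothesis q_im : forall r : R, 0 < r -> exists2 x, 0 < x < r & (impoly q).[x] != 0.
Local Notation l := (lambda omega).

Let l_unit := lambda_unit omega.
Let l_irr n := @lambda_irrational _ omega n irr.

Variable U : ser C.
Hypotheses (bU : bounded U) (wU : weight 0 U).
Hypothesis UQ : U * conj (dpoly q) = serC l * dpoly q.

(** U = l Q / conj Q has modulus one when w = conj z, so that T rotates each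
    circle by an angle that depends on the circle. *)
Let T : ser C := serZ * U.

Let U00 : U 0%N 0%N = l.
Proof.
have := congr1 (fun f : ser C => f 0%N 0%N) UQ; rewrite serCM ser_coefM !big_ord1 conjE.
by rewrite dpolyE /diagonal /= -horner_coef0 q1 conjc1 !mulr1.
Qed.

Lemma twist_multiplier : multiplier l T.
Proof. by rewrite /T /serZ; split; rewrite monoM //= subnn U00. Qed.

Lemma twist_resonant : resonant T.
Proof.
move=> j k jk; rewrite /T /serZ monoM; case: j jk => [|j] jk //=.
by rewrite subn1 subn0 wU //; move: jk; lia.
Qed.

Lemma twist_norm : T * conj T = serZ * serW.
Proof.
suff UU : U * conj U = 1 by rewrite /T conjM conjZ mulrACA UU mulr1.
have b : bounded (dpoly q * conj (dpoly q)).
  by apply: boundedM; rewrite ?conj_dpoly; exact: bounded_dpoly.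
have w : weight 0 (dpoly q * conj (dpoly q)).
  by rewrite -[0]addr0 conj_dpoly; apply: weightM; exact: weight_dpoly.
have q0 : (dpoly q * conj (dpoly q)) 0%N 0%N = 1.
  by rewrite ser_coefM !big_ord1 conjE dpolyE /diagonal /= -horner_coef0 q1 conjc1 mulr1.
have [g [gE _ _]] := unit_inverse q0 b w.
have := congr1 (@conj R) UQ; rewrite !conjM conjK conjserC => UQ'.
have E : (U * conj U) * (dpoly q * conj (dpoly q)) = dpoly q * conj (dpoly q).
  rewrite [dpoly q * _]mulrC mulrACA UQ UQ' mulrACA -rmorphM l_unit rmorph1 mul1r.
  exact: mulrC.
by rewrite -[LHS]mulr1 -gE mulrA E.
Qed.

(** The sum of z^(2m) + w^(2m) over all m >= N: a term in every large even
    weight, whatever the weights at which resonances occur. *)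
Definition even_modes : ser C := fun j k =>
  (((j == 0%N) || (k == 0%N)) && ~~ odd (j + k) && (N.*2 <= j + k)%N)%:R.

Lemma even_modes_conj : conj even_modes = even_modes.
Proof. by apply: serP => j k; rewrite conjE /even_modes conjc_nat orbC addnC. Qed.

Lemma even_modes_ord : ord N.*2 even_modes.
Proof. by move=> j k jk; rewrite /even_modes leqNgt jk andbF. Qed.

Definition twist s : ser C := T * (1 + serC (s%:C)%C * even_modes).

Lemma twist_multiplier_s s : multiplier l (twist s).
Proof.
apply/multiplierP; rewrite /twist mulrDr mulr1 addrAC; apply: ordD.
  exact/multiplierP/twist_multiplier.
have oT := multiplier_ord twist_multiplier.
have oy : ord N.*2 (serC (s%:C)%C * even_modes) by apply: ordMr; exact: even_modes_ord.
by apply: ord_le (ordM oT oy); lia.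
Qed.

Lemma twist_jet s : ord N.*2.+1 (twist s - T).
Proof.
rewrite /twist mulrDr mulr1 addrC addKr -add1n.
by apply: ordM; [exact: (multiplier_ord twist_multiplier) | apply: ordMr; exact: even_modes_ord].
Qed.

Lemma twist_odd s : odd_map (twist s).
Proof.
have pT : forall j k, ~~ odd (j + k) -> T j k = 0.
  by move=> j k jk; apply: twist_resonant; apply/negP => /eqP jk'; move: jk; rewrite jk'; lia.
apply/odd_mapP => j k jk; rewrite /twist ser_coefM big1 // => a _; rewrite big1 // => b _.
have [ab|ab] := boolP (odd (a + b)); last by rewrite pT // mul0r.
rewrite ser_addE serCM /even_modes.
have o : odd (j - a + (k - b)).
  by have := ltn_ord a; have := ltn_ord b; move: ab jk; lia.
rewrite o andbF mulr0 addr0.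
rewrite (_ : (1 : ser C) (j - a)%N (k - b)%N = 0) ?mulr0 //.
by apply: weight1; move: o; lia.
Qed.

Lemma twist_norm_s s : twist s * conj (twist s) =
  serZ * serW * (1 + serC (s%:C)%C * even_modes) ^+ 2.
Proof.
rewrite /twist conjM mulrACA twist_norm conjD conj1 conjM even_modes_conj conjserC expr2.
by congr (_ * (_ * (1 + serC _ * _))); apply/eqP; rewrite eq_complex /= oppr0 !eqxx.
Qed.

Lemma bounded_even_modes : bounded even_modes.
Proof.
apply/bounded_geometric; exists 1%N => j k; rewrite expr1n /even_modes.
by case: (_ && _); rewrite ?cabs1 ?cabs0.
Qed.

Lemma twist_bounded s : bounded (twist s).
Proof.
apply: boundedM; first by apply: boundedM => //; exact: bounded_mono.
apply: boundedD; first by rewrite -[1](rmorph1 (@serC C)); apply: bounded_cst.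
by apply: boundedM; [exact: bounded_cst | exact: bounded_even_modes].
Qed.

Let pol (_ : nat) (f : R -> C) := exists p : {poly C}, forall s, f s = p.[(s%:C)%C].

Lemma graded_pol : graded_class pol.
Proof.
split.
- by move=> n; exists 0 => s; rewrite horner0.
- by move=> c; exists c%:P => s; rewrite hornerC.
- by move=> n f g [p fp] [p' gp]; exists (p + p') => s; rewrite hornerD fp gp.
- by move=> n m f g [p fp] [p' gp]; exists (p * p') => s; rewrite hornerM fp gp.
- move=> n f [p fp]; exists (map_poly (fun x : C => (x^*)%C) p) => s.
  by rewrite conj_horner fp.
Qed.

(** The integral equation of the family is divisible by s; this permits to divide
    and set s = 0. *)
Lemma pol_extend (f : R -> C) : pol 0 f -> (forall s, s != 0 -> f s = 0) -> f 0 = 0.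
Proof.
move=> [p fp] f0; rewrite fp; suff -> : p = 0 by rewrite horner0.
apply: (@roots_geq_poly_eq0 _ _ [seq (i.+1%:R : C) | i <- iota 0 (size p)]).
- apply/allP => _ /mapP[i _ ->]; apply/rootP.
  rewrite (_ : i.+1%:R = ((i.+1%:R : R)%:C)%C); last by rewrite rmorph_nat.
  by rewrite -fp f0 // pnatr_eq0.
- rewrite map_inj_uniq ?iota_uniq // => i j /eqP.
  by rewrite eqr_nat => /eqP[].
- by rewrite size_map size_iota.
Qed.

Lemma weighted_twist : weighted (fun n (f : R -> C) => exists p : {poly C},
     (size p <= 2 * n + 1)%N /\ forall s, f s = p.[(s%:C)%C]) 1 twist.
Proof.
have E s j k : twist s j k = T j k + (s%:C)%C * (T * even_modes) j k.
  by rewrite /twist mulrDr mulr1 ser_addE mulrCA serCM.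
have o1 : ord 3 (T * even_modes).
  apply: ord_le (ordM (multiplier_ord twist_multiplier) even_modes_ord); lia.
move=> j k; split.
  move=> jk s; rewrite E o1 ?mulr0 ?addr0; last by lia.
  by apply: (multiplier_ord twist_multiplier).
move=> jk; exists ((T j k)%:P + (T * even_modes) j k *: 'X); split; last first.
  by move=> s; rewrite !hornerE E mulrC.
have [jk3|jk3] := ltnP (j + k) 3.
  rewrite o1 // scale0r addr0; apply: leq_trans (size_polyC_leq1 _) _; lia.
apply: leq_trans (size_polyD _ _) _; rewrite geq_max; apply/andP; split.
  by apply: leq_trans (size_polyC_leq1 _) _; lia.
apply: leq_trans (size_scale_leq _ _) _; rewrite size_polyX; lia.
Qed.

Lemma poly_split (p : {poly C}) : exists2 d : {poly C}, (size d <= size p)%N &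
  forall s : C, p.[s] = p.[0] + s * d.[s].
Proof.
have /factor_theorem[d dE] : root (p - p.[0]%:P) 0.
  by rewrite /root !hornerE subrr.
rewrite subr0 in dE; exists d.
  have [->|d0] := eqVneq d 0; first by rewrite size_poly0.
  rewrite -(leq_add2r 1) addn1 -(size_mulX d0) -dE; apply: leq_trans (size_polyD _ _) _.
  rewrite geq_max leq_addr size_polyN; apply: leq_trans (size_polyC_leq1 _) _; lia.
by move=> s; rewrite -{1}(subrK p.[0]%:P p) dE !hornerE addrC mulrC.
Qed.

(** With T_s = T (1 + s y) one has |T_s|^2 = z w (1 + s y)^2. Differentiating
    I_s(T_s) = gam_s(I_s) at s = 0, where I_0 = z w and gam_0 = id, gives the
    equation for I1. The difference quotient is kept as a polynomial in s, to
    which extrapolation applies. *)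
Lemma first_variation : exists (d : nat * nat -> {poly C}) (gam : nat -> C),
  [/\ forall t, (size (d t) <= 2 * (t.1 + t.2) + 1)%N,
      forall s t, canonical l (twist s) t.1 t.2
        = (serZ * serW : ser C) t.1 t.2 + (s%:C)%C * (d t).[(s%:C)%C]
    & let I1 : ser C := fun j k => (d (j, k)).[0] in
      comp I1 T + serZ * serW * even_modes *+ 2 = I1 + diagonal gam].
Proof.
have [wh wN] := weighted_nf (graded_polynomial R) true l weighted_twist.
have [c [sc cE]] := polynomial_modulus wh; have [r [_ rE]] := polynomial_modulus wN.
have T0 : twist 0 = T by rewrite /twist rmorph0 mul0r addr0 mulr1.
have oT := multiplier_ord twist_multiplier.
have odT : odd_map T by rewrite -T0; exact: twist_odd.
have [can0 rad0] := canonical_conservative l_unit l_irr twist_multiplier odT twist_norm.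
have c0 t : (c t).[0] = (serZ * serW : ser C) t.1 t.2.
  by rewrite -can0 /canonical -T0 cE.
have r0 t : (r t).[0] = (serZ * serW : ser C) t.1 t.2.
  by rewrite -rad0 /radial_factor -T0 rE.
have /choice[d Hd] : forall t, exists d : {poly C}, (size d <= size (c t))%N /\
    forall s, (c t).[s] = (c t).[0] + s * d.[s].
  by move=> t; have [d] := poly_split (c t); exists d.
have /choice[g Hg] : forall n, exists g : {poly C},
    forall s, (r (n, n)).[s] = (r (n, n)).[0] + s * g.[s].
  by move=> n; have [g] := poly_split (r (n, n)); exists g.
pose Ds s : ser C := fun j k => (d (j, k)).[(s%:C)%C].
pose gs s n : C := (g n).[(s%:C)%C].
have cEs s : canonical l (twist s) = serZ * serW + serC (s%:C)%C * Ds s.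
  apply: serP => j k; rewrite ser_addE serCM.
  by rewrite [LHS](cE s (j, k)) (Hd (j, k)).2 c0.
exists d, (gs 0); split.
- by move=> t; apply: leq_trans (Hd t).1 (sc t).
- by move=> s [j k]; rewrite cEs ser_addE serCM.
pose E s : ser C := serZ * serW * (even_modes *+ 2 + serC (s%:C)%C * even_modes ^+ 2)
   + comp (Ds s) (twist s) - Ds s - comp (one_var (gs s)) (canonical l (twist s)).
have oZW : ord 1 (serZ * serW : ser C) by apply: ord_le (@ord2_ZW _).
suff E0 : E 0 = 0.
  move: E0; rewrite /E T0 can0 rmorph0 mul0r addr0 -diagonalE => E0.
  have -> : (fun j k => (d (j, k)).[0]) = Ds 0 by [].
  apply/eqP; rewrite -subr_eq0; apply/eqP; rewrite -E0 mulrnAr; ring.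
have Es s : s != 0 -> E s = 0.
  move=> s0; have ms := twist_multiplier_s s; have os := multiplier_ord ms.
  have [gam tg radE] := radial_factorE l_unit ms.
  have [_ _] := canonical_is_integral l_unit l_irr ms tg radE.
  have oc : ord 1 (canonical l (twist s)) by apply: ord_le (canonical_ord ms).
  have -> : one_var gam = serZ + serC (s%:C)%C * one_var (gs s).
    apply: serP => j k; rewrite ser_addE serCM /one_var; case: eqP => [->|k0]; last first.
      by rewrite /serZ /mono mulr0 addr0 (introF eqP k0) andbF.
    have := rE s (j, j); rewrite -/(radial_factor l (twist s)) radE /diagonal eqxx Hg r0 => ->.
    congr (_ + _); rewrite -[serZ * serW]/(mono 1 0 * mono 0 1) mono_mono /serZ /mono andbb.
    by rewrite andbT.
  rewrite compD (id_comp oc) (compM _ _ oc) compC.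
  have cT : comp (canonical l (twist s)) (twist s)
      = comp (serZ * serW) (twist s) + serC (s%:C)%C * comp (Ds s) (twist s).
    by rewrite [in LHS]cEs compD [comp (serC _ * _) _](compM _ _ os) compC.
  rewrite cT.
  have -> : comp (serZ * serW) (twist s) = twist s * conj (twist s).
    by rewrite (compM _ _ os) -conjZ -conj_comp (id_comp os).
  rewrite twist_norm_s {1}cEs => H; have sE : serC (s%:C)%C * E s = 0.
    rewrite /E -cEs in H *; move: H; rewrite {1}cEs; set I := canonical _ _.
    set A := comp (Ds s) _; set B := comp (one_var _) _ => H.
    rewrite (_ : _ * _ = serZ * serW * (1 + serC (s%:C)%C * even_modes) ^+ 2 + serC (s%:C)%C * A
      - (serZ * serW + serC (s%:C)%C * Ds s + serC (s%:C)%C * B)); last by ring.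
    by rewrite H subrr.
  apply: serP => j k; have := congr1 (fun f : ser C => f j k) sE; rewrite serCM ser0E => /eqP.
  by rewrite mulf_eq0 => /orP[/eqP[s00]|/eqP //]; rewrite s00 eqxx in s0.
apply: serP => j k; apply: pol_extend (_ : pol 0 (fun s => E s j k)) _; last first.
  by move=> s s0; rewrite Es.
have wD : weighted pol 0 Ds by move=> a b; split=> // _; exists (d (a, b)).
have wg : weighted pol 0 (fun s => one_var (gs s)).
  move=> a b; split=> // _; rewrite /one_var; case: eqP => _; first by exists (g a).
  by exists 0 => s; rewrite horner0.
have wt : weighted pol 1 twist.
  move=> a b; have [w1 w2] := weighted_twist a b; split=> // ab.
  by have [p [_ H]] := w2 ab; exists p.
have wC f : weighted pol 0 (fun=> f).
  by move=> a b; split=> // _; exists (f a b)%:P => s; rewrite hornerC.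
have ws : weighted pol 0 (fun s => serC (s%:C)%C).
  move=> a b; split=> // _; rewrite /serC.
  case: (_ && _); first by exists 'X => s; rewrite hornerX.
  by exists 0 => s; rewrite horner0.
have wc : weighted pol 1 (fun s => canonical l (twist s)).
  have [wh' _] := weighted_nf graded_pol true l wt.
  move=> a b; have := weightedM graded_pol wh' (weighted_conj graded_pol wh') a b.
  by move=> [w1 w2]; split=> ab; [apply: w1; lia | case: (ltnP (a + b) 2) => [ab2|/w2 //]; exists 0 => s; rewrite horner0 [LHS]w1].
have wE : weighted pol 0 E.
  apply: (weightedB graded_pol); last exact: (weighted_comp graded_pol).
  apply: (weightedB graded_pol) => //; apply: (weightedD graded_pol); last exact: (weighted_comp graded_pol).
  apply: (weightedM graded_pol (wC _)); apply: (weightedD graded_pol) => //.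
  exact: (weightedM graded_pol ws).
exact: (wE j k).2.
Qed.

(** Composition with T preserves the weight and multiplies the part
    z^(2m) f(z w) of weight 2m by U^(2m), as z w is invariant. *)
Lemma first_variation_mode (I1 : ser C) gam m : (N <= m)%N ->
  comp I1 T + serZ * serW * even_modes *+ 2 = I1 + diagonal gam ->
  let f : ser C := diagonal (fun n => I1 (m.*2 + n)%N n) in
  f * U ^+ m.*2 + serZ * serW *+ 2 = f.
Proof.
move=> Nm E f; have oT := multiplier_ord twist_multiplier.
have wf : weight 0 f by exact: weight_diagonal.
have wT : weight 1 T by exact: (weight_resonant twist_resonant).
have comp_mode j : comp I1 T (m.*2 + j)%N j = (f * U ^+ m.*2) j j.
  have -> : comp I1 T (m.*2 + j)%N j = comp (mono m.*2 0 * f) T (m.*2 + j)%N j.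
    rewrite !compE !subst_coef; apply: eq_bigr => a _; apply: eq_bigr => b _.
    rewrite monoM subn0 andbT /f /diagonal.
    have [ab|ab] := eqVneq (a : nat) (m.*2 + b)%N.
      by rewrite ab leq_addr addKn eqxx.
    rewrite [X in _ = _ * X](_ : _ = 0) ?mulr0; last first.
      have : weight (1 * a%:Z + (-1) * b%:Z) (T ^+ a * conj T ^+ b).
        by apply: weightM; apply: weightX => //; exact: weight_conj.
      by apply; move: ab; lia.
    rewrite [X in _ * X = _](_ : _ = 0) ?mulr0 //.
    have : weight (1 * a%:Z + (-1) * b%:Z) (T ^+ a * conj T ^+ b).
      by apply: weightM; apply: weightX => //; exact: weight_conj.
    by apply; move: ab; lia.
  have fT : comp f T = f.
    rewrite /f diagonalE (comp_assoc _ (ord_le _ (@ord2_ZW _)) oT) //.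
    have -> // : comp (serZ * serW) T = serZ * serW.
    by rewrite (compM _ _ oT) -conjZ -conj_comp (id_comp oT) twist_norm conjZ.
  rewrite (compM _ _ oT) fT compE subst_mono //; last exact: ord_conj.
  rewrite expr0 mulr1 /T exprMn -[serZ ^+ _]mulr1 -[1](expr0 serW) -monoE -mulrA monoM.
  by rewrite leq_addr addKn /= subn0 mulrC.
apply: serP => j k; have [jk|jk] := eqVneq j k; last first.
  have w0 : weight 0 (f * U ^+ m.*2).
    by rewrite -[0](addr0 0); apply: weightM => //; rewrite -(mul0r m.*2%:Z); exact: weightX.
  rewrite ser_addE w0 ?wf; [| by move: jk; lia | by move: jk; lia].
  rewrite mulr2n ser_addE -[serZ * serW]/(mono 1 0 * mono 0 1) mono_mono /mono.
  by case: eqP => [j1|]; case: eqP => [k1|]; rewrite ?addr0 ?add0r //; move: jk; rewrite j1 k1 eqxx.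
rewrite -jk ser_addE -comp_mode.
have -> : f j j = I1 (m.*2 + j)%N j by rewrite /f /diagonal eqxx.
have m0 : (0 < m)%N by apply: leq_trans N0 Nm.
have := congr1 (fun g : ser C => g (m.*2 + j)%N j) E; rewrite !ser_addE /diagonal.
have -> : ((m.*2 + j)%N == j) = false by lia.
rewrite addr0 => <-; congr (_ + _).
rewrite !mulr2n !ser_addE -[serZ * serW]/(mono 1 0 * mono 0 1) mono_mono monoM /mono /even_modes.
case: j {jk} => [|[|j]] /=.
- by rewrite andbF.
- have -> : (0 < m.*2 + 1)%N by lia.
  rewrite /= addn1 subn1 /= subnn addn0 odd_double leq_double Nm eqxx orbT.
  by [].
- have -> : (0 < m.*2 + j.+2)%N by lia.
  have -> : (m.*2 + j.+2 - 1 == 0)%N = false by lia.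
  by rewrite subn1.
Qed.

(** If all the members of the family had a convergent integral, so would the
    first variation by extrapolation to s = 0. Its part of weight 2m then
    converges on a disc that does not depend on m, although its denominator
    1 - U^(2m) vanishes in that disc for some m. *)
Lemma twist_divergent : exists s, ~ bounded (canonical l (twist s)).
Proof.
apply: contrapT => H; have Hb s : bounded (canonical l (twist s)).
  by apply: contrapT => nb; apply: H; exists s.
have [d [gam [sd dE I1E]]] := first_variation.
have [|x x12|M0 HM0] := extrapolation sd (_ : (1 : R) < 2) _ 0; first by lra.
  have /bounded_geometric[M HM] := Hb x; exists M.+1 => -[j k].
  have x0 : 0 < x by lra.
  rewrite -(ler_pM2l x0); have -> : x * cabs (d (j, k)).[(x%:C)%C]
      = cabs (canonical l (twist x) j k - (serZ * serW : ser C) j k).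
    by rewrite (dE x (j, k)) addrC addKr cabsM cabs_real gtr0_norm.
  apply: (@le_trans _ _ (M%:R ^+ (j + k).+1 + 1)).
    apply: le_trans (cabsB _ _) _; apply: lerD; first exact: HM.
    rewrite -[serZ * serW]/(mono 1 0 * mono 0 1) mono_mono /mono.
    by case: (_ && _); rewrite ?cabs1 ?cabs0.
  apply: (@le_trans _ _ (M.+1%:R ^+ (j + k).+1)); last first.
    by rewrite ler_peMl ?exprn_ge0 //; lra.
  rewrite -!natrX -[1 in X in X <= _]/(1%:R) -natrD ler_nat !expnS mulSn.
  have : (0 < M.+1 ^ (j + k))%N by rewrite expn_gt0.
  have : (M ^ (j + k) <= M.+1 ^ (j + k))%N by case: (j + k)%N => // n; rewrite leq_exp2r.
  by nia.
pose I1 : ser C := fun j k => (d (j, k)).[0].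
pose M := M0.+1; have HM j k : cabs (I1 j k) <= M%:R ^+ (j + k).+1.
  apply: le_trans (HM0 (j, k)) _; rewrite -!natrX ler_nat leq_exp2r //.
pose rho : R := (M%:R ^+ 2)^-1.
have rho0 : 0 < rho by rewrite invr_gt0 exprn_gt0.
have [m [x [Nm /andP[x0 xr] qx qm]]] := phase_root N irr q1 rho0 q_im.
pose f : ser C := diagonal (fun n => I1 (m.*2 + n)%N n).
have fE : f * U ^+ m.*2 + serZ * serW *+ 2 = f := first_variation_mode Nm I1E.
pose qc := map_poly (fun a : C => (a^*)%C) q.
apply: (@quotient_singularity R f ((l ^+ m.*2)%:P * q ^+ m.*2 - qc ^+ m.*2)
  ((- 2)%:P * 'X * qc ^+ m.*2) (x%:C)%C (M%:R ^+ m.*2.+1) (M%:R ^+ 2)).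
- rewrite dpolyB !dpolyM !dpoly_exp !dpolyC dpolyX -conj_dpoly rmorphXn -exprMn -UQ exprMn.
  have fA : f * U ^+ m.*2 = f - serZ * serW *+ 2 by rewrite -[X in _ = X - _]fE addrK.
  rewrite [LHS](_ : _ = (f * U ^+ m.*2) * conj (dpoly q) ^+ m.*2 - f * conj (dpoly q) ^+ m.*2).
    by rewrite fA rmorphN rmorph_nat; ring.
  by rewrite mulrBr mulrA.
- by rewrite !hornerE conj_horner qm subrr.
- rewrite !hornerE conj_horner !mulf_neq0 ?oppr_eq0 ?pnatr_eq0 //.
    by rewrite eq_complex /= negb_and gt_eqF.
  by rewrite expf_neq0 // conjc_eq0.
- move=> n; rewrite /f /diagonal eqxx; apply: le_trans (HM _ _) _.
  by rewrite -exprM -exprD le_eqVlt; apply/orP; left; apply/eqP; congr (_ ^+ _); lia.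
- by rewrite exprn_gt0.
- by rewrite cabs_real gtr0_norm // -lter_pdivlMl ?exprn_gt0 // mulr1.
Qed.

End Twist.

(** * Divergent models with a prescribed conservative jet *)

Section ConservativeJets.
Variable R : realType.
Local Notation C := R[i].
Implicit Types (F G f g h J : ser C).

(** All the iterates that converge to the inverse are odd. *)
Lemma odd_inverse F G : multiplier 1 F -> odd_map F -> ord 1 G -> comp F G = serZ -> odd_map G.
Proof.
move=> mF oF oG FG; have [H [mH FH HF cH]] := inverse_exists mF.
have oF1 := multiplier_ord mF.
have -> : G = H by rewrite -[G](id_comp oG) -HF (comp_assoc _ oF1 oG) FG comp_id.
have odd_sub f g : odd_map f -> odd_map g -> odd_map (f - g).
  move=> /odd_mapP of_ /odd_mapP og; apply/odd_mapP => j k jk.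
  by rewrite ser_subE of_ // og // subrr.
have oZ : odd_map (serZ : ser C) by apply/odd_mapP => -[|[|j]] [|k].
have it m : odd_map (inverse_iter F m).
  elim: m => [|m IH]; first exact: oZ.
  rewrite /=; apply: (odd_sub _ _ oZ).
  have oFZ : ord 1 (F - serZ) by apply: ordB => //; exact: ord1Z.
  exact: (odd_comp (inverse_iter_ord m mF) oFZ (odd_sub _ _ oF oZ) IH).
apply/odd_mapP => j k jk; have /ord_subP -> // := cH (j + k).+1.
by move/odd_mapP: (it (j + k).+1) => ->.
Qed.

(** A convergent change of coordinates carries convergent integrals to convergent
    integrals, and the divergence of the canonical one is the absence of the
    latter. *)
Lemma divergent_model_conjugate omega F h k : irrational omega ->
  divergent_model omega F -> multiplier 1 h -> bounded h -> odd_map h ->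
  multiplier 1 k -> comp h k = serZ -> comp k h = serZ ->
  divergent_model omega (comp k (comp F h)).
Proof.
move=> irr [mF oF bF nb] mh bh oh mk hk kh.
have irr' n := @lambda_irrational _ omega n irr; have lu := lambda_unit omega.
have [[oh1 ok1] oF1] := (multiplier_ord mh, multiplier_ord mk, multiplier_ord mF).
have bk : bounded k by exact: (bounded_inverse mh mk bh hk).
have odk : odd_map k by exact: (odd_inverse mh oh ok1 hk).
have oFh : ord 1 (comp F h) by exact: ord_comp.
set F1 := comp k (comp F h).
have mF1 : multiplier (lambda omega) F1.
  have lin f g c d : multiplier c f -> multiplier d g -> multiplier (c * d) (comp f g).
    move=> mf mg; have og := multiplier_ord mg; apply/multiplierP.
    move/multiplierP: (mf) => of_; have := ord_comp of_ og.
    rewrite compB (compM _ _ og) compC (id_comp og) => H.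
    apply: ord_trans H _; move/multiplierP: mg => og2.
    by rewrite rmorphM -mulrA -mulrBr; apply: ordMr.
  by have := lin _ _ _ _ mk (lin _ _ _ _ mF mh); rewrite mul1r mulr1.
have oF11 := multiplier_ord mF1.
split=> //.
- by apply: odd_comp => //; exact: odd_comp.
- by apply: bounded_comp => //; exact: bounded_comp.
move=> b1; apply: nb.
have [gam tg radE] := radial_factorE lu mF1.
have [oI _ II] := canonical_is_integral lu irr' mF1 tg radE.
set I1 := canonical _ F1 in b1 oI II *.
have oI1 : ord 1 I1 by apply: ord_le (canonical_ord mF1).
have kF : comp k F = comp F1 k.
  by rewrite /F1 (comp_assoc _ oFh ok1) (comp_assoc _ oh1 ok1) hk comp_id.
apply: (@canonical_bounded _ _ lu irr' F (comp I1 k) gam) => //; last exact: bounded_comp.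
split=> //.
  apply: (@ord_trans _ _ _ (comp (serZ * serW) k)).
    by rewrite -compB; apply: ord_comp.
  rewrite (compM _ _ ok1) -conjZ -conj_comp (id_comp ok1) conjZ; exact: norm_lead.
by rewrite (comp_assoc _ ok1 oF1) kF -(comp_assoc _ oF11 ok1) II (comp_assoc _ oI1 ok1).
Qed.

Lemma bounded_jet n f : bounded (jet n f).
Proof. by apply: (@polynomial_bounded _ n) => j k jk; rewrite /jet leqNgt jk. Qed.

Lemma poly_nonzero_near0 (p : {poly R}) : p != 0 ->
  forall r : R, 0 < r -> exists2 x, 0 < x < r & p.[x] != 0.
Proof.
move=> p0 r r0; apply: contrapT => H; move/eqP: p0; apply.
apply: (@roots_geq_poly_eq0 _ _ [seq r / i.+2%:R | i <- iota 0 (size p)]).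
- apply/allP => _ /mapP[i _ ->]; apply/negPn/negP => pi; apply: H.
  exists (r / i.+2%:R); last by move: pi; rewrite /root.
  by rewrite divr_gt0 //= ltr_pdivrMr // ltr_pMr // ltr1n.
- rewrite map_inj_uniq ?iota_uniq // => i j /(mulfI (lt0r_neq0 r0)) /invr_inj /eqP.
  by rewrite eqr_nat => /eqP[].
- by rewrite size_map size_iota.
Qed.

Lemma impoly_nonzero (q : {poly C}) n : complex.Im q`_n != 0 -> impoly q != 0.
Proof.
move=> qn; apply/negP => /eqP /(congr1 (fun p : {poly R} => p`_n)).
rewrite coef0 coef_poly; case: ltnP => [_ /eqP|qs _]; first by rewrite (negPf qn).
by move: qn; rewrite nth_default //= eqxx.
Qed.

(** A resonant normal form that preserves |z|^2 up to order N agrees to that order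
    with a twist T as above, and a member of its divergent family has the same
    jet. Undoing the normalization by its polynomial truncation preserves both
    the jet and the divergence. *)
Lemma conservative_model omega (N : nat) J h (Nf : ser C) : irrational omega -> (2 <= N)%N ->
  multiplier (lambda omega) J ->
  multiplier 1 h -> odd_map h -> multiplier (lambda omega) Nf -> resonant Nf ->
  comp h J = comp Nf h -> ord N.+2 (Nf * conj Nf - serZ * serW) ->
  exists2 F1, divergent_model omega F1 & same_jet N F1 J.
Proof.
move=> irr N2 mJ mh oh mNf rNf hJ NN; set l := lambda omega.
have lu := lambda_unit omega.
pose gt : {poly C} := \poly_(i < N.+1) Nf i.+1 i.
(* If g is the truncation of Nf / z, of modulus one up to order N, then
   (1 + conj(l) g) / (1 + l conj(g)) = conj(l) g, which makes l Q / conj Q agree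
   with g. The last term, too small to change the jet, makes Im q nonzero. *)
pose q : {poly C} := (2^-1)%:P * (1 + (l^*)%C%:P * gt) + ('i%C)%:P * 'X^(N.+2).
have gt0 : gt`_0 = l by rewrite coef_poly /=; case: mNf.
have q1 : q.[0] = 1.
  have X0 : ('X^(N.+2) : {poly C}).[0] = 0 by rewrite hornerXn expr0n.
  rewrite hornerD [X in _ + X]hornerM X0 mulr0 addr0 hornerM hornerC hornerD hornerM !hornerC.
  rewrite horner_coef0 gt0 [_ * l]mulrC lu.
  by rewrite -[1 + 1]/(2 : C) mulVf // pnatr_eq0.
have q_im : impoly q != 0.
  apply: (@impoly_nonzero q N.+2); rewrite coefD !coefCM coefXn eqxx mulr1 coefD coef1 coefCM.
  have -> : gt`_N.+2 = 0 by rewrite coef_poly ltnNge leqnSn.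
  have -> : (N.+2 == 0)%N = false by [].
  by rewrite mulr0 addr0 mulr0 add0r /= oner_eq0.
set Q := dpoly q; set G := dpoly gt; pose X : ser C := serZ * serW.
have QE : Q = serC 2^-1 * (1 + serC (l^*)%C * G) + serC 'i%C * X ^+ N.+2.
  by rewrite /Q /q dpolyD [dpoly (_ * 'X^_)]dpolyM dpoly_exp dpolyX dpolyM dpolyD dpolyM !dpolyC rmorph1.
have XJ : conj X = X by exact: conj_ZW.
have cQE : conj Q = serC 2^-1 * (1 + serC l * conj G) - serC 'i%C * X ^+ N.+2.
  rewrite QE conjD [conj (_ * X ^+ _)]conjM conjX XJ conjM conjD conj1 conjM !conjserC conjcK.
  rewrite fmorphV rmorph_nat (_ : (('i : C)^*)%C = - 'i%C); last first.
    by apply/eqP; rewrite eq_complex /= oppr0 !eqxx.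
  by rewrite rmorphN mulNr.
have wcQ : weight 0 (conj Q) by rewrite conj_dpoly; exact: weight_dpoly.
have bcQ : bounded (conj Q) by rewrite conj_dpoly; exact: bounded_dpoly.
have cQ1 : conj Q 0%N 0%N = 1.
  by rewrite conjE /Q dpolyE /diagonal /= -horner_coef0 q1 conjc1.
have [Qi [QQi bQi wQi]] := unit_inverse cQ1 bcQ wcQ.
pose U := serC l * Q * Qi.
have UQ : U * conj Q = serC l * Q by rewrite /U -mulrA [Qi * _]mulrC QQi mulr1.
have bU : bounded U.
  by apply: boundedM => //; apply: boundedM; [exact: bounded_cst | exact: bounded_dpoly].
have wC a : weight 0 (serC a : ser C) by move=> [|j] [|k].
have wU : weight 0 U.
  rewrite /U -[0](addr0 0); apply: weightM => //; rewrite -[0](addr0 0).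
  by apply: weightM => //; exact: weight_dpoly.
have N0 : (0 < N)%N by lia.
have near0 := poly_nonzero_near0 q_im.
have [s nb] := twist_divergent irr q1 N0 near0 wU UQ.
set F0 := twist N U s in nb.
have dF0 : divergent_model omega F0.
  split=> //; [exact: (twist_multiplier_s q1 N0 UQ) | exact: (twist_odd N0 wU) |].
  exact: twist_bounded.
have oX : ord 2 X by exact: ord2_ZW.
have oNG : ord N.+1 (Nf - serZ * G).
  apply/ord_subP => j k jk; rewrite /serZ monoM /G dpolyE /diagonal coef_poly.
  have [->|jk1] := eqVneq j k.+1; last first.
    rewrite rNf //; case: j jk jk1 => [|j] //= jk jk1; rewrite subn1 subn0 /=.
    by case: eqP => // jk2; rewrite jk2 eqxx in jk1.
  by rewrite /= subn1 subn0 eqxx; case: ltnP => //; lia.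
have oGG : ord N (G * conj G - 1).
  have H : ord N.+2 (X * (G * conj G - 1)).
    have -> : X * (G * conj G - 1) = (serZ * G - Nf) * conj (serZ * G)
        + Nf * conj (serZ * G - Nf) + (Nf * conj Nf - serZ * serW).
      by rewrite conjB !conjM conjZ /X; ring.
    have oNG' : ord N.+1 (serZ * G - Nf) by exact: ord_sym.
    apply: ordD => //; apply: ordD.
      by rewrite -addn1; apply: ordM => //; apply: ord_conj; apply: ordMl; exact: ord1Z.
    by rewrite -add1n; apply: ordM; [exact: (multiplier_ord mNf) | exact: ord_conj].
  move=> j k jk; have := H j.+1 k.+1; rewrite /X -[serZ * serW]/(mono 1 0 * mono 0 1) mono_mono.
  by rewrite monoM /= !subn1 /=; apply; lia.
have oUG : ord N (U - G).
  have -> : U - G = (U - G) * conj Q * Qi by rewrite -mulrA QQi mulr1.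
  apply: ordMl; rewrite mulrBl UQ.
  have -> : serC l * Q - G * conj Q = serC (- (l / 2)) * (G * conj G - 1)
      + serC 'i%C * (serC l + G) * X ^+ N.+2.
    rewrite cQE QE; have l1 : serC l * serC (l^*)%C = 1 :> ser C by rewrite -rmorphM lu rmorph1.
    rewrite rmorphN rmorphM /= (_ : serC l * _ = serC l * serC 2^-1 + serC 2^-1 * (serC l * serC (l^*)%C) * G
      + serC l * serC 'i%C * X ^+ N.+2); last by ring.
    rewrite l1; ring.
  apply: ordD; apply: ordMr => //.
  have oX1 : ord 1 X by apply: ord_le oX.
  by apply: ord_le (ord_exp N.+2 oX1); lia.
have oF0 : ord N.+1 (F0 - Nf).
  apply: (@ord_trans _ _ _ (serZ * U)).
    by apply: ord_le (@twist_jet _ omega q N q1 U UQ s); lia.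
  apply: (@ord_trans _ _ _ (serZ * G)); last exact: ord_sym.
  by rewrite -mulrBr -add1n; apply: ordM => //; exact: ord1Z.
pose ht := jet N h.
have oht : ord N.+1 (h - ht) by exact: ord_jet.
have mht : multiplier 1 ht.
  by case: mh => h0 h1 h2; split; rewrite /ht /jet /= ?N0.
have odht : odd_map ht.
  move/odd_mapP: oh => oh; apply/odd_mapP => j k jk; rewrite /ht /jet oh //; by case: ifP.
have [k [mk hk kh _]] := inverse_exists mht.
exists (comp k (comp F0 ht)).
  exact: (divergent_model_conjugate irr dF0 mht (bounded_jet N h) odht mk hk kh).
have [oh1 oht1] := (multiplier_ord mh, multiplier_ord mht).
have [oJ oNf] := (multiplier_ord mJ, multiplier_ord mNf); have ok := multiplier_ord mk.
have oF01 : ord 1 F0 by case: dF0 => /multiplier_ord.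
have A : ord N.+1 (comp F0 ht - comp ht J).
  apply: (@ord_trans _ _ _ (comp Nf ht)).
    by rewrite -compB; exact: ord_comp.
  apply: (@ord_trans _ _ _ (comp h J)); last by rewrite -compB; exact: ord_comp.
  rewrite hJ; have oht' := ord_sym oht.
  rewrite -[N.+1]addn0; apply: (@ord_subst_diff _ 1) => //; try exact: ord_conj.
  by rewrite -conjB; exact: ord_conj.
have B : ord N.+1 (comp k (comp F0 ht) - J).
  have -> : J = comp k (comp ht J) by rewrite -(comp_assoc _ oht1 oJ) kh (id_comp oJ).
  rewrite -[N.+1]addn0; apply: (@ord_subst_diff _ 1) => //.
  - exact: ord_comp.
  - by apply: ord_conj; exact: ord_comp.
  - by rewrite -conjB; exact: ord_conj.
by move=> j k' jk; move/ord_subP: B; apply.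
Qed.

End ConservativeJets.

(** * Area-preserving jets *)

Section Derivations.
Variable A : comNzRingType.
Implicit Types (f g u v : ser A).

Definition d1 f : ser A := fps_d1 f.
Definition d2 f : ser A := fps_d2 f.

Record derivation (D : ser A -> ser A) : Prop := {
  derD : forall f g, D (f + g) = D f + D g;
  derC : forall c, D (serC c) = 0;
  derM : forall f g, D (f * g) = D f * g + f * D g;
  der_ord : forall n f, ord n.+1 f -> ord n (D f) }.

Lemma derivation_d1 : derivation d1.
Proof.
split.
- by move=> f g; apply: serP => j k; rewrite /d1 /fps_d1 !ser_addE mulrDr.
- by move=> c; apply: serP => j k; rewrite /d1 /fps_d1 /serC /= mulr0.
- move=> f g; apply: serP => j k; rewrite /d1 /fps_d1 ser_addE !ser_coefM.
  transitivity (\sum_(a < j.+2) \sum_(b < k.+1) (a%:R * f a b) * g (j.+1 - a)%N (k - b)%N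
     + \sum_(a < j.+2) \sum_(b < k.+1) f a b * ((j.+1 - a)%:R * g (j.+1 - a)%N (k - b)%N)).
    rewrite -big_split mulr_sumr; apply: eq_bigr => a _ /=.
    rewrite -big_split mulr_sumr; apply: eq_bigr => b _ /=.
    rewrite -{1}(subnKC (ltn_ord a : (a <= j.+1)%N)) natrD; ring.
  congr (_ + _).
    by rewrite big_ord_recl /= big1 ?add0r // => b _; rewrite !mul0r.
  rewrite big_ord_recr /= [X in _ + X]big1 ?addr0 => [|b _]; last by rewrite subnn mul0r mulr0.
  by apply: eq_bigr => a _; apply: eq_bigr => b _; rewrite subSn // -ltnS.
- by move=> n f of_ j k jk; rewrite /d1 /fps_d1 of_ ?mulr0 //; lia.
Qed.

Lemma derivation_d2 : derivation d2.
Proof.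
split.
- by move=> f g; apply: serP => j k; rewrite /d2 /fps_d2 !ser_addE mulrDr.
- by move=> c; apply: serP => j k; rewrite /d2 /fps_d2 /serC /= andbF mulr0.
- move=> f g; apply: serP => j k; rewrite /d2 /fps_d2 ser_addE !ser_coefM.
  rewrite mulr_sumr -big_split; apply: eq_bigr => a _ /=.
  transitivity (\sum_(b < k.+2) (b%:R * f a b) * g (j - a)%N (k.+1 - b)%N
     + \sum_(b < k.+2) f a b * ((k.+1 - b)%:R * g (j - a)%N (k.+1 - b)%N)).
    rewrite -big_split mulr_sumr; apply: eq_bigr => b _ /=.
    rewrite -{1}(subnKC (ltn_ord b : (b <= k.+1)%N)) natrD; ring.
  congr (_ + _).
    by rewrite big_ord_recl /= !mul0r add0r.
  rewrite big_ord_recr /= subnn mul0r mulr0 addr0.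
  by apply: eq_bigr => b _; rewrite subSn // -ltnS.
- by move=> n f of_ j k jk; rewrite /d2 /fps_d2 of_ ?mulr0 //; lia.
Qed.

Lemma d1Z : d1 serZ = 1.
Proof. by apply: serP => -[|j] [|k]; rewrite /d1 /fps_d1 /serZ /mono /= ?mulr0 ?mulr1. Qed.
Lemma d1W : d1 serW = 0.
Proof. by apply: serP => -[|j] [|k]; rewrite /d1 /fps_d1 /serW /mono /= ?mulr0 ?mulr1. Qed.
Lemma d2Z : d2 serZ = 0.
Proof. by apply: serP => -[|j] [|k]; rewrite /d2 /fps_d2 /serZ /mono /= ?andbF ?mulr0 ?mulr1. Qed.
Lemma d2W : d2 serW = 1.
Proof. by apply: serP => -[|j] [|k]; rewrite /d2 /fps_d2 /serW /mono /= ?mulr0 ?mulr1. Qed.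

(** Both sides are derivations of f, which agree on the two indeterminates. *)
Lemma chain_rule D f u v : derivation D -> ord 1 u -> ord 1 v ->
  D (subst f u v) = subst (d1 f) u v * D u + subst (d2 f) u v * D v.
Proof.
move=> dD ou ov; have [dd1 dd2] := (derivation_d1, derivation_d2).
pose chain g := D (subst g u v) = subst (d1 g) u v * D u + subst (d2 g) u v * D v.
have chainD g1 g2 : chain g1 -> chain g2 -> chain (g1 + g2).
  move=> c1 c2; rewrite /chain substD (derD dD) c1 c2 (derD dd1) (derD dd2) !substD; ring.
have chainM g1 g2 : chain g1 -> chain g2 -> chain (g1 * g2).
  move=> c1 c2; rewrite /chain substM // (derM dD) c1 c2 (derM dd1) (derM dd2).
  by rewrite !substD !substM //; ring.
have chainC c : chain (serC c).
  by rewrite /chain substC (derC dD) (derC dd1) (derC dd2) !subst0 !mul0r addr0.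
have chainX g n : chain g -> chain (g ^+ n).
  move=> cg; elim: n => [|n IH]; last by rewrite exprS; exact: chainM.
  by rewrite expr0 -(rmorph1 (@serC A)); exact: chainC.
have chain_mono a b : chain (mono a b).
  rewrite monoE; apply: chainM; apply: chainX.
    by rewrite /chain substZ // d1Z d2Z subst1 // subst0 mul1r mul0r addr0.
  by rewrite /chain substW // d1W d2W subst1 // subst0 mul1r mul0r add0r.
have chain_sum I (r : seq I) (g : I -> ser A) :
    (forall i, chain (g i)) -> chain (\sum_(i <- r) g i).
  move=> cg; elim: r => [|i r IH]; last by rewrite big_cons; exact: chainD.
  by rewrite big_nil -(rmorph0 (@serC A)); exact: chainC.
have chain_jet n : chain (jet n f).
  have [F ->] := jet_sum n f; apply: (chain_sum) => a; apply: (chain_sum) => b.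
  exact: chainM.
apply: ord_eq => n; have [r or fE] : exists2 r, ord n.+1 r & f = jet n f + r.
  by exists (f - jet n f); [exact: ord_jet | rewrite addrC subrK].
rewrite {1 2 3}fE substD (derD dD) (chain_jet n) (derD dd1) (derD dd2) !substD.
rewrite [X in ord _ X](_ : _ = D (subst r u v) - subst (d1 r) u v * D u - subst (d2 r) u v * D v); last by ring.
apply: ordB; first apply: ordB.
- by apply: (der_ord dD); exact: ord_subst.
- by apply: ordMl; apply: ord_subst => //; exact: (der_ord dd1).
- by apply: ordMl; apply: ord_subst => //; exact: (der_ord dd2).
Qed.

Lemma subst_swap f j k : subst f serW serZ j k = f k j.
Proof.
have [kj jk] : (k < (j + k).+1)%N /\ (j < (j + k).+1)%N by lia.
have E a b : (serW ^+ a * serZ ^+ b : ser A) j k = ((j == b) && (k == a))%:R.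
  by rewrite mulrC -monoE.
rewrite subst_coef (bigD1 (Ordinal kj)) //= (bigD1 (Ordinal jk)) //= E !eqxx mulr1.
rewrite big1 => [|b]; last by rewrite -val_eqE /= E eq_sym => /negPf ->; rewrite mulr0.
rewrite big1 ?addr0 // => a; rewrite -val_eqE /= eq_sym => /negPf ka; rewrite big1 // => b _.
by rewrite E ka andbF mulr0.
Qed.

End Derivations.

Section Jacobian.
Variable R : realType.
Local Notation C := R[i].
Implicit Types (F G f g h J : ser C).

Definition jac F : ser C := d1 F * d2 (conj F) - d2 F * d1 (conj F).

Lemma jac_comp F G : ord 1 G -> jac (comp F G) = comp (jac F) G * jac G.
Proof.
move=> oG; have ocG := ord_conj oG.
have [dd1 dd2] := (derivation_d1 C, derivation_d2 C).
rewrite /jac conj_comp !compE !(chain_rule _ dd1 oG ocG) !(chain_rule _ dd2 oG ocG).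
by rewrite substB !substM //; ring.
Qed.

Lemma jac_agree F G n : ord n.+1 (F - G) -> ord n (jac F - jac G).
Proof.
move=> FG; have [dd1 dd2] := (derivation_d1 C, derivation_d2 C).
have derB D f g : derivation D -> D (f - g) = D f - D g.
  move=> dD; have := derD dD (f - g) g; rewrite subrK => ->; by rewrite addrK.
have cFG : ord n.+1 (conj F - conj G) by rewrite -conjB; exact: ord_conj.
have o1 := der_ord dd1 FG; have o2 := der_ord dd2 FG.
have o3 := der_ord dd1 cFG; have o4 := der_ord dd2 cFG.
rewrite !(derB _ _ _ dd1) in o1 o3; rewrite !(derB _ _ _ dd2) in o2 o4.
rewrite /jac (_ : _ - _ = (d1 F - d1 G) * d2 (conj F) + d1 G * (d2 (conj F) - d2 (conj G))
  - ((d2 F - d2 G) * d1 (conj F) + d2 G * (d1 (conj F) - d1 (conj G)))); last by ring.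
by apply: ordB; apply: ordD; first [exact: ordMl | exact: ordMr].
Qed.

Lemma jac_tangent h : multiplier 1 h -> jac h 0%N 0%N = 1.
Proof.
move=> [h0 h1 h2]; rewrite /jac ser_subE !ser_coefM !big_ord1 /d1 /d2 /fps_d1 /fps_d2 !conjE.
by rewrite h1 h2 conjc0 conjc1 !mulr1 !mulr0 subr0.
Qed.

(** For f = z u(x), x = z w, both sides are w times the derivative of x u conj(u)
    with respect to x. *)
Lemma jac_resonant f : resonant f -> serW * jac f = d1 (f * conj f).
Proof.
move=> rf; have dd1 := derivation_d1 C.
have Zd g j k : (serZ * d1 g) j k = j%:R * g j k.
  by rewrite /serZ monoM; case: j => [|j] /=; rewrite ?mul0r // subn1 subn0.
have Wd g j k : (serW * d2 g) j k = k%:R * g j k.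
  by rewrite /serW monoM /=; case: k => [|k] /=; rewrite ?mul0r // subn1 subn0.
have E1 : serZ * d1 f = f + serW * d2 f.
  apply: serP => j k; rewrite ser_addE Zd Wd.
  have [->|/rf ->] := eqVneq j k.+1; last by rewrite !mulr0 addr0.
  by rewrite -natr1; ring.
have E2 : serW * d2 (conj f) = conj f + serZ * d1 (conj f).
  apply: serP => j k; rewrite ser_addE Zd Wd conjE.
  have [->|/rf ->] := eqVneq k j.+1; last by rewrite conjc0 !mulr0 addr0.
  by rewrite -natr1; ring.
rewrite (derM dd1) /jac mulrBr mulrCA E2 mulrA.
have -> : serW * d2 f = serZ * d1 f - f by rewrite E1 addrC addKr.
ring.
Qed.

(** The linear change L from (x, y) to (z, w) = (x + i y, x - i y) on the source,
    and the same one on the target, multiply the Jacobian by -2 i and by its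
    inverse. *)
Lemma area_preserving_jac F : area_preserving F -> jac F = 1.
Proof.
move=> aF; pose L1 : ser C := fps_lin 1 'i%C; pose L2 : ser C := fps_lin 1 (- 'i%C).
have [dd1 dd2] := (derivation_d1 C, derivation_d2 C).
have i2 : ('i%C : C) * 'i%C = -1 by rewrite -expr2 sqr_i.
have L1E : L1 = serZ + serC 'i%C * serW by rewrite /L1 fps_linE rmorph1 mul1r.
have L2E : L2 = serZ - serC 'i%C * serW by rewrite /L2 fps_linE rmorph1 mul1r rmorphN mulNr.
have [oZ oW] : ord 1 (serZ : ser C) /\ ord 1 (serW : ser C) by split; [exact: ord1Z | exact: ord1W].
have oL1 : ord 1 L1 by rewrite L1E; apply: ordD => //; exact: ordMr.
have oL2 : ord 1 L2 by rewrite L2E; apply: ordB => //; exact: ordMr.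
pose P := subst F L1 L2; pose P' := subst (conj F) L1 L2.
have ci : (('i%C : C)^*)%C = - 'i%C by apply/eqP; rewrite eq_complex /= oppr0 !eqxx.
have P'E j k : P' j k = ((P j k)^*)%C.
  have sL (c : C) : subst (serW + serC c * serZ) serW serZ = serZ + serC c * serW.
    by rewrite substD substM // substC substZ // substW.
  have cL1 : conj L1 = serW + serC (- 'i%C) * serZ.
    by rewrite L1E conjD conjM conjZ conjW conjserC ci.
  have cL2 : conj L2 = serW + serC 'i%C * serZ.
    by rewrite L2E conjB conjM conjZ conjW conjserC ci rmorphN mulNr opprK.
  have <- : subst (conj P) serW serZ = P'.
    rewrite /P conj_subst subst_assoc //; [|exact: ord_conj|exact: ord_conj].
    by rewrite cL1 cL2 !sL rmorphN mulNr -L1E -L2E.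
  by rewrite subst_swap conjE.
pose CU : ser C := fun j k => ((complex.Re (P j k))%:C)%C.
pose CV : ser C := fun j k => ((complex.Im (P j k))%:C)%C.
have PE : P = CU + serC 'i%C * CV.
  apply: serP => j k; rewrite ser_addE serCM /CU /CV; case: (P j k) => x y.
  by apply/eqP; rewrite eq_complex /=; apply/andP; split; apply/eqP; ring.
have PE' : P' = CU - serC 'i%C * CV.
  apply: serP => j k; rewrite P'E ser_subE serCM /CU /CV; case: (P j k) => x y.
  by apply/eqP; rewrite eq_complex /=; apply/andP; split; apply/eqP; ring.
have JUV : d1 CU * d2 CV - d2 CU * d1 CV = 1.
  apply: serP => j k; have E : fps_jacobian F = fps_one R := aF.
  have := congr1 (fun f : fps R => ((f j k)%:C)%C) E; rewrite /fps_jacobian /fps_one.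
  have emb (x y : fps R) (x' y' : ser C) : (forall a b, x' a b = ((x a b)%:C)%C) ->
      (forall a b, y' a b = ((y a b)%:C)%C) -> (x' * y') j k = ((fps_mul x y j k)%:C)%C.
    move=> xE yE; rewrite (ser_mulE (x : ser R) y) !ser_coefM rmorph_sum; apply: eq_bigr => a _.
    by rewrite rmorph_sum; apply: eq_bigr => b _; rewrite xE yE -rmorphM.
  have e1 (x : fps R) a b : d1 (fun j k => ((x j k)%:C)%C) a b = ((fps_d1 x a b)%:C)%C.
    by rewrite /d1 /fps_d1 rmorphM rmorph_nat.
  have e2 (x : fps R) a b : d2 (fun j k => ((x j k)%:C)%C) a b = ((fps_d2 x a b)%:C)%C.
    by rewrite /d2 /fps_d2 rmorphM rmorph_nat.
  pose Ur : fps R := fun a b => complex.Re (real_coords F a b).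
  pose Vr : fps R := fun a b => complex.Im (real_coords F a b).
  move=> E'; rewrite ser_subE.
  have -> : (d1 CU * d2 CV) j k = _ := emb _ _ _ _ (e1 Ur) (e2 Vr).
  have -> : (d2 CU * d1 CV) j k = _ := emb _ _ _ _ (e2 Ur) (e1 Vr).
  by rewrite -rmorphB [LHS]E' rmorph_nat.
have J1 : subst (jac F) L1 L2 = 1.
  have [d1L1 d1L2] : d1 L1 = 1 /\ d1 L2 = 1.
    rewrite L1E L2E -mulNr -rmorphN !(derD dd1) !(derM dd1) !(derC dd1) d1Z d1W.
    by rewrite !mul0r !mulr0 !addr0.
  have [d2L1 d2L2] : d2 L1 = serC 'i%C /\ d2 L2 = - serC 'i%C.
    rewrite L1E L2E -mulNr -rmorphN !(derD dd2) !(derM dd2) !(derC dd2) d2Z d2W.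
    by rewrite !mul0r !mulr1 !add0r.
  have p1 := chain_rule F dd1 oL1 oL2; have p2 := chain_rule F dd2 oL1 oL2.
  have q1 := chain_rule (conj F) dd1 oL1 oL2; have q2 := chain_rule (conj F) dd2 oL1 oL2.
  rewrite -/P d1L1 d1L2 !mulr1 in p1; rewrite -/P d2L1 d2L2 in p2.
  rewrite -/P' d1L1 d1L2 !mulr1 in q1; rewrite -/P' d2L1 d2L2 in q2.
  have DP D : derivation D -> D P = D CU + serC 'i%C * D CV /\ D P' = D CU - serC 'i%C * D CV.
    move=> dD; rewrite PE PE' -mulNr -rmorphN !(derD dD) !(derM dD) !(derC dD) !mul0r !add0r.
    by rewrite rmorphN mulNr.
  have [r1 s1] := DP _ dd1; have [r2 s2] := DP _ dd2.
  set a := subst (d1 F) L1 L2 in p1 p2; set b := subst (d2 F) L1 L2 in p1 p2.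
  set a' := subst (d1 (conj F)) L1 L2 in q1 q2; set b' := subst (d2 (conj F)) L1 L2 in q1 q2.
  have -> : subst (jac F) L1 L2 = a * b' - b * a' by rewrite /jac substB !substM.
  have I2 : serC 'i%C * serC 'i%C = - 1 :> ser C by rewrite -rmorphM i2 rmorphN rmorph1.
  have two : serC 2^-1 * (1 + 1) = 1 :> ser C.
    by rewrite -(rmorph1 (@serC C)) -rmorphD -rmorphM mulVf // pnatr_eq0.
  have E1 : d1 P * d2 P' - d2 P * d1 P' = - (1 + 1) * serC 'i%C * (a * b' - b * a').
    by rewrite p1 p2 q1 q2; ring.
  have E2 : d1 P * d2 P' - d2 P * d1 P' = - (1 + 1) * serC 'i%C.
    rewrite r1 r2 s1 s2; rewrite -[RHS]mulr1 -[X in _ = _ * X]JUV; ring.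
  have E3 : (1 + 1) * (a * b' - b * a') = 1 + 1 :> ser C.
    rewrite -[LHS]mul1r -[X in X * _ = _]opprK -I2 -[RHS]mul1r -[X in _ = X * _]opprK -I2.
    have := congr1 (fun f => serC 'i%C * f) (etrans (esym E1) E2) => /= E4.
    rewrite [LHS](_ : _ = serC 'i%C * (- (1 + 1) * serC 'i%C * (a * b' - b * a'))); last by ring.
    by rewrite E4; ring.
  by rewrite -[LHS]mul1r -two -mulrA E3.
pose K1 : ser C := serC 2^-1 * (serZ + serW).
pose K2 : ser C := serC (- 'i%C / 2) * (serZ - serW).
have oK1 : ord 1 K1 by apply: ordMr; exact: ordD.
have oK2 : ord 1 K2 by apply: ordMr; exact: ordB.
have h2 : serC 2^-1 + serC 2^-1 = 1 :> ser C.
  rewrite -rmorphD -[2^-1 in X in X + _]mulr1 -[2^-1 in X in _ + X]mulr1 -mulrDr.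
  by rewrite -[1 + 1]/(2 : C) mulVf ?pnatr_eq0 // rmorph1.
have IK : serC 'i%C * K2 = serC 2^-1 * (serZ - serW).
  by rewrite /K2 mulrA -rmorphM mulrA mulrN i2 opprK mul1r.
have EL1 : subst L1 K1 K2 = serZ.
  rewrite L1E substD substM // substC substZ // substW // IK /K1 -mulrDr.
  rewrite (_ : _ + _ + _ = serZ + serZ); last by ring.
  by rewrite mulrDr -mulrDl h2 mul1r.
have EL2 : subst L2 K1 K2 = serW.
  rewrite L2E substB substM // substC substZ // substW // IK /K1 -mulrBr.
  rewrite (_ : _ + _ - _ = serW + serW); last by ring.
  by rewrite mulrDr -mulrDl h2 mul1r.
have := congr1 (fun f => subst f K1 K2) J1 => /=.
by rewrite subst_assoc // EL1 EL2 subst_id subst1.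
Qed.

End Jacobian.

Section ConservativeNormalForms.
Variable R : realType.
Local Notation C := R[i].
Implicit Types (F G f g h J : ser C).

Section AreaPreserving.
Variables (l : C) (N : nat) (J h Nf : ser C).
Hypothesis l_unit : l * (l^*)%C = 1.
Hypotheses (mJ : multiplier l J) (mh : multiplier 1 h) (mN : multiplier l Nf).
Hypotheses (rN : resonant Nf) (hJ : comp h J = comp Nf h).
Hypothesis jJ : ord N (jac J - 1).

(** If x = z w and Nf conj(Nf) = p(x), the Jacobian of Nf is p'(x). The
    conjugacy h transports the area to a density tau with
    tau o Nf = p'(x) tau; at the order of the first term of p(x) - x, the two
    sides have different coefficients of x^m. *)
Lemma area_preserving_normal_form : ord N.+2 (Nf * conj Nf - serZ * serW).
Proof.
have [[oh oJ] oN] := (multiplier_ord mh, multiplier_ord mJ, multiplier_ord mN).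
have [k [mk hk kh _]] := inverse_exists mh; have ok := multiplier_ord mk.
have FN : comp k Nf = comp J k.
  rewrite -[comp k Nf]comp_id -hk -[in LHS]comp_assoc // [comp (comp k Nf) h]comp_assoc //.
  by rewrite -hJ -comp_assoc // kh id_comp.
pose tau := comp (jac h) k.
have tau0 : tau 0%N 0%N = 1.
  by rewrite /tau compE subst_coef !big_ord1 !expr0 mulr1 mulr1 jac_tangent.
have tauN : ord N (comp tau Nf - jac Nf * tau).
  have E : comp (jac h) J * jac J = comp (jac Nf) h * jac h.
    by rewrite -(jac_comp h oJ) -(jac_comp Nf oh) hJ.
  have E1 : ord N (comp (comp (jac h) J - comp (jac Nf) h * jac h) k).
    apply: ord_comp => //; rewrite -E (_ : _ - _ = - (comp (jac h) J * (jac J - 1))); last by ring.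
    by apply: ordN; exact: ordMr.
  have -> // : comp tau Nf - jac Nf * tau = comp (comp (jac h) J - comp (jac Nf) h * jac h) k.
  rewrite compB (compM _ _ ok) (comp_assoc _ oh ok) hk comp_id.
  by rewrite /tau (comp_assoc _ ok oN) FN (comp_assoc _ oJ ok).
have [p [p0 p1] pE] := resonant_norm_diagonal l_unit mN rN.
have dE m : jac Nf m m = m.+1%:R * p m.+1.
  have := congr1 (fun f : ser C => f m m.+1) (jac_resonant rN).
  by rewrite pE /serW monoM /= subn0 subn1 /d1 /fps_d1 /diagonal eqxx.
have wjac : weight 0 (jac Nf).
  move=> a b ab; have := congr1 (fun f : ser C => f a b.+1) (jac_resonant rN).
  rewrite pE /serW monoM /= subn0 subn1 /d1 /fps_d1 /diagonal => ->.
  by case: eqP => [[ab']|_]; [move: ab; rewrite ab' subrr eqxx | rewrite mulr0].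
have main m : (1 <= m)%N -> (m.*2 < N)%N ->
    (forall i, (i <= m)%N -> p i = (i == 1%N)%:R) -> p m.+1 = 0.
  move=> m1 mN2 pm; pose X : ser C := serZ * serW.
  have Xp a : X ^+ a = mono a a by rewrite exprMn -monoE.
  have oP : ord m.*2.+2 (Nf * conj Nf - X).
    apply/ord_subP => a b ab; rewrite pE /diagonal -[X]expr1 Xp /mono.
    case: (eqVneq a b) => [ab'|ab']; last first.
      by case: eqP => // a1; case: eqP => // b1; rewrite a1 b1 eqxx in ab'.
    by rewrite pm -?ab' ?andbb //; move: ab; rewrite -ab'; lia.
  have oX1 : ord 1 X by apply: ord_le (@ord2_ZW _).
  have oP1 : ord 1 (Nf * conj Nf) by exact: ordMl.
  (* Nf preserves x up to order m, hence the coefficient of x^m in tau. *)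
  have lhs : comp tau Nf m m = tau m m.
    rewrite compE subst_coef.
    have mm : (m < (m + m).+1)%N by lia.
    rewrite (bigD1 (Ordinal mm)) //= (bigD1 (Ordinal mm)) //=.
    have pw a : (Nf ^+ a * conj Nf ^+ a) m m = (a == m)%:R.
      rewrite -exprMn; have := ord_powers_diff (n := m.*2.+2) (u := X) (v := X)
        (u' := Nf * conj Nf) (v' := X) (a := a) (b := 0) (isT : (0 < m.*2.+2)%N) oX1 oX1 oP.
      rewrite !expr0 !mulr1 subrr => /(_ (@ord_zero _ _)) H.
      case: a H => [|a] H.
        by rewrite expr0 -[1]/(mono 0 0) /mono andbb eq_sym.
      have /ord_subP -> := H isT; last by lia.
      by rewrite Xp /mono andbb eq_sym.
    rewrite pw eqxx mulr1 big1 => [|b]; last first.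
      rewrite -val_eqE /= => bm.
      have -> : (Nf ^+ m * conj Nf ^+ b) m m = 0; last by rewrite mulr0.
      have : weight (1 * m%:Z + (-1) * b%:Z) (Nf ^+ m * conj Nf ^+ b).
        by apply: weightM; apply: weightX; [|apply: weight_conj]; exact: weight_resonant.
      by apply; move: bm; lia.
    rewrite addr0 big1 ?addr0 // => a; rewrite -val_eqE /= => am; rewrite big1 // => b _.
    have [ba|ba] := eqVneq (b : nat) a; first by rewrite ba pw (negPf am) mulr0.
    have -> : (Nf ^+ a * conj Nf ^+ b) m m = 0; last by rewrite mulr0.
    have : weight (1 * a%:Z + (-1) * b%:Z) (Nf ^+ a * conj Nf ^+ b).
      by apply: weightM; apply: weightX; [|apply: weight_conj]; exact: weight_resonant.
    by apply; move: ba; lia.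
  (* In p'(x) tau the term (m + 1) p_(m+1) x^m is added, as tau(0) = 1. *)
  have rhs : (jac Nf * tau) m m = tau m m + m.+1%:R * p m.+1.
    have oj : ord m.*2 (jac Nf - 1).
      apply/ord_subP => a b ab; have [ab'|ab'] := eqVneq a b; last first.
        by rewrite wjac ?(@weight1 R) //; move: ab'; lia.
      rewrite -ab' dE pm; last by move: ab; rewrite -ab'; lia.
      by rewrite -[1 in RHS]/(mono 0 0) /mono andbb; case: a {ab ab'} => [|a]; rewrite ?mulr1 ?mulr0.
    have -> : jac Nf * tau = tau + (jac Nf - 1) + (jac Nf - 1) * (tau - 1) by ring.
    have ot : ord 1 (tau - 1) by move=> [|a] [|b] //= _; rewrite ser_subE tau0 subrr.
    rewrite !ser_addE (ordM oj ot) ?addr0; last by lia.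
    rewrite ser_oppE dE; have -> : (1 : ser C) m m = 0; last by rewrite subr0.
    by rewrite -[1]/(mono 0 0) /mono andbb eqn0Ngt m1.
  have /ord_subP := tauN => /(_ m m); rewrite -addnn in mN2 * => /(_ mN2).
  rewrite lhs rhs => /eqP; rewrite -subr_eq0 opprD addrA subrr add0r oppr_eq0.
  by rewrite mulf_eq0 pnatr_eq0 /= => /eqP.
have pall i : (i.*2 < N.+2)%N -> p i = (i == 1%N)%:R.
  elim/ltn_ind: i => -[|[|m]] IH iN //=.
  by apply: main => // i im; apply: IH; lia.
apply/ord_subP => a b ab; rewrite pE /diagonal -[serZ * serW]/(mono 1 0 * mono 0 1) mono_mono /mono.
case: (eqVneq a b) => [ab'|ab']; last first.
  by case: eqP => // a1; case: eqP => // b1; rewrite a1 b1 eqxx in ab'.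
by rewrite pall -?ab' ?andbb // -addnn {2}ab'.
Qed.

End AreaPreserving.

(** Without the normalization on the line w = z, the map h and all the defects
    stay holomorphic, and z is the only holomorphic resonant monomial. *)
Lemma holomorphic_normal_form (l : C) J : multiplier l J ->
  (forall j k, (0 < k)%N -> J j k = 0) -> nf_form false l J = serC l * serZ.
Proof.
move=> mJ hJ; pose holo f := forall j k, (0 < k)%N -> f j k = 0.
have holoM f g : holo f -> holo g -> holo (f * g).
  move=> hf hg j k k0; rewrite ser_coefM big1 // => a _; rewrite big1 // => b _.
  case: (posnP b) => [->|b0]; last by rewrite hf // mul0r.
  by rewrite hg ?mulr0 // subn0.
have holoX f n : holo f -> holo (f ^+ n).
  move=> hf; elim: n => [|n IH]; last by rewrite exprS; exact: holoM.
  by move=> [|j] [|k].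
have holo_comp f g : holo f -> holo g -> holo (comp f g).
  move=> hf hg j k k0; rewrite compE subst_coef big1 // => a _; rewrite big1 // => b _.
  case: (posnP b) => [->|b0]; last by rewrite hf // mul0r.
  by rewrite expr0 mulr1 holoX // mulr0.
have holoZ : holo (serZ : ser C) by move=> [|[|j]] [|k].
have holoC c f : holo f -> holo (serC c * f) by move=> hf j k k0; rewrite serCM hf // mulr0.
have stage m : holo (nf_stage false l J m).1 /\ (nf_stage false l J m).2 = serC l * serZ.
  elim: m => [|m [IH1 IH2]] //=.
  have hE : holo (nf_defect J (nf_stage false l J m).1 (nf_stage false l J m).2).
    have h1 := holo_comp _ _ IH1 hJ.
    have h2 : holo (comp (nf_stage false l J m).2 (nf_stage false l J m).1).
      by apply: holo_comp => //; rewrite IH2; exact: holoC.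
    by move=> j k k0; rewrite /nf_defect ser_subE h1 // h2 // subrr.
  split=> [j k k0 /=|].
    by case: ifP => _; [rewrite /nf_quotient hE // oppr0 mul0r addr0 | exact: IH1].
  apply: serP => j k; case: ifP => [/andP[/eqP jk /eqP jk1]|_]; last by rewrite IH2.
  rewrite hE; last by lia.
  by rewrite serCM /serZ /mono; case: k jk jk1 => [|k]; rewrite ?andbF ?mulr0 //; lia.
apply: serP => j k; rewrite /nf_form; by rewrite (stage _).2.
Qed.

End ConservativeNormalForms.

(** * The models for the prescribed jets *)

Section Models.
Variable R : realType.
Local Notation C := R[i].

Lemma conservative_jet_model (omega : R) (N : nat) (J : ser C) (normalized : bool) :
  irrational omega -> (2 <= N)%N -> odd_polynomial omega N J ->
  let Nf := nf_form normalized (lambda omega) J in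
  ord N.+2 (Nf * conj Nf - serZ * serW) ->
  exists2 F1 : ser C, divergent_model omega F1 & same_jet N F1 J.
Proof.
move=> irr N2 [mJ _ oJ] Nf NN; have lu := lambda_unit omega.
have irr' n := @lambda_irrational _ omega n irr.
have [mh mN] := nf_multipliers (lambda omega) normalized J.
have [oh _] := odd_nf normalized mJ oJ.
apply: (conservative_model irr N2 mJ mh oh mN (@nf_form_resonant _ _ _ _)) => //.
exact: nf_conjugacy.
Qed.

Lemma holomorphic_model (omega : R) (N : nat) (J : ser C) :
  irrational omega -> (2 <= N)%N -> odd_polynomial omega N J ->
  (forall j k, (0 < k)%N -> J j k = 0) ->
  exists2 F1 : ser C, divergent_model omega F1 & same_jet N F1 J.
Proof.
move=> irr N2 oJ hJ; apply: (conservative_jet_model (normalized := false)) => //.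
case: oJ => mJ _ _; rewrite (holomorphic_normal_form mJ hJ) conjM conjserC conjZ mulrACA.
by rewrite -rmorphM lambda_unit rmorph1 mul1r subrr; exact: ord_zero.
Qed.

Lemma area_preserving_model (omega : R) (N : nat) (J A : ser C) :
  irrational omega -> (2 <= N)%N -> odd_polynomial omega N J ->
  area_preserving A -> same_jet N A J ->
  exists2 F1 : ser C, divergent_model omega F1 & same_jet N F1 J.
Proof.
move=> irr N2 oJ aA AJ; apply: (conservative_jet_model (normalized := true)) => //.
case: oJ => mJ _ _; have lu := lambda_unit omega.
have irr' n := @lambda_irrational _ omega n irr.
have [mh mN] := nf_multipliers (lambda omega) true J.
apply: (area_preserving_normal_form lu mJ mh mN (@nf_form_resonant _ _ _ _)).
  exact: nf_conjugacy.
rewrite -(area_preserving_jac aA); apply: jac_agree; apply/ord_subP => j k jk.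
by rewrite AJ.
Qed.

(** Without a prescribed jet, the linear one will do. *)
Lemma rotation_model (omega : R) : irrational omega ->
  exists F1 : ser C, divergent_model omega F1.
Proof.
move=> irr; have mJ : multiplier (lambda omega) (serC (lambda omega) * serZ : ser C).
  by split; rewrite serCM /serZ /mono ?mulr0 ?mulr1.
have [||F1 dF _] := @holomorphic_model omega 2 (serC (lambda omega) * serZ) irr isT.
- split=> //.
    by move=> [|[|j]] [|k] //=; rewrite serCM /serZ /mono ?mulr0.
  by apply/odd_mapP => -[|[|j]] [|k] //=; rewrite serCM /serZ /mono ?mulr0.
- by move=> [|[|j]] [|k] //=; rewrite serCM /serZ /mono ?mulr0.
by exists F1.
Qed.

End Models.

Theorem theorem2 (R : realType) (omega : R) (homega : irrational omega) :
  (* (i) *)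
  (forall D : R, 0 < D ->
     generic D (Fodd omega D) (@all_normalizations_divergent R)) /\
  (* (i') *)
  (forall D : R, 0 < D ->
     generic D (Fodd omega D `&` [set F | ~ formally_conservative F])
       (@all_normalizations_divergent R)) /\
  (* (ii) *)
  (forall D : R, 0 < D ->
   forall (N : nat) (J : nat -> nat -> R[i]), (2 <= N)%N ->
     odd_polynomial omega N J ->
     infinite_set [set k : nat | (0 < k)%N /\
       (k`!)%:R <= `|lambda omega ^+ (2 * k) - 1|^-1] ->
     generic D (FoddJ omega D N J) (@all_normalizations_divergent R)) /\
  (* (iii) *)
  (forall (N : nat) (J : nat -> nat -> R[i]), (2 <= N)%N ->
     odd_polynomial omega N J ->
     (forall j k : nat, (0 < k)%N -> J j k = 0) ->
     exists D0 : R, 0 < D0 /\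
       forall D : R, 0 < D -> D <= D0 -> non_bruno omega ->
         generic D (FoddJ omega D N J) (@all_normalizations_divergent R)) /\
  (* (iv) *)
  (forall D : R, 0 < D ->
   forall (N : nat) (J : nat -> nat -> R[i]), (2 <= N)%N ->
     odd_polynomial omega N J ->
     (exists A : nat -> nat -> R[i], area_preserving A /\ same_jet N A J) ->
     generic D (FoddJ omega D N J) (@all_normalizations_divergent R)).
Proof.
split; [|split; [|split; [|split]]].
- move=> D D0; have [F1 dF] := rotation_model homega.
  exact: (generic_odd D0 homega dF).
- move=> D D0; have [F1 dF] := rotation_model homega.
  exact: (generic_nonconservative D0 homega dF).
- move=> D D0 N J N2 oJ iA; apply: (generic_jet D0 homega (F1 := digit_model (lambda omega) N J)).
    exact: digit_model_divergent.
  by case: oJ => mJ _ _; exact: digit_model_jet.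
- move=> N J N2 oJ hJ; exists 1; split=> // D D0 _ _.
  have [F1 dF jF] := holomorphic_model homega N2 oJ hJ.
  exact: (generic_jet D0 homega dF jF).
- move=> D D0 N J N2 oJ [A [aA AJ]].
  have [F1 dF jF] := area_preserving_model homega N2 oJ aA AJ.
  exact: (generic_jet D0 homega dF jF).
Qed.
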